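(* Let $\lambda_1,\lambda_2$ be real with $1+\lambda_1>0$, $1+\lambda_2>0$, $1+\lambda_1+\lambda_2>0$, let $q\in\mathbb{C}$ be fixed, and let $$ \mathfrak M(q\,|\,\tau,\lambda_1,\lambda_2)=\frac{\tau^{q/\tau}}{\Gamma^q\bigl(1-\frac1\tau\bigr)}\, \frac{\Gamma_2(\tau(\lambda_1+\lambda_2+1)+1-q\,|\,\tau)}{\Gamma_2(\tau(\lambda_1+\lambda_2+1)+1\,|\,\tau)}\, \frac{\Gamma_2(-q+\tau\,|\,\tau)}{\Gamma_2(\tau\,|\,\tau)}\, \frac{\Gamma_2(\tau(1+\lambda_1)+1\,|\,\tau)}{\Gamma_2(\tau(1+\lambda_1)+1-q\,|\,\tau)}\, \frac{\Gamma_2(\tau(1+\lambda_2)+1\,|\,\tau)}{\Gamma_2(\tau(1+\lambda_2)+1-q\,|\,\tau)} . $$ Then $\log\mathfrak M(q\,|\,\tau,\lambda_1,\lambda_2)$ has, in the limit $\tau\to\infty$, the asymptotic expansion $$ \log\mathfrak M(q\,|\,\tau,\lambda_1,\lambda_2)\sim q\Bigl(\log\Gamma(1+\lambda_1+\lambda_2)-\log\Gamma(1+\lambda_1)-\log\Gamma(1+\lambda_2)\Bigr) $$ $$ +\sum_{p=1}^\infty\frac1{p\,\tau^p}\Bigl[\bigl(\zeta(p,1+\lambda_1+\lambda_2)-\zeta(p,1+\lambda_1)-\zeta(p,1+\lambda_2)\bigr)\frac{B_{p+1}(q)-B_{p+1}}{p+1}+\zeta(p)\,\frac{B_{p+1}(q+1)-B_{p+1}}{p+1}-q\,\zeta(p)\Bigr].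 $$
   Context: $\Gamma_2(z\,|\,\tau)$ is the Barnes double gamma function with parameters $(1,\tau)$, normalized by $$\log\Gamma_2(z\,|\,\tau)=\frac{\partial}{\partial s}\Big|_{s=0}\sum_{k_1,k_2\ge0}(z+k_1+k_2\tau)^{-s}$$ (analytic continuation in $s$ of the series, which converges for $\Re(s)>2$). $B_n(x)$ are the Bernoulli polynomials and $B_n=B_n(0)$. $\zeta(p,a)$ is the Hurwitz zeta function, $\zeta(p,1)=\zeta(p)$, with the convention $\zeta(1,a)=-\psi(a)$ where $\psi=\Gamma'/\Gamma$ (so $\zeta(1)=-\psi(1)$). The logarithm of $\mathfrak M$ is the branch, continuous in $q$, that vanishes at $q=0$ (defined for fixed $q$ and all sufficiently large $\tau$). The symbol $\sim$ denotes an asymptotic expansion in inverse powers of $\tau$. *)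

(* Defs.v *)
From Stdlib Require Import Reals ClassicalEpsilon.
From Coquelicot Require Import Coquelicot.

Open Scope R_scope.

Definition Cexp (z : C) : C :=
  (exp (Re z) * cos (Im z), exp (Re z) * sin (Im z)).

(** Principal argument, in (-PI, PI] (for [z <> 0]). *)
Definition Carg (z : C) : R :=
  if Rle_dec 0 (Im z) then acos (Re z / Cmod z) else - acos (Re z / Cmod z).

Definition Clog (z : C) : C := (ln (Cmod z), Carg z).

Definition Cpower (z s : C) : C := Cexp (s * Clog z)%C.

Definition analytic_at (f : C -> C) (s : C) : Prop :=
  exists (a : nat -> C) (r : R),
    0 < r /\
    forall w : C, Cmod (w - s)%C < r ->
      is_pseries (K := C_AbsRing) (V := C_NormedModule) a (w - s)%C (f w).

(** [f] is the analytic continuation in [s] of the double series of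
    [(z + k1 + k2 tau)^(-s)].  Its only singularities are the poles [s = 1] and
    [s = 2], so [f] is determined everywhere else and is unconstrained at these
    two points.  The series converges absolutely, so it is written as an
    iterated sum.  Powers are principal: this is the usual definition for
    [0 < tau] and [0 < Re z]. *)
Definition is_barnes_zeta2 (tau : R) (z : C) (f : C -> C) : Prop :=
  (forall s : C, s <> RtoC 1 -> s <> RtoC 2 -> analytic_at f s) /\
  (forall s : C, 2 < Re s ->
     exists row : nat -> C,
       (forall k1 : nat,
          is_series
            (fun k2 : nat =>
               Cpower (z + RtoC (INR k1) + RtoC (INR k2 * tau))%C (- s)%C)
            (row k1)) /\
       is_series row (f s)).

Definition barnes_zeta2 (tau : R) (z : C) : C -> C :=
  epsilon (inhabits (fun _ : C => RtoC 0)) (is_barnes_zeta2 tau z).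

Definition log_Gamma2 (z : C) (tau : R) : C :=
  C_derive (barnes_zeta2 tau z) (RtoC 0).

Definition Gamma2 (z : C) (tau : R) : C := Cexp (log_Gamma2 z tau).

(** Euler's integral: meaningful for [0 < x] only. *)
Definition Gamma (x : R) : R :=
  RInt_gen (fun t : R => Rpower t (x - 1) * exp (- t))
    (at_right 0) (Rbar_locally p_infty).

Definition digamma (x : R) : R := Derive Gamma x / Gamma x.

Definition hurwitz_zeta (p : nat) (a : R) : R :=
  if Nat.eqb p 1 then - digamma a
  else Series (fun k : nat => / (INR k + a) ^ p).

Definition zeta (p : nat) : R := hurwitz_zeta p 1.

(** [bernoulli_upto n k] is [B_k] for [k <= n], computed by
    [B_(m+1) = - (m+2)^(-1) sum_(j <= m) binom(m+2, j) B_j]; in particular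
    [B_1 = -1/2]. *)
Fixpoint bernoulli_upto (n : nat) : nat -> R :=
  match n with
  | O => fun _ => 1
  | S m => fun k =>
      if Nat.leb k m then bernoulli_upto m k
      else - / INR (m + 2) *
           sum_n (fun j : nat => Binomial.C (m + 2) j * bernoulli_upto m j) m
  end.

Definition bernoulli (n : nat) : R := bernoulli_upto n n.

Definition bernoulli_poly (n : nat) (x : C) : C :=
  sum_n (fun k : nat =>
           (RtoC (Binomial.C n k * bernoulli k) * Cpow x (n - k))%C) n.

Definition frakM (q : C) (tau lambda1 lambda2 : R) : C :=
  (Cpower (RtoC tau) (q / RtoC tau)
     / Cpower (RtoC (Gamma (1 - 1 / tau)%R)) q
   * (Gamma2 (RtoC (tau * (lambda1 + lambda2 + 1) + 1)%R - q) tau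
      / Gamma2 (RtoC (tau * (lambda1 + lambda2 + 1) + 1)%R) tau)
   * (Gamma2 (- q + RtoC tau) tau / Gamma2 (RtoC tau) tau)
   * (Gamma2 (RtoC (tau * (1 + lambda1) + 1)%R) tau
      / Gamma2 (RtoC (tau * (1 + lambda1) + 1)%R - q) tau)
   * (Gamma2 (RtoC (tau * (1 + lambda2) + 1)%R) tau
      / Gamma2 (RtoC (tau * (1 + lambda2) + 1)%R - q) tau))%C.

(** [L] is the value at [q] of the branch of [log F] that is continuous and
    vanishes at [0]; the branch is taken on the closed disc of radius [|q|]. *)
Definition is_log_branch (F : C -> C) (q L : C) : Prop :=
  exists l : C -> C,
    continuous_on (fun w : C => Cmod w <= Cmod q) l /\
    (forall w : C, Cmod w <= Cmod q -> Cexp (l w) = F w) /\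
    l (RtoC 0) = RtoC 0 /\
    l q = L.

(** Poincare asymptotic expansion [F(tau) ~ c0 + sum_(p >= 1) c_p / tau^p] as
    [tau -> +oo]: every truncation at order [N] has error [o(tau^(-N))]. *)
Definition is_asymptotic_expansion (F : R -> C) (c0 : C) (c : nat -> C) : Prop :=
  forall N : nat,
    filterlim
      (fun tau : R =>
         (RtoC (tau ^ N)
          * (F tau - (c0 + sum_n_m (fun p : nat => c p / RtoC (tau ^ p)) 1 N)))%C)
      (Rbar_locally p_infty) (locally (RtoC 0)).

(* Main.v *)
(* The one-dimensional Euler-Maclaurin formula, with Bernoulli polynomials and an explicit remainder,
   writes [s (x + w)^(- s - 1)] as a difference [Q(x) - Q(x + 1)] up to a rapidly decreasing term.  Summing
   it twice continues the Barnes double zeta function of [tau a + w] to any half plane, up to its two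
   poles; the remainder is bounded uniformly in [w] by a negative power of [tau] that can be chosen
   arbitrarily large.  All bounds are made on absolutely summable Taylor coefficients, so they pass to
   derivatives in [s] with no use of Cauchy's formula.  Since any two continuations agree (by the identity
   theorem along horizontal lines), differentiating at [s = 0] gives, for fixed [a > 0],

     log Gamma2(tau a + w | tau) - log Gamma2(tau a + v | tau)
       = sum_(j < N) (B_(j+1)(w) - B_(j+1)(v)) gamma_j(tau, a) + O(|w - v| tau^(3 - N)),

   where [gamma_j] is given by [ln Gamma(a)], [psi(a)] or [zeta(j, a)] and by [ln tau], up to a constant
   independent of [a] in [gamma_0], which cancels below; these values come from limits of finite sums,
   identified through Euler's integral by the Bohr-Mollerup argument.  Substituting this in the four
   quotients of the product and using [B_n(1 - w) = (-1)^n B_n(w)] gives the coefficients: the [ln tau]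
   terms cancel against [tau^(q / tau)], and [ln Gamma(1 - 1 / tau)] supplies the terms [- q zeta(p)].
   The same Lipschitz bound in [w] makes the resulting logarithm continuous, and a continuous logarithm
   that vanishes at [0] is unique along the segment from [0] to [q]. *)

Require Import Defs.
From Stdlib Require Import Reals ZArith Lra Lia ClassicalEpsilon ssreflect.
From Coquelicot Require Import Coquelicot.

Open Scope R_scope.

(** * Complex series *)

(** The double zeta function of the statement is an [epsilon] choice, known only through existence
    and uniqueness, and its derivative at [0] needs control on a whole disc around [0]. Norms of
    Taylor coefficients give this control: the coefficient of order one is at most the norm divided
    by the radius. Expanding [s (x + w)^(- s - 1)] rather than [(x + w)^(- s)] keeps every
    Euler-Maclaurin term entire in [s]; the poles of the two summations then appear only as explicit
    factors [/ (s - 1)] and [/ (s - 2)]. The constant in [gamma_0] is left undetermined (classically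
    it is half the logarithm of [2 pi]): it enters through differences of [B_1] that all equal
    [- q], with two plus and two minus signs. The part of [log Gamma2] that does not depend on [w]
    is never evaluated, because only differences in [w] occur. The estimates lose a fixed number of
    powers of [tau], which a larger truncation order makes up for. *)

Fixpoint csum (u : nat -> C) (n : nat) : C :=
  match n with O => RtoC 0 | S m => (csum u m + u m)%C end.

Fixpoint rsum (u : nat -> R) (n : nat) : R :=
  match n with O => 0 | S m => rsum u m + u m end.

Definition clim (u : nat -> C) (l : C) : Prop :=
  forall eps, 0 < eps -> exists N, forall n, (N <= n)%nat -> Cmod (u n - l)%C < eps.

Definition csums (u : nat -> C) (l : C) : Prop := clim (csum u) l.

(** For nonnegative terms this is convergence with sum at most [M]; absolute convergence is carried
    in this form, with its bound and without the sum. *)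
Definition rbdd (u : nat -> R) (M : R) : Prop := forall n, rsum u n <= M.

Lemma csum_S u n : csum u (S n) = (csum u n + u n)%C.
Proof. by []. Qed.

Lemma csum_ext_lt u v n :
  (forall k, (k < n)%nat -> u k = v k) -> csum u n = csum v n.
Proof.
  elim: n => [|n IH] H //=.
  rewrite IH; first by rewrite H //; lia.
  move=> k Hk; apply H; lia.
Qed.

Lemma csum_ext u v n : (forall k, u k = v k) -> csum u n = csum v n.
Proof. move=> H; apply csum_ext_lt => k _; apply H. Qed.

Lemma rsum_ext u v n : (forall k, u k = v k) -> rsum u n = rsum v n.
Proof. move=> H; elim: n => [|n IH] //=; by rewrite IH H. Qed.

Lemma rsum_le_lt u v n : (forall k, (k < n)%nat -> u k <= v k) -> rsum u n <= rsum v n.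
Proof.
  elim: n => [|n IH] H /=; first lra.
  have := H n ltac:(lia).
  have : rsum u n <= rsum v n by apply IH => k Hk; apply H; lia.
  lra.
Qed.

Lemma rsum_le u v n : (forall k, u k <= v k) -> rsum u n <= rsum v n.
Proof. move=> H; apply rsum_le_lt => k _; apply H. Qed.

Lemma csum_plus u v n : csum (fun k => (u k + v k)%C) n = (csum u n + csum v n)%C.
Proof. elim: n => [|n IH] /=; [ring|rewrite IH; ring]. Qed.

Lemma csum_minus u v n : csum (fun k => (u k - v k)%C) n = (csum u n - csum v n)%C.
Proof. elim: n => [|n IH] /=; [ring|rewrite IH; ring]. Qed.

Lemma csum_scal c u n : csum (fun k => (c * u k)%C) n = (c * csum u n)%C.
Proof. elim: n => [|n IH] /=; [ring|rewrite IH; ring]. Qed.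

Lemma csum_zero u n : (forall k, (k < n)%nat -> u k = RtoC 0) -> csum u n = RtoC 0.
Proof.
  move=> H; rewrite (csum_ext_lt _ (fun _ => RtoC 0)) //.
  elim: n {H} => [|n IH] //=; rewrite IH; ring.
Qed.

Lemma csum_shift u n m : csum u (n + m) = (csum u n + csum (fun k => u (n + k)%nat) m)%C.
Proof.
  elim: m => [|m IH] /=; first by rewrite Nat.add_0_r; ring.
  rewrite Nat.add_succ_r /= IH; ring.
Qed.

Lemma csum_S_l u n : csum u (S n) = (u 0%nat + csum (fun k => u (S k)) n)%C.
Proof. rewrite (csum_shift u 1 n) /=; ring. Qed.

Lemma rsum_plus u v n : rsum (fun k => u k + v k) n = rsum u n + rsum v n.
Proof. elim: n => [|n IH] /=; [ring|rewrite IH; ring]. Qed.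

Lemma rsum_scal c u n : rsum (fun k => c * u k) n = c * rsum u n.
Proof. elim: n => [|n IH] /=; [ring|rewrite IH; ring]. Qed.

Lemma rsum_nonneg u n : (forall k, 0 <= u k) -> 0 <= rsum u n.
Proof. move=> H; elim: n => [|n IH] /=; [lra|have := H n; lra]. Qed.

Lemma rsum_shift u n m : rsum u (n + m) = rsum u n + rsum (fun k => u (n + k)%nat) m.
Proof.
  elim: m => [|m IH] /=; first by rewrite Nat.add_0_r; ring.
  rewrite Nat.add_succ_r /= IH; ring.
Qed.

Lemma rsum_incr u n m : (forall k, 0 <= u k) -> (n <= m)%nat -> rsum u n <= rsum u m.
Proof.
  move=> H Hnm; have -> : m = (n + (m - n))%nat by lia.
  rewrite rsum_shift.
  have := rsum_nonneg (fun k => u (n + k)%nat) (m - n) (fun k => H _); lra.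
Qed.

Lemma rsum_swap (a : nat -> nat -> R) n m :
  rsum (fun i => rsum (a i) m) n = rsum (fun j => rsum (fun i => a i j) n) m.
Proof.
  elim: n => [|n IH] /=.
  - elim: m => [|m IH] //=; rewrite -IH; ring.
  - by rewrite IH -rsum_plus.
Qed.

Lemma Cmod_csum u n : Cmod (csum u n) <= rsum (fun k => Cmod (u k)) n.
Proof.
  elim: n => [|n IH] /=; first by rewrite Cmod_0; lra.
  apply: Rle_trans; first apply Cmod_triangle; lra.
Qed.

Lemma Re_csum u n : Re (csum u n) = rsum (fun k => Re (u k)) n.
Proof. elim: n => [|n IH] //=; by rewrite -IH. Qed.

Lemma Im_csum u n : Im (csum u n) = rsum (fun k => Im (u k)) n.
Proof. elim: n => [|n IH] //=; by rewrite -IH. Qed.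

Lemma csum_RtoC u n : csum (fun k => RtoC (u k)) n = RtoC (rsum u n).
Proof. elim: n => [|n IH] //=; by rewrite IH RtoC_plus. Qed.

Lemma sum_n_csum (u : nat -> C) n : sum_n (G := C_AbelianMonoid) u n = csum u (S n).
Proof.
  elim: n => [|n IH]; first by rewrite sum_O /=; ring.
  by rewrite sum_Sn IH.
Qed.

Lemma Cmod_sub_sym (x y : C) : Cmod (x - y)%C = Cmod (y - x)%C.
Proof. by rewrite -(Cmod_opp (y - x)%C); congr Cmod; ring. Qed.

Lemma Cmod_sub_triangle (x y z : C) : Cmod (x - z)%C <= Cmod (x - y)%C + Cmod (y - z)%C.
Proof. have -> : (x - z = (x - y) + (y - z))%C by ring. apply Cmod_triangle. Qed.

Lemma Cmod_triangle_minus (x y : C) : Cmod (x - y)%C <= Cmod x + Cmod y.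
Proof. rewrite -(Cmod_opp y). apply Cmod_triangle. Qed.

Lemma Cmod_le_sub (x y : C) : Cmod x <= Cmod (x - y)%C + Cmod y.
Proof. have {1}-> : x = ((x - y) + y)%C by ring. apply Cmod_triangle. Qed.

(** [C] carries the product uniform structure, whose balls are squares; passing between squares and
    discs costs a factor [sqrt 2]. *)
Lemma clim_filterlim u (l : C) :
  clim u l <-> filterlim u eventually (locally (T := C_UniformSpace) l).
Proof.
  split => H.
  - apply filterlim_locally => eps.
    case: (H eps (cond_pos eps)) => N HN; exists N => n Hn.
    by apply (C_NormedModule_mixin_compat1 l (u n) eps); apply HN.
  - move=> eps Heps.
    have h2 : 0 < sqrt 2 by apply sqrt_lt_R0; lra.
    have He : 0 < eps / sqrt 2 by apply Rdiv_lt_0_compat.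
    case: (proj1 (filterlim_locally u l) H (mkposreal _ He)) => N HN; exists N => n Hn.
    have := C_NormedModule_mixin_compat2 l (u n) (mkposreal _ He) (HN n Hn) => /=.
    have -> : sqrt 2 * (eps / sqrt 2) = eps by field; lra.
    by [].
Qed.

Lemma is_series_csums (u : nat -> C) (l : C) :
  is_series (K := C_AbsRing) (V := C_NormedModule) u l <-> csums u l.
Proof.
  rewrite /is_series /csums; split => H.
  - have {}H := proj2 (clim_filterlim _ _) H.
    move=> eps Heps; case: (H eps Heps) => N HN; exists (S N) => -[|n] Hn; first lia.
    rewrite -sum_n_csum; apply HN; lia.
  - apply (proj1 (clim_filterlim _ _)) => eps Heps.
    case: (H eps Heps) => N HN; exists N => n Hn.
    rewrite sum_n_csum; apply HN; lia.
Qed.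

Lemma clim_unique u l l' : clim u l -> clim u l' -> l = l'.
Proof.
  move=> H H'.
  have Z : Cmod (l - l')%C = 0.
  { case: (Rle_lt_or_eq_dec _ _ (Cmod_ge_0 (l - l')%C)) => // Hp.
    case: (H (Cmod (l - l')%C / 2)); first lra; move=> N HN.
    case: (H' (Cmod (l - l')%C / 2)); first lra; move=> N' HN'.
    have A := HN (N + N')%nat ltac:(lia); have B := HN' (N + N')%nat ltac:(lia).
    have := Cmod_sub_triangle l (u (N + N')%nat) l'.
    rewrite (Cmod_sub_sym l (u _)); lra. }
  have := Cmod_eq_0 _ Z => E.
  have -> : l = ((l - l') + l')%C by ring.
  rewrite E; ring.
Qed.

Lemma clim_ext_ev u v l N0 :
  (forall n, (N0 <= n)%nat -> u n = v n) -> clim u l -> clim v l.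
Proof.
  move=> H Hu eps He; case: (Hu eps He) => N HN; exists (N + N0)%nat => n Hn.
  rewrite -H; last lia; apply HN; lia.
Qed.

Lemma clim_ext u v l : (forall n, u n = v n) -> clim u l -> clim v l.
Proof. move=> H; apply (clim_ext_ev _ _ _ 0) => n _; apply H. Qed.

Lemma clim_const c : clim (fun _ => c) c.
Proof.
  move=> eps He; exists 0%nat => n _.
  have -> : (c - c = 0)%C by ring. by rewrite Cmod_0.
Qed.

Lemma clim_plus u v l l' : clim u l -> clim v l' -> clim (fun n => (u n + v n)%C) (l + l')%C.
Proof.
  move=> H H' eps He.
  case: (H (eps / 2)); first lra; move=> N HN.
  case: (H' (eps / 2)); first lra; move=> N' HN'.
  exists (N + N')%nat => n Hn.
  have A := HN n ltac:(lia); have B := HN' n ltac:(lia).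
  have -> : (u n + v n - (l + l') = (u n - l) + (v n - l'))%C by ring.
  apply: Rle_lt_trans; first apply Cmod_triangle; lra.
Qed.

Lemma clim_scal c u l : clim u l -> clim (fun n => (c * u n)%C) (c * l)%C.
Proof.
  move=> H eps He.
  have Hc := Cmod_ge_0 c.
  have Hp : 0 < eps / (Cmod c + 1) by apply Rdiv_lt_0_compat; lra.
  case: (H _ Hp) => N HN; exists N => n Hn.
  have -> : (c * u n - c * l = c * (u n - l))%C by ring.
  rewrite Cmod_mult.
  have A := HN n Hn.
  have B : (Cmod c + 1) * Cmod (u n - l)%C < (Cmod c + 1) * (eps / (Cmod c + 1)).
  { apply Rmult_lt_compat_l; lra. }
  have E : (Cmod c + 1) * (eps / (Cmod c + 1)) = eps by field; lra.
  have := Cmod_ge_0 (u n - l)%C; lra.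
Qed.

Lemma clim_minus u v l l' : clim u l -> clim v l' -> clim (fun n => (u n - v n)%C) (l - l')%C.
Proof.
  move=> H H'.
  have K := clim_plus _ _ _ _ H (clim_scal (-(1))%C _ _ H').
  have -> : (l - l' = l + - (1) * l')%C by ring.
  apply: clim_ext K => n /=; ring.
Qed.

Lemma clim_bound u l M N0 :
  (forall n, (N0 <= n)%nat -> Cmod (u n) <= M) -> clim u l -> Cmod l <= M.
Proof.
  move=> H Hu; apply le_epsilon => eps He.
  case: (Hu eps He) => N HN.
  have A := HN (N + N0)%nat ltac:(lia); have B := H (N + N0)%nat ltac:(lia).
  have := Cmod_le_sub l (u (N + N0)%nat); rewrite Cmod_sub_sym; lra.
Qed.

Lemma csums_unique u l l' : csums u l -> csums u l' -> l = l'.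
Proof. apply clim_unique. Qed.

Lemma csums_ext u v l : (forall k, u k = v k) -> csums u l -> csums v l.
Proof. move=> H; apply clim_ext => n; by apply csum_ext. Qed.

Lemma csums_plus u v l l' :
  csums u l -> csums v l' -> csums (fun k => (u k + v k)%C) (l + l')%C.
Proof. move=> H H'; apply: clim_ext (clim_plus _ _ _ _ H H') => n; by rewrite csum_plus. Qed.

Lemma csums_minus u v l l' :
  csums u l -> csums v l' -> csums (fun k => (u k - v k)%C) (l - l')%C.
Proof. move=> H H'; apply: clim_ext (clim_minus _ _ _ _ H H') => n; by rewrite csum_minus. Qed.

Lemma csums_scal c u l : csums u l -> csums (fun k => (c * u k)%C) (c * l)%C.
Proof. move=> H; apply: clim_ext (clim_scal c _ _ H) => n; by rewrite csum_scal. Qed.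

Lemma csums_finite u N : (forall k, (N <= k)%nat -> u k = RtoC 0) -> csums u (csum u N).
Proof.
  move=> H; apply: (clim_ext_ev (fun _ => csum u N) _ _ N); last apply clim_const.
  move=> n Hn; have -> : n = (N + (n - N))%nat by lia.
  rewrite csum_shift (csum_zero (fun k => u (N + k)%nat)); first by ring.
  move=> k _; apply H; lia.
Qed.

Lemma csums_shift u N l :
  csums (fun k => u (N + k)%nat) l <-> csums u (csum u N + l)%C.
Proof.
  split => H eps He; case: (H eps He) => M HM.
  - exists (N + M)%nat => n Hn; have -> : n = (N + (n - N))%nat by lia.
    rewrite csum_shift.
    have -> : (csum u N + csum (fun k : nat => u (N + k)%nat) (n - N) - (csum u N + l) =
      csum (fun k : nat => u (N + k)%nat) (n - N) - l)%C by ring.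
    apply HM; lia.
  - exists M => n Hn; have := HM (N + n)%nat ltac:(lia); rewrite csum_shift.
    by have -> : (csum u N + csum (fun k : nat => u (N + k)%nat) n - (csum u N + l) =
      csum (fun k : nat => u (N + k)%nat) n - l)%C by ring.
Qed.

Lemma csums_bound u l M : rbdd (fun k => Cmod (u k)) M -> csums u l -> Cmod l <= M.
Proof.
  move=> H; apply: (clim_bound _ _ _ 0) => n _.
  apply: Rle_trans (Cmod_csum _ _) (H n).
Qed.

Lemma rbdd_le u v M : (forall k, u k <= v k) -> rbdd v M -> rbdd u M.
Proof. move=> H Hv n; apply: Rle_trans (Hv n); by apply rsum_le. Qed.

Lemma rbdd_scal c u M : 0 <= c -> rbdd u M -> rbdd (fun k => c * u k) (c * M).
Proof. move=> Hc H n; rewrite rsum_scal; by apply Rmult_le_compat_l. Qed.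

Lemma rbdd_term u M k : (forall k, 0 <= u k) -> rbdd u M -> u k <= M.
Proof. move=> H Hb; have := Hb (S k) => /=; have := rsum_nonneg u k H; lra. Qed.

Lemma rbdd_shift u M N : (forall k, 0 <= u k) -> rbdd u M -> rbdd (fun k => u (N + k)%nat) M.
Proof.
  move=> H Hb n; have := Hb (N + n)%nat; rewrite rsum_shift.
  have := rsum_nonneg u N H; lra.
Qed.

Lemma rbdd_tail u M eps :
  (forall k, 0 <= u k) -> rbdd u M -> 0 < eps ->
  exists K, forall n, (K <= n)%nat -> rsum u n - rsum u K < eps.
Proof.
  move=> H Hb He.
  case: (completeness (fun x => exists n, x = rsum u n)).
  - exists M => x [n ->]; apply Hb.
  - by exists 0, 0%nat.
  - move=> l [Hu Hl].
    have : ~ is_upper_bound (fun x => exists n, x = rsum u n) (l - eps).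
    { move=> Hn; have := Hl _ Hn; lra. }
    move=> Hn.
    have [K HK] : exists K, l - eps < rsum u K.
    { apply Classical_Prop.NNPP => Hne; apply Hn => x [n ->].
      apply Rnot_lt_le => Hlt; apply Hne; by exists n. }
    exists K => n _; have := Hu (rsum u n) (ex_intro _ n eq_refl); lra.
Qed.

Lemma csum_diff_bound u M n m :
  (forall k, Cmod (u k) <= M k) -> (n <= m)%nat ->
  Cmod (csum u m - csum u n)%C <= rsum M m - rsum M n.
Proof.
  move=> H Hnm; have -> : m = (n + (m - n))%nat by lia.
  rewrite csum_shift rsum_shift.
  have -> : forall x y : C, (x + y - x = y)%C by move=> x y; ring.
  apply: Rle_trans (Cmod_csum _ _) _.
  have : rsum (fun k => Cmod (u (n + k)%nat)) (m - n) <= rsum (fun k => M (n + k)%nat) (m - n)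
    by apply rsum_le => k; apply H.
  lra.
Qed.

Lemma csums_abs u M : rbdd (fun k => Cmod (u k)) M -> exists l, csums u l.
Proof.
  move=> H.
  have [l Hl] : ex_series (K := C_AbsRing) (V := C_NormedModule) u.
  { apply (ex_series_Cauchy (V := C_CompleteNormedModule)) => eps.
    case: (rbdd_tail (fun k => Cmod (u k)) M eps) => //.
    - move=> k; apply Cmod_ge_0.
    - apply cond_pos.
    - move=> K HK; exists (S K) => n m Hn Hm.
      case: (Compare_dec.le_lt_dec n m) => Hnm.
      + destruct n as [|n]; first lia.
        rewrite sum_n_m_sum_n; last lia.
        change (Cmod (sum_n (G := C_AbelianMonoid) u m - sum_n (G := C_AbelianMonoid) u n)%C < eps).
        rewrite !sum_n_csum.
        apply: Rle_lt_trans
          (csum_diff_bound u (fun k => Cmod (u k)) (S n) (S m) (fun k => Rle_refl _) _) _; first lia.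
        have := HK (S m) ltac:(lia).
        have := rsum_incr (fun k => Cmod (u k)) K (S n) (fun k => Cmod_ge_0 _) ltac:(lia).
        lra.
      + rewrite sum_n_m_zero; last lia.
        rewrite norm_zero; apply cond_pos. }
  exists l; by apply is_series_csums.
Qed.

Lemma csums_tail_bound u l M K eps :
  (forall k, Cmod (u k) <= M k) ->
  (forall n, (K <= n)%nat -> rsum M n - rsum M K <= eps) ->
  csums u l -> Cmod (l - csum u K)%C <= eps.
Proof.
  move=> H HK Hl.
  apply: (clim_bound (fun n => (csum u n - csum u K)%C) _ _ K).
  - move=> n Hn; apply: Rle_trans (HK n Hn); by apply csum_diff_bound.
  - apply clim_minus => //; apply clim_const.
Qed.

Lemma csum_clim (t : nat -> nat -> C) (r : nat -> C) K :
  (forall k, (k < K)%nat -> clim (fun N => t N k) (r k)) ->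
  clim (fun N => csum (t N) K) (csum r K).
Proof.
  elim: K => [|K IH] H /=; first apply clim_const.
  apply clim_plus; [apply IH => k Hk; apply H; lia | apply H; lia].
Qed.

(** Dominated convergence: one index [K] makes the tails of all [t N] and of [r] small, and on the
    first [K] terms only finitely many limits are taken. *)
Lemma tannery (t : nat -> nat -> C) (r : nat -> C) (M : nat -> R) B (T : nat -> C) l :
  (forall k, clim (fun N => t N k) (r k)) ->
  (forall N k, Cmod (t N k) <= M k) -> rbdd M B ->
  (forall N, csums (t N) (T N)) -> csums r l -> clim T l.
Proof.
  move=> Ht HM HB HT Hr eps He.
  have M0 : forall k, 0 <= M k by move=> k; apply: Rle_trans (Cmod_ge_0 _) (HM 0%nat k).
  have rM : forall k, Cmod (r k) <= M k.
  { move=> k; apply: (clim_bound _ _ _ 0 _ (Ht k)) => N _; apply HM. }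
  case: (rbdd_tail M B (eps / 4) M0 HB); first lra; move=> K HK.
  have HK' : forall n, (K <= n)%nat -> rsum M n - rsum M K <= eps / 4
    by move=> n Hn; apply Rlt_le, HK.
  case: (csum_clim t r K (fun k _ => Ht k) (eps / 4)); first lra; move=> N0 HN0.
  exists N0 => N HN.
  have A := csums_tail_bound _ _ _ _ _ (HM N) HK' (HT N).
  have A' := csums_tail_bound _ _ _ _ _ rM HK' Hr.
  have A'' := HN0 N HN.
  have T1 := Cmod_sub_triangle (T N) (csum (t N) K) l.
  have T2 := Cmod_sub_triangle (csum (t N) K) (csum r K) l.
  rewrite Cmod_sub_sym in A'; lra.
Qed.

Lemma csums_csum (a : nat -> nat -> C) (c : nat -> C) N :
  (forall n, (n < N)%nat -> csums (fun k => a k n) (c n)) ->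
  csums (fun k => csum (a k) N) (csum c N).
Proof.
  elim: N => [|N IH] H /=.
  - exact: (csums_finite (fun _ => RtoC 0) 0).
  - apply csums_plus; [apply IH => n Hn; apply H; lia | apply H; lia].
Qed.

Lemma rsum_Cmod_lim (t : nat -> nat -> C) (c : nat -> C) N B :
  (forall n, (n < N)%nat -> clim (fun K => t K n) (c n)) ->
  (forall K, rsum (fun n => Cmod (t K n)) N <= B) -> rsum (fun n => Cmod (c n)) N <= B.
Proof.
  move=> H HB.
  suff : forall eps, 0 < eps -> exists K0, forall K, (K0 <= K)%nat ->
    rsum (fun n => Cmod (c n)) N <= rsum (fun n => Cmod (t K n)) N + eps.
  { move=> G; apply le_epsilon => eps He; case: (G eps He) => K0 HK0.
    have := HK0 K0 (Nat.le_refl _); have := HB K0; lra. }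
  elim: N H {HB} => [|N IH] H eps He /=; first by exists 0%nat => K _; lra.
  case: (IH _ (eps / 2)); [by move=> n Hn; apply H; lia | lra | move=> K0 HK0].
  case: (H N ltac:(lia) (eps / 2)); [lra | move=> K1 HK1].
  exists (K0 + K1)%nat => K HK.
  have A := HK0 K ltac:(lia); have A' := HK1 K ltac:(lia).
  have := Cmod_le_sub (c N) (t K N); rewrite Cmod_sub_sym; lra.
Qed.

(** Turns a choice made separately for each index, such as Taylor coefficients for the [k]-th term
    of a series of functions, into one function. *)
Lemma choice_of {A B : Type} (P : A -> B -> Prop) :
  (forall x, exists y, P x y) -> exists f, forall x, P x (f x).
Proof.
  move=> H; exists (fun x => proj1_sig (constructive_indefinite_description _ (H x))) => x.
  by case: constructive_indefinite_description.
Qed.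

(** Fubini for an array with absolutely summable rows: the sums of the first [N] columns are series
    in [k] dominated by [M], so [tannery] lets [N] tend to infinity. The bound on the column sums is
    what controls the norm of a sum of power series. *)
Lemma double_series (a : nat -> nat -> C) (M : nat -> R) B (r : nat -> C) :
  (forall k, rbdd (fun n => Cmod (a k n)) (M k)) -> rbdd M B ->
  (forall k, csums (a k) (r k)) ->
  exists c l, (forall n, csums (fun k => a k n) (c n)) /\
    rbdd (fun n => Cmod (c n)) B /\ csums r l /\ csums c l /\ Cmod l <= B.
Proof.
  move=> HM HB Hr.
  have aM : forall k n, Cmod (a k n) <= M k.
  { move=> k n; apply (rbdd_term (fun n => Cmod (a k n))) => // m; apply Cmod_ge_0. }
  have Hc : forall n, exists c, csums (fun k => a k n) c.
  { move=> n; apply (csums_abs _ B); apply: rbdd_le HB => k; apply aM. }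
  have [c {}Hc] := choice_of _ Hc.
  have rM : forall k, Cmod (r k) <= M k by move=> k; apply: csums_bound (HM k) (Hr k).
  have rB : rbdd (fun k => Cmod (r k)) B by apply: rbdd_le HB.
  have [l Hl] := csums_abs _ _ rB.
  exists c, l; split => //; split; [|split => //; split].
  - move=> N; apply: (rsum_Cmod_lim (fun K n => csum (fun k => a k n) K)).
    + move=> n _; apply Hc.
    + move=> K; apply: Rle_trans (HB K).
      apply: (Rle_trans _ (rsum (fun n => rsum (fun k => Cmod (a k n)) K) N)).
      { apply rsum_le => n; apply Cmod_csum. }
      rewrite -rsum_swap; apply rsum_le => k; apply HM.
  - apply: (tannery (fun N k => csum (a k) N) r M B) => // [N k|N].
    + apply: Rle_trans (Cmod_csum _ _) (HM k N).
    + by apply csums_csum.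
  - by apply: csums_bound Hl.
Qed.

(** * Power series with absolutely summable coefficients *)

Definition conv (a b : nat -> C) (n : nat) : C :=
  csum (fun k => (a k * b (n - k)%nat)%C) (S n).

(** The products [u k * v (n - k)] form an array that vanishes for [n < k]; its rows sum to
    [u k * lv] and its columns to the convolution. *)
Lemma cauchy_product u v U V lu lv :
  rbdd (fun n => Cmod (u n)) U -> rbdd (fun n => Cmod (v n)) V ->
  csums u lu -> csums v lv ->
  rbdd (fun n => Cmod (conv u v n)) (U * V) /\ csums (conv u v) (lu * lv)%C.
Proof.
  move=> HU HV Hu Hv.
  pose a k n := if Nat.ltb n k then RtoC 0 else (u k * v (n - k)%nat)%C.
  have a0 : forall k n, (n < k)%nat -> a k n = RtoC 0.
  { by move=> k n /Nat.ltb_lt; rewrite /a => ->. }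
  have a1 : forall k n, a k (k + n)%nat = (u k * v n)%C.
  { move=> k n; rewrite /a.
    have -> : Nat.ltb (k + n) k = false by apply Nat.ltb_ge; lia.
    by have -> : (k + n - k = n)%nat by lia. }
  have V0 : 0 <= V by apply: Rle_trans (HV 0%nat) => /=; lra.
  have HR : forall k, rbdd (fun n => Cmod (a k n)) (Cmod (u k) * V).
  { move=> k N.
    apply: Rle_trans (rsum_incr _ N (k + N) (fun n => Cmod_ge_0 _) ltac:(lia)) _.
    rewrite rsum_shift.
    have -> : rsum (fun n => Cmod (a k n)) k = 0.
    { apply Rle_antisym; last by apply rsum_nonneg => n; apply Cmod_ge_0.
      apply (Rle_trans _ (rsum (fun _ => 0 * 0) k)); last by rewrite rsum_scal; lra.
      apply rsum_le_lt => n Hn; rewrite a0 // Cmod_0; lra. }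
    rewrite Rplus_0_l.
    rewrite (rsum_ext _ (fun n => Cmod (u k) * Cmod (v n))); last by move=> n; rewrite a1 Cmod_mult.
    rewrite rsum_scal; apply Rmult_le_compat_l; [apply Cmod_ge_0 | apply HV]. }
  have HB : rbdd (fun k => Cmod (u k) * V) (U * V).
  { move=> N; rewrite (rsum_ext _ (fun k => V * Cmod (u k))); last by move=> k; ring.
    rewrite rsum_scal Rmult_comm; by apply Rmult_le_compat_r. }
  have Hr : forall k, csums (a k) (lv * u k)%C.
  { move=> k; have -> : (lv * u k = csum (a k) k + lv * u k)%C.
    { rewrite csum_zero; [ring | by move=> n Hn; apply a0]. }
    apply csums_shift; rewrite (Cmult_comm lv).
    apply: csums_ext (csums_scal (u k) _ _ Hv) => n; by rewrite a1. }
  have [c [l [Hc [HcB [Hl [Hcl _]]]]]] := double_series _ _ _ _ HR HB Hr.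
  have Ec : forall n, c n = conv u v n.
  { move=> n; apply: csums_unique (Hc n) _.
    have -> : conv u v n = csum (fun k => a k n) (S n).
    { apply csum_ext_lt => k Hk; rewrite -a1; congr a; lia. }
    apply csums_finite => k Hk; apply a0; lia. }
  have El : l = (lu * lv)%C.
  { apply: csums_unique Hl _; rewrite Cmult_comm; by apply csums_scal. }
  split.
  - by move=> N; rewrite -(rsum_ext (fun n => Cmod (c n))) // => n; rewrite Ec.
  - rewrite -El; by apply: csums_ext Hcl.
Qed.

Lemma conv_pow a b h n :
  conv (fun n => (a n * h ^ n)%C) (fun n => (b n * h ^ n)%C) n = (conv a b n * h ^ n)%C.
Proof.
  rewrite /conv Cmult_comm -csum_scal; apply csum_ext_lt => k Hk.
  have {3}-> : n = (k + (n - k))%nat by lia.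
  rewrite Cpow_add_r; ring.
Qed.

(* The least such [M] is the norm of [f] in the Wiener-type algebra of the closed disc, which is
   submultiplicative; all uniform estimates below are estimates in this norm. *)
Definition ps (s0 : C) (r M : R) (a : nat -> C) (f : C -> C) : Prop :=
  0 < r /\ rbdd (fun n => Cmod (a n) * r ^ n) M /\
  forall s, Cmod (s - s0)%C <= r -> csums (fun n => (a n * (s - s0) ^ n)%C) (f s).

Definition psb (s0 : C) (r M : R) (f : C -> C) : Prop := exists a, ps s0 r M a f.

Lemma ps_psb s0 r M a f : ps s0 r M a f -> psb s0 r M f.
Proof. by exists a. Qed.

Lemma ps_term_le r (a : nat -> C) h n :
  Cmod h <= r -> Cmod (a n * h ^ n)%C <= Cmod (a n) * r ^ n.
Proof.
  move=> H; rewrite Cmod_mult Cmod_pow.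
  apply Rmult_le_compat_l; first apply Cmod_ge_0.
  apply pow_incr; split => //; apply Cmod_ge_0.
Qed.

Lemma ps_ext s0 r M a f g :
  (forall s, Cmod (s - s0)%C <= r -> f s = g s) -> ps s0 r M a f -> ps s0 r M a g.
Proof. move=> H [r0 [A B]]; split => //; split => // s Hs; rewrite -H //; by apply B. Qed.

Lemma psb_ext s0 r M f g :
  (forall s, Cmod (s - s0)%C <= r -> f s = g s) -> psb s0 r M f -> psb s0 r M g.
Proof. move=> H [a Ha]; exists a; by apply: ps_ext Ha. Qed.

Lemma ps_mono s0 r M M' a f : M <= M' -> ps s0 r M a f -> ps s0 r M' a f.
Proof. move=> H [r0 [A B]]; split => //; split => // n; have := A n; lra. Qed.

Lemma psb_mono s0 r M M' f : M <= M' -> psb s0 r M f -> psb s0 r M' f.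
Proof. move=> H [a Ha]; exists a; by apply: ps_mono Ha. Qed.

Lemma ps_nonneg s0 r M a f : ps s0 r M a f -> 0 <= M.
Proof. move=> [_ [A _]]; exact: (A 0%nat). Qed.

Lemma psb_nonneg s0 r M f : psb s0 r M f -> 0 <= M.
Proof. move=> [a]; apply ps_nonneg. Qed.

Lemma ps_bound s0 r M a f s : ps s0 r M a f -> Cmod (s - s0)%C <= r -> Cmod (f s) <= M.
Proof.
  move=> [_ [A B]] Hs; apply: csums_bound (B s Hs).
  apply: rbdd_le A => n; by apply ps_term_le.
Qed.

Lemma psb_bound s0 r M f s : psb s0 r M f -> Cmod (s - s0)%C <= r -> Cmod (f s) <= M.
Proof. move=> [a]; apply ps_bound. Qed.

Lemma Cmod_minus_diag (x : C) : Cmod (x - x)%C = 0.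
Proof. have -> : (x - x = 0)%C by ring. apply Cmod_0. Qed.

Lemma ps_value s0 r M a f : ps s0 r M a f -> f s0 = a 0%nat.
Proof.
  move=> [Hr [_ B]].
  have := B s0; rewrite Cmod_minus_diag => /(_ (Rlt_le _ _ Hr)) H.
  apply: csums_unique H _.
  have E : csum (fun n => (a n * (s0 - s0) ^ n)%C) 1 = a 0%nat by rewrite /=; ring.
  rewrite -E; apply csums_finite => -[|k] Hk; first lia.
  rewrite Cpow_S; ring.
Qed.

Lemma ps_plus s0 r M M' a b f g :
  ps s0 r M a f -> ps s0 r M' b g ->
  ps s0 r (M + M') (fun n => (a n + b n)%C) (fun s => (f s + g s)%C).
Proof.
  move=> [Hr [A B]] [_ [A' B']]; split => //; split.
  - move=> n.
    apply (Rle_trans _ (rsum (fun n => Cmod (a n) * r ^ n + Cmod (b n) * r ^ n) n)).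
    + apply rsum_le => k; rewrite -Rmult_plus_distr_r; apply Rmult_le_compat_r; last apply Cmod_triangle.
      apply pow_le; lra.
    + rewrite rsum_plus; have := A n; have := A' n; lra.
  - move=> s Hs; apply: csums_ext (csums_plus _ _ _ _ (B s Hs) (B' s Hs)) => k; ring.
Qed.

Lemma ps_const s0 r c : 0 < r -> ps s0 r (Cmod c) (fun n => match n with O => c | _ => RtoC 0 end) (fun _ => c).
Proof.
  move=> Hr; split => //; split.
  - elim => [|[|n] IH] /=; first by apply Cmod_ge_0.
    + lra.
    + move: IH => /=; rewrite Cmod_0; lra.
  - move=> s Hs; have {2}-> : c = (c + 0)%C by ring.
    have -> : (c + 0 = csum (fun n => match n with O => c | _ => RtoC 0 end * (s - s0) ^ n)%C 1)%C by rewrite /=; ring.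
    apply csums_finite => -[|k] Hk; first lia. by ring.
Qed.

Lemma ps_id s0 r c : 0 < r ->
  ps s0 r (Cmod (s0 - c)%C + r) (fun n => match n with O => (s0 - c)%C | 1%nat => RtoC 1 | _ => RtoC 0 end)
    (fun s => (s - c)%C).
Proof.
  move=> Hr; split => //; split.
  - have H0 := Cmod_ge_0 (s0 - c)%C.
    elim => [|[|[|n]] IH] /=; first lra.
    + lra.
    + rewrite Cmod_1; lra.
    + move: IH => /=; rewrite Cmod_0; lra.
  - move=> s Hs.
    have -> : (s - c = csum (fun n => match n with O => (s0 - c)%C | 1%nat => RtoC 1 | _ => RtoC 0 end * (s - s0) ^ n)%C 2)%C
      by rewrite /=; ring.
    apply csums_finite => -[|[|k]] Hk; try lia; by ring.
Qed.

Lemma ps_mult s0 r M M' a b f g :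
  ps s0 r M a f -> ps s0 r M' b g ->
  ps s0 r (M * M') (conv a b) (fun s => (f s * g s)%C).
Proof.
  move=> [Hr [A B]] [_ [A' B']].
  have F (h : C) : Cmod h <= r -> rbdd (fun n => Cmod (a n * h ^ n)%C) M /\
     rbdd (fun n => Cmod (b n * h ^ n)%C) M'.
  { move=> Hh; split; [apply: rbdd_le A | apply: rbdd_le A'] => n; by apply ps_term_le. }
  split => //; split.
  (* At the point [s0 + r] the moduli of the terms are exactly the summands of the norm, so the norm
     of the product is read off there. *)
  - have Hrr : Cmod (RtoC r) = r by rewrite Cmod_R Rabs_pos_eq //; lra.
    have E : (s0 + r - s0 = RtoC r)%C by ring.
    have [F1 F2] := F (RtoC r) ltac:(lra).
    have G1 := B (s0 + r)%C; rewrite E Hrr in G1.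
    have G2 := B' (s0 + r)%C; rewrite E Hrr in G2.
    have [K _] := cauchy_product _ _ _ _ _ _ F1 F2 (G1 (Rle_refl _)) (G2 (Rle_refl _)).
    apply: rbdd_le K => n; rewrite conv_pow Cmod_mult Cmod_pow Hrr; lra.
  - move=> s Hs; have [F1 F2] := F _ Hs.
    have [_ K] := cauchy_product _ _ _ _ _ _ F1 F2 (B s Hs) (B' s Hs).
    by apply: csums_ext K => n; rewrite conv_pow.
Qed.

Lemma ps_scal s0 r M a f c :
  ps s0 r M a f -> ps s0 r (Cmod c * M) (fun n => (c * a n)%C) (fun s => (c * f s)%C).
Proof.
  move=> [Hr [A B]]; split => //; split.
  - move=> n; rewrite -(rsum_ext (fun k => Cmod c * (Cmod (a k) * r ^ k))).
    + rewrite rsum_scal; apply Rmult_le_compat_l; [apply Cmod_ge_0|apply A].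
    + move=> k; rewrite Cmod_mult; ring.
  - move=> s Hs; apply: csums_ext (csums_scal c _ _ (B s Hs)) => k; ring.
Qed.

Lemma ps_minus s0 r M M' a b f g :
  ps s0 r M a f -> ps s0 r M' b g ->
  ps s0 r (M + M') (fun n => (a n + - (1) * b n)%C) (fun s => (f s - g s)%C).
Proof.
  move=> H H'; have K := ps_plus _ _ _ _ _ _ _ _ H (ps_scal _ _ _ _ _ (- (1))%C H').
  rewrite Cmod_m1 Rmult_1_l in K.
  apply: ps_ext K => s Hs; ring.
Qed.

Lemma ps_shift s0 c r M a f : ps (s0 + c)%C r M a f -> ps s0 r M a (fun s => f (s + c)%C).
Proof.
  move=> [Hr [A B]]; split => //; split => // s Hs.
  have E : (s + c - (s0 + c) = s - s0)%C by ring.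
  have := B (s + c)%C; rewrite E; by apply.
Qed.

Lemma ps_shrink s0 r r' M a f : 0 < r' <= r -> ps s0 r M a f -> ps s0 r' M a f.
Proof.
  move=> Hr [_ [A B]]; split; first lra; split.
  - apply: rbdd_le A => n; apply Rmult_le_compat_l; first apply Cmod_ge_0.
    apply pow_incr; lra.
  - move=> s Hs; apply B; lra.
Qed.

Lemma psb_shrink s0 r r' M f : 0 < r' <= r -> psb s0 r M f -> psb s0 r' M f.
Proof. move=> Hr [a Ha]; exists a; by apply: ps_shrink Ha. Qed.

Lemma psb_plus s0 r M M' f g :
  psb s0 r M f -> psb s0 r M' g -> psb s0 r (M + M') (fun s => (f s + g s)%C).
Proof. move=> [a Ha] [b Hb]; eexists; apply ps_plus; eassumption. Qed.

Lemma psb_minus s0 r M M' f g :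
  psb s0 r M f -> psb s0 r M' g -> psb s0 r (M + M') (fun s => (f s - g s)%C).
Proof. move=> [a Ha] [b Hb]; eexists; apply ps_minus; eassumption. Qed.

Lemma psb_mult s0 r M M' f g :
  psb s0 r M f -> psb s0 r M' g -> psb s0 r (M * M') (fun s => (f s * g s)%C).
Proof. move=> [a Ha] [b Hb]; eexists; apply ps_mult; eassumption. Qed.

Lemma psb_scal s0 r M f c : psb s0 r M f -> psb s0 r (Cmod c * M) (fun s => (c * f s)%C).
Proof. move=> [a Ha]; eexists; apply ps_scal; eassumption. Qed.

Lemma psb_const s0 r c : 0 < r -> psb s0 r (Cmod c) (fun _ => c).
Proof. move=> Hr; eexists; by apply ps_const. Qed.

Lemma psb_id s0 r c : 0 < r -> psb s0 r (Cmod (s0 - c)%C + r) (fun s => (s - c)%C).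
Proof. move=> Hr; eexists; by apply ps_id. Qed.

Lemma psb_shift s0 c r M f : psb (s0 + c)%C r M f -> psb s0 r M (fun s => f (s + c)%C).
Proof. move=> [a Ha]; exists a; by apply ps_shift. Qed.

Lemma psb_csum s0 r (M : nat -> R) (f : nat -> C -> C) N :
  0 < r -> (forall k, (k < N)%nat -> psb s0 r (M k) (f k)) ->
  psb s0 r (rsum M N) (fun s => csum (fun k => f k s) N).
Proof.
  move=> Hr; elim: N => [|N IH] H /=.
  - have := psb_const s0 r (RtoC 0) Hr; by rewrite Cmod_0.
  - apply psb_plus; [apply IH => k Hk; apply H; lia | apply H; lia].
Qed.

(** Weierstrass' theorem for these norms: the Taylor coefficients are summed column by column with
    [double_series], and the norms add up. *)
Lemma psb_series s0 r (M : nat -> R) B (f : nat -> C -> C) :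
  0 < r -> (forall k, psb s0 r (M k) (f k)) -> rbdd M B ->
  exists g, psb s0 r B g /\ forall s, Cmod (s - s0)%C <= r -> csums (fun k => f k s) (g s).
Proof.
  move=> Hr Hf HB.
  have [a Ha] := choice_of _ Hf.
  have Hrr : Cmod (RtoC r) = r by rewrite Cmod_R Rabs_pos_eq //; lra.
  have key (s : C) : Cmod (s - s0)%C <= r -> exists c l,
     (forall n, csums (fun k => a k n * (s - s0) ^ n)%C (c n)) /\
     rbdd (fun n => Cmod (c n)) B /\ csums (fun k => f k s) l /\ csums c l.
  { move=> Hs.
    have HM : forall k, rbdd (fun n => Cmod (a k n * (s - s0) ^ n)%C) (M k).
    { move=> k; have [_ [A _]] := Ha k; apply: rbdd_le A => n; by apply ps_term_le. }
    have HR : forall k, csums (fun n => a k n * (s - s0) ^ n)%C (f k s).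
    { move=> k; have [_ [_ F]] := Ha k; by apply F. }
    have [c [l [H1 [H2 [H3 [H4 _]]]]]] := double_series _ M B _ HM HB HR.
    by exists c, l. }
  have E : (s0 + r - s0 = RtoC r)%C by ring.
  have [d [_ [Hd [dB _]]]] := key (s0 + r)%C (Req_le _ _ (eq_trans (f_equal Cmod E) Hrr)).
  have rC : RtoC r <> 0 by move=> /RtoC_inj; lra.
  rewrite E in Hd.
  (* The coefficients of the sum are recovered from the column sums at the single point [s0 + r]. *)
  pose b n := (/ RtoC r ^ n * d n)%C.
  have Hb : forall n, csums (fun k => a k n) (b n).
  { move=> n; have P := Cpow_nz _ n rC.
    apply: csums_ext (csums_scal (/ RtoC r ^ n)%C _ _ (Hd n)) => k; by field. }
  have {}key (s : C) : exists l, Cmod (s - s0)%C <= r ->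
      csums (fun k => f k s) l /\ csums (fun n => b n * (s - s0) ^ n)%C l.
  { case: (Rle_lt_dec (Cmod (s - s0)%C) r) => Hs; last by exists 0 => ?; lra.
    have [c [l [Hc [_ [H3 H4]]]]] := key s Hs.
    exists l => _; split => //.
    apply: csums_ext H4 => n; apply: csums_unique (Hc n) _.
    rewrite Cmult_comm; apply: csums_ext (csums_scal _ _ _ (Hb n)) => k; ring. }
  have [g Hg] := choice_of _ key.
  exists g; split; last by move=> s Hs; apply (Hg s Hs).
  exists b; split => //; split; last by move=> s Hs; apply (Hg s Hs).
  apply: rbdd_le dB => n.
  rewrite /b Cmod_mult Cmod_inv; last by apply Cpow_nz.
  rewrite Cmod_pow Hrr.
  have P : 0 < r ^ n by apply pow_lt.
  apply Req_le; field; lra.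
Qed.

Lemma conv_1 a b : conv a b 1 = (a 0%nat * b 1%nat + a 1%nat * b 0%nat)%C.
Proof. rewrite /conv /=; ring. Qed.

(** [Cmod (a 1) * r] is one summand of the norm; this is the estimate by which all bounds pass to
    derivatives. *)
Lemma ps_coef1_bound s0 r M a f : ps s0 r M a f -> Cmod (a 1%nat) <= M / r.
Proof.
  move=> [Hr [A _]].
  have := A 2%nat => /=; have := Cmod_ge_0 (a 0%nat) => H0 H.
  apply (Rmult_le_reg_r r) => //.
  have -> : M / r * r = M by field; lra.
  lra.
Qed.

Lemma ps_tail2 s0 r M a f h :
  ps s0 r M a f -> Cmod h <= r ->
  Cmod (f (s0 + h)%C - a 0%nat - a 1%nat * h)%C <= Cmod h ^ 2 * (M / r ^ 2).
Proof.
  move=> [Hr [A B]] Hh.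
  have E : (s0 + h - s0 = h)%C by ring.
  have := B (s0 + h)%C; rewrite E => /(_ Hh) H.
  have {}H : csums (fun k => a (2 + k)%nat * h ^ (2 + k))%C (f (s0 + h)%C - a 0%nat - a 1%nat * h)%C.
  { apply (csums_shift (fun k => a k * h ^ k)%C 2).
    have -> : (csum (fun k => a k * h ^ k) 2 + (f (s0 + h) - a 0%nat - a 1%nat * h) = f (s0 + h))%C
      by rewrite /=; ring.
    done. }
  apply: csums_bound H.
  have A' : rbdd (fun n => Cmod (a (2 + n)%nat) * r ^ (2 + n)) M.
  { apply (rbdd_shift (fun n => Cmod (a n) * r ^ n)) => // k.
    apply Rmult_le_pos; [apply Cmod_ge_0 | apply pow_le; lra]. }
  have P : 0 < r ^ 2 by apply pow_lt.
  have A2 := rbdd_scal (Cmod h ^ 2 / r ^ 2) _ _ ltac:(apply Rdiv_le_0_compat => //; apply pow_le, Cmod_ge_0) A'.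
  have -> : Cmod h ^ 2 * (M / r ^ 2) = Cmod h ^ 2 / r ^ 2 * M by field; lra.
  apply: rbdd_le A2 => n.
  rewrite Cmod_mult Cmod_pow !pow_add.
  have -> : Cmod h ^ 2 / r ^ 2 * (Cmod (a (2 + n)%nat) * (r ^ 2 * r ^ n)) =
     Cmod (a (2 + n)%nat) * (Cmod h ^ 2 * r ^ n) by field; lra.
  apply Rmult_le_compat_l; first apply Cmod_ge_0.
  apply Rmult_le_compat_l; first apply pow_le, Cmod_ge_0.
  apply pow_incr; split => //; apply Cmod_ge_0.
Qed.

(** [C_derive] takes limits of real and imaginary parts along the horizontal line through [s0], so
    only real increments are compared, by means of the quadratic remainder [ps_tail2]. *)
Lemma ps_derive s0 r M a f : ps s0 r M a f -> C_derive f s0 = a 1%nat.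
Proof.
  move=> H; have Hr := proj1 H.
  pose K := M / r ^ 2 + 1.
  have K0 : 0 < K.
  { have := ps_nonneg _ _ _ _ _ H; rewrite /K => M0.
    have : 0 <= M / r ^ 2 by apply Rdiv_le_0_compat => //; apply pow_lt. lra. }
  have key : forall eps, 0 < eps -> exists delta, 0 < delta /\ forall x, x <> fst s0 -> Rabs (x - fst s0) < delta ->
     Cmod ((f (x, snd s0) - f s0) / ((x, snd s0) - s0) - a 1%nat)%C < eps.
  { move=> eps He; exists (Rmin r (eps / K)); split.
    { apply Rmin_glb_lt => //; by apply Rdiv_lt_0_compat. }
    move=> x Hx Hd.
    pose h := RtoC (x - fst s0).
    have Hh : Cmod h = Rabs (x - fst s0) by apply Cmod_R.
    have h0 : h <> 0 by move=> /RtoC_inj; lra.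
    have E : (x, snd s0) = (s0 + h)%C.
    { rewrite /h /RtoC /Cplus; apply injective_projections => /=; ring. }
    have D1 := Rmin_l r (eps / K); have D2 := Rmin_r r (eps / K).
    have T := ps_tail2 _ _ _ _ _ h H ltac:(lra).
    rewrite E (ps_value _ _ _ _ _ H).
    have -> : ((f (s0 + h) - a 0%nat) / (s0 + h - s0) - a 1%nat =
      (f (s0 + h) - a 0%nat - a 1%nat * h) / h)%C.
    { have -> : (s0 + h - s0 = h)%C by ring. by field. }
    rewrite Cmod_div //.
    have hp : 0 < Cmod h by apply Cmod_gt_0.
    apply (Rmult_lt_reg_r (Cmod h)) => //.
    have -> : forall y, y / Cmod h * Cmod h = y by move=> y; field; lra.
    apply: Rle_lt_trans T _.
    have : Cmod h * K < eps.
    { have : Cmod h < eps / K by lra.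
      move=> Q; have := Rmult_lt_compat_r K _ _ K0 Q.
      by have -> : eps / K * K = eps by field; lra. }
    rewrite /K => Q.
    have -> : Cmod h ^ 2 * (M / r ^ 2) = Cmod h * (Cmod h * (M / r ^ 2)) by ring.
    rewrite (Rmult_comm eps); apply Rmult_lt_compat_l => //; lra. }
  rewrite /C_derive /C_lim; apply injective_projections => /=.
  - apply (f_equal real (y := Finite (fst (a 1%nat)))), is_lim_unique, is_lim_spec => eps.
    have [d [d0 Hd]] := key eps (cond_pos eps).
    exists (mkposreal _ d0) => y Hy Hne.
    apply: Rle_lt_trans (Hd y Hne Hy).
    apply: Rle_trans (Rmax_Cmod _); apply Rmax_l.
  - apply (f_equal real (y := Finite (snd (a 1%nat)))), is_lim_unique, is_lim_spec => eps.
    have [d [d0 Hd]] := key eps (cond_pos eps).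
    exists (mkposreal _ d0) => y Hy Hne.
    apply: Rle_lt_trans (Hd y Hne Hy).
    apply: Rle_trans (Rmax_Cmod _); apply Rmax_r.
Qed.

Lemma psb_derive_bound s0 r M f : psb s0 r M f -> Cmod (C_derive f s0) <= M / r.
Proof. move=> [a Ha]; rewrite (ps_derive _ _ _ _ _ Ha); by apply: ps_coef1_bound Ha. Qed.

Lemma pow_n_C (x : C) n : pow_n (K := C_Ring) x n = (x ^ n)%C.
Proof. by elim: n => [|n IH] //=; rewrite IH. Qed.

Lemma psb_analytic s0 r M f : psb s0 r M f -> analytic_at f s0.
Proof.
  move=> [a [Hr [_ B]]]; exists a, r; split => // w Hw.
  apply is_series_csums, (csums_ext (fun n => a n * (w - s0) ^ n)%C).
  - move=> k; rewrite pow_n_C; apply Cmult_comm.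
  - apply B; lra.
Qed.

(** * Exponential and binomial series *)

Lemma sum_n_rsum (u : nat -> R) n : sum_n u n = rsum u (S n).
Proof.
  elim: n => [|n IH]; first by rewrite sum_O /=; ring.
  by rewrite sum_Sn IH.
Qed.

Lemma Cmod_le_abs (z : C) : Cmod z <= Rabs (Re z) + Rabs (Im z).
Proof.
  have -> : z = (RtoC (Re z) + RtoC (Im z) * Ci)%C.
  { apply injective_projections; rewrite /Re /Im /=; ring. }
  apply: Rle_trans (Cmod_triangle _ _) _.
  rewrite Cmod_mult !Cmod_R Cmod_Ci.
  have -> : Re (RtoC (Re z) + RtoC (Im z) * Ci)%C = Re z by rewrite /Re /Im /=; ring.
  have -> : Im (RtoC (Re z) + RtoC (Im z) * Ci)%C = Im z by rewrite /Re /Im /=; ring.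
  lra.
Qed.

Lemma csums_pair u x y :
  is_series (fun n => Re (u n)) x -> is_series (fun n => Im (u n)) y -> csums u (x, y).
Proof.
  move=> Hx Hy eps He.
  have He2 : 0 < eps / 2 by lra.
  have [N HN] := proj1 (filterlim_locally _ _) Hx (mkposreal _ He2).
  have [N' HN'] := proj1 (filterlim_locally _ _) Hy (mkposreal _ He2).
  exists (S (N + N')) => -[|n] Hn; first lia.
  have A := HN n ltac:(lia); have B := HN' n ltac:(lia).
  rewrite sum_n_rsum in A; rewrite sum_n_rsum in B.
  apply: Rle_lt_trans (Cmod_le_abs _) _.
  have -> : Re (csum u (S n) - (x, y))%C = rsum (fun k => Re (u k)) (S n) - x by rewrite -Re_csum.
  have -> : Im (csum u (S n) - (x, y))%C = rsum (fun k => Im (u k)) (S n) - y by rewrite -Im_csum.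
  have {}A : Rabs (rsum (fun k => Re (u k)) (S n) - x) < eps / 2 by exact A.
  have {}B : Rabs (rsum (fun k => Im (u k)) (S n) - y) < eps / 2 by exact B.
  lra.
Qed.

(** Serves for linear differential equations on [[0, 1]], by which the sums of power series are
    identified. *)
Definition dC (f : R -> C) (t : R) (d : C) : Prop :=
  is_derive (fun x => Re (f x)) t (Re d) /\ is_derive (fun x => Im (f x)) t (Im d).

Lemma im_le_Cmod (z : C) : Rabs (Im z) <= Cmod z.
Proof. apply: Rle_trans (Rmax_Cmod z); apply Rmax_r. Qed.

Lemma CV_radius_gt (a : nat -> R) rho M :
  (forall n, Rabs (a n) * rho ^ n <= M) -> 1 < rho -> forall t, 0 <= t <= 1 ->
  Rbar_lt (Rabs t) (CV_radius a).
Proof.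
  move=> H Hr t Ht.
  apply (Rbar_lt_le_trans _ rho); first by rewrite Rabs_pos_eq /=; lra.
  apply (proj1 (CV_radius_bounded a)); exists M => n.
  rewrite Rabs_mult (Rabs_pos_eq (rho ^ n)) //; apply pow_le; lra.
Qed.

Lemma pser_dC (a : nat -> C) rho M :
  (forall n, Cmod (a n) * rho ^ n <= M) -> 1 < rho ->
  exists g g' : R -> C, forall t, 0 <= t <= 1 ->
    csums (fun n => a n * RtoC t ^ n)%C (g t) /\
    csums (fun n => RtoC (INR (S n)) * a (S n) * RtoC t ^ n)%C (g' t) /\ dC g t (g' t).
Proof.
  move=> H Hr.
  pose u n := Re (a n); pose v n := Im (a n).
  have P n : 0 <= rho ^ n by apply pow_le; lra.
  have Hu : forall n, Rabs (u n) * rho ^ n <= M.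
  { move=> n; apply: Rle_trans (H n); apply Rmult_le_compat_r => //; apply re_le_Cmod. }
  have Hv : forall n, Rabs (v n) * rho ^ n <= M.
  { move=> n; apply: Rle_trans (H n); apply Rmult_le_compat_r => //; apply im_le_Cmod. }
  exists (fun t => (PSeries u t, PSeries v t)), (fun t => (PSeries (PS_derive u) t, PSeries (PS_derive v) t)) => t Ht.
  have Ru := CV_radius_gt u rho M Hu Hr t Ht.
  have Rv := CV_radius_gt v rho M Hv Hr t Ht.
  have reX (z : C) n : Re (z * RtoC t ^ n)%C = Re z * t ^ n by rewrite -RtoC_pow /Re /Im /=; ring.
  have imX (z : C) n : Im (z * RtoC t ^ n)%C = Im z * t ^ n by rewrite -RtoC_pow /Re /Im /=; ring.
  have re2 n : Re (RtoC (INR (S n)) * a (S n))%C = PS_derive u n.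
  { rewrite /PS_derive /u /Re /Im; move: (INR (S n)) => c /=; ring. }
  have im2 n : Im (RtoC (INR (S n)) * a (S n))%C = PS_derive v n.
  { rewrite /PS_derive /v /Re /Im; move: (INR (S n)) => c /=; ring. }
  have G w : Rbar_lt (Rabs t) (CV_radius w) -> is_series (fun n => w n * t ^ n) (PSeries w t).
  { move=> Hw; apply is_pseries_R, PSeries_correct, CV_radius_inside => //. }
  have D w : Rbar_lt (Rabs t) (CV_radius w) -> Rbar_lt (Rabs t) (CV_radius (PS_derive w)).
  { by rewrite CV_radius_derive. }
  split; [|split].
  - apply csums_pair; (apply: is_series_ext; last by apply G) => n; by rewrite ?reX ?imX.
  - apply csums_pair; (apply: is_series_ext; last by apply G, D) => n; by rewrite ?reX ?imX ?re2 ?im2.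
  - by split => /=; apply is_derive_PSeries.
Qed.

Lemma dC_const c t : dC (fun _ => c) t (RtoC 0).
Proof. split; exact (is_derive_const (K := R_AbsRing) (V := R_NormedModule) _ t). Qed.

Lemma dC_id t : dC RtoC t (RtoC 1).
Proof.
  split; first exact (is_derive_id (K := R_AbsRing) t).
  exact (is_derive_const (K := R_AbsRing) (V := R_NormedModule) _ t).
Qed.

Lemma dC_mult f g t df dg :
  dC f t df -> dC g t dg -> dC (fun x => f x * g x)%C t (df * g t + f t * dg)%C.
Proof.
  move=> [A B] [A' B']; split => /=.
  - have H1 := is_derive_mult _ _ _ _ _ A A' Rmult_comm.
    have H2 := is_derive_mult _ _ _ _ _ B B' Rmult_comm.
    have H := is_derive_minus _ _ _ _ _ H1 H2.
    apply: is_derive_ext; last (evar_last; first apply H).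
    + by [].
    + rewrite /minus /plus /opp /mult /Re /Im /=; ring.
  - have H1 := is_derive_mult _ _ _ _ _ A B' Rmult_comm.
    have H2 := is_derive_mult _ _ _ _ _ B A' Rmult_comm.
    have H := is_derive_plus _ _ _ _ _ H1 H2.
    apply: is_derive_ext; last (evar_last; first apply H).
    + move=> x; rewrite /plus /mult /Re /Im /=; ring.
    + rewrite /minus /plus /opp /mult /Re /Im /=; ring.
Qed.

Lemma dC_Cexp f t df : dC f t df -> dC (fun x => Cexp (f x)) t (df * Cexp (f t))%C.
Proof.
  move=> [A B].
  have E := is_derive_comp exp _ _ _ _ (is_derive_exp _) A.
  have Ec := is_derive_comp cos _ _ _ _ (is_derive_cos _) B.
  have Es := is_derive_comp sin _ _ _ _ (is_derive_sin _) B.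
  split => /=.
  - have H := is_derive_mult _ _ _ _ _ E Ec Rmult_comm.
    evar_last; first apply H.
    rewrite /plus /mult /scal /= /mult /Re /Im /=; ring.
  - have H := is_derive_mult _ _ _ _ _ E Es Rmult_comm.
    evar_last; first apply H.
    rewrite /plus /mult /scal /= /mult /Re /Im /=; ring.
Qed.

Lemma Cexp_plus a b : Cexp (a + b)%C = (Cexp a * Cexp b)%C.
Proof.
  rewrite /Cexp /Cmult /=; rewrite exp_plus cos_plus sin_plus.
  apply injective_projections => /=; rewrite /Re /Im; ring.
Qed.

Lemma Cexp_0 : Cexp 0 = RtoC 1.
Proof. rewrite /Cexp /= exp_0 cos_0 sin_0 /RtoC; f_equal; ring. Qed.

Lemma Cexp_neq_0 z : Cexp z <> 0.
Proof.
  move=> H; have := Cexp_plus z (- z)%C.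
  have -> : (z + - z = 0)%C by ring.
  rewrite H Cexp_0 Cmult_0_l => /RtoC_inj; lra.
Qed.

Lemma Cexp_opp z : Cexp (- z)%C = (/ Cexp z)%C.
Proof.
  have H := Cexp_plus z (- z)%C.
  have E : (z + - z = 0)%C by ring.
  rewrite E Cexp_0 in H.
  have N := Cexp_neq_0 z.
  have -> : (/ Cexp z = / Cexp z * (Cexp z * Cexp (- z)))%C by rewrite -H; ring.
  by field.
Qed.

Lemma Cmod_Cexp z : Cmod (Cexp z) = exp (Re z).
Proof.
  rewrite /Cmod /Cexp /=.
  have -> : exp (Re z) * cos (Im z) * (exp (Re z) * cos (Im z) * 1) +
    exp (Re z) * sin (Im z) * (exp (Re z) * sin (Im z) * 1) =
    (exp (Re z))² * ((sin (Im z))² + (cos (Im z))²) by rewrite /Rsqr; ring.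
  rewrite sin2_cos2 Rmult_1_r sqrt_Rsqr //; apply Rlt_le, exp_pos.
Qed.

(** [g * Cexp (- z * l)] has derivative zero. With [l] the identity this identifies the exponential
    series, with [l] a logarithm the binomial series. *)
Lemma dC_exp_unique g l g' l' z :
  (forall t, 0 <= t <= 1 -> dC g t (g' t) /\ dC l t (l' t) /\ g' t = (z * l' t * g t)%C) ->
  g 1 = (g 0 * Cexp (z * (l 1 - l 0)))%C.
Proof.
  move=> H.
  have K t : 0 <= t <= 1 -> dC (fun x => g x * Cexp (- z * l x))%C t (RtoC 0).
  { move=> Ht; have [Hg [Hl E]] := H t Ht.
    have Hc := dC_const (- z)%C t.
    have := dC_mult _ _ _ _ _ Hg (dC_Cexp _ _ _ (dC_mult _ _ _ _ _ Hc Hl)).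
    rewrite E.
    by have -> : (z * l' t * g t * Cexp (- z * l t) + g t * ((0 * l t + - z * l' t) * Cexp (- z * l t)) = 0)%C by ring. }
  have E : (g 0 * Cexp (- z * l 0) = g 1 * Cexp (- z * l 1))%C.
  { apply injective_projections.
    - apply (eq_is_derive (V := R_NormedModule) (fun x => Re (g x * Cexp (- z * l x))%C) 0 1); last lra.
      move=> t Ht; apply (K t Ht).
    - apply (eq_is_derive (V := R_NormedModule) (fun x => Im (g x * Cexp (- z * l x))%C) 0 1); last lra.
      move=> t Ht; apply (K t Ht). }
  have -> : (z * (l 1 - l 0) = - z * l 0 + - (- z * l 1))%C by ring.
  rewrite Cexp_plus Cmult_assoc E Cexp_opp; field; apply Cexp_neq_0.
Qed.

Lemma Cexp_series z : rbdd (fun n => Cmod (z ^ n / RtoC (INR (Factorial.fact n)))%C) (exp (Cmod z)) /\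
  csums (fun n => z ^ n / RtoC (INR (Factorial.fact n)))%C (Cexp z).
Proof.
  have fn n : RtoC (INR (Factorial.fact n)) <> 0.
  { move=> /RtoC_inj; apply INR_fact_neq_0. }
  have E y n : Cmod (y ^ n / RtoC (INR (Factorial.fact n)))%C = Cmod y ^ n / INR (Factorial.fact n).
  { rewrite Cmod_div // Cmod_pow Cmod_R Rabs_pos_eq //; apply pos_INR. }
  have T y : rbdd (fun n => Cmod (y ^ n / RtoC (INR (Factorial.fact n)))%C) (exp (Cmod y)).
  { move=> n; apply: Rle_trans (exp_ge_taylor _ n (Cmod_ge_0 y)).
    rewrite -sum_n_Reals sum_n_rsum (rsum_ext _ (fun n => Cmod y ^ n / INR (Factorial.fact n))) //=.
    have : 0 <= Cmod y ^ n / INR (Factorial.fact n).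
    { apply Rdiv_le_0_compat; [apply pow_le, Cmod_ge_0 | apply INR_fact_lt_0]. }
    lra. }
  split => //.
  (* A radius of convergence of at least [2] makes the endpoint [t = 1] an interior point. *)
  have B n : Cmod (z ^ n / RtoC (INR (Factorial.fact n)))%C * 2 ^ n <= exp (Cmod (2 * z)%C).
  { have := rbdd_term _ _ n (fun k => Cmod_ge_0 _) (T (2 * z)%C).
    rewrite !E Cmod_mult Cmod_R Rabs_pos_eq; last lra.
    rewrite Rpow_mult_distr => Q; apply: Rle_trans Q; apply Req_le; field; apply INR_fact_neq_0. }
  have [g [g' Hg]] := pser_dC _ 2 _ B ltac:(lra).
  have G0 : g 0 = RtoC 1.
  { have [Hs _] := Hg 0 ltac:(lra).
    apply: csums_unique Hs _.
    have Z : RtoC 1 = csum (fun n => z ^ n / RtoC (INR (Factorial.fact n)) * RtoC 0 ^ n)%C 1.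
    { rewrite /=; field. }
    rewrite Z; apply csums_finite => -[|k] Hk; first lia.
    rewrite (Cpow_S (RtoC 0)); ring. }
  have G1 := dC_exp_unique g RtoC g' (fun _ => RtoC 1) z.
  rewrite G0 Cmult_1_l in G1.
  have <- : (z * (1 - 0) = z)%C by ring.
  rewrite -G1.
  - have [Hs _] := Hg 1 ltac:(lra).
    apply: csums_ext Hs => n; have -> : (z * (1 - 0) = z)%C by ring.
    rewrite Cpow_1_l; ring.
  - move=> t Ht; have [Hs [Hs' Hd]] := Hg t Ht; split => //; split.
    + apply dC_id.
    + rewrite Cmult_1_r; apply: csums_unique Hs' _.
      apply: csums_ext (csums_scal z _ _ Hs) => n.
      rewrite Cpow_S.
      have -> : RtoC (INR (Factorial.fact (S n))) = (RtoC (INR (S n)) * RtoC (INR (Factorial.fact n)))%C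
        by rewrite -RtoC_mult -mult_INR.
      field; split => //; move=> /RtoC_inj; apply not_0_INR; lia.
Qed.

Lemma ps_exp s0 r c : 0 < r ->
  ps s0 r (Cmod (Cexp (c * s0)) * exp (Cmod c * r))
    (fun n => Cexp (c * s0) * (c ^ n / RtoC (INR (Factorial.fact n))))%C (fun s => Cexp (c * s)%C).
Proof.
  move=> Hr; split => //; split.
  - have [B _] := Cexp_series (c * RtoC r)%C.
    have -> : Cmod c * r = Cmod (c * RtoC r)%C by rewrite Cmod_mult Cmod_R Rabs_pos_eq //; lra.
    have K := rbdd_scal (Cmod (Cexp (c * s0)%C)) _ _ (Cmod_ge_0 _) B.
    apply: rbdd_le K => n; rewrite Cmod_mult Rmult_assoc.
    apply Rmult_le_compat_l; first apply Cmod_ge_0.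
    rewrite /Cdiv !Cmod_mult Cpow_mult_l !Cmod_mult !Cmod_pow Cmod_R (Rabs_pos_eq r); last lra.
    apply Req_le; ring.
  - move=> s Hs.
    have -> : (c * s = c * s0 + c * (s - s0))%C by ring.
    rewrite Cexp_plus.
    have [_ B] := Cexp_series (c * (s - s0))%C.
    apply: csums_ext (csums_scal (Cexp (c * s0)%C) _ _ B) => n.
    rewrite Cpow_mult_l /Cdiv; ring.
Qed.

Lemma csums_geom (z : C) : Cmod z < 1 -> csums (fun n => z ^ n)%C (/ (1 - z))%C.
Proof.
  move=> Hz.
  have N1 : (1 - z)%C <> 0.
  { move=> E; have E' : z = RtoC 1 by have -> : z = (1 - (1 - z))%C by [ring]; rewrite E; ring.
    rewrite E' Cmod_1 in Hz; lra. }
  have S n : csum (fun n => z ^ n)%C n = (/ (1 - z) - / (1 - z) * z ^ n)%C.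
  { elim: n => [|n IH]; first by rewrite /=; ring.
    rewrite -/(Nat.succ _) /= IH; by field. }
  have Z : clim (fun n => (z ^ n)%C) 0.
  { move=> eps He.
    have : is_lim_seq (fun n => Cmod z ^ n) 0.
    { apply is_lim_seq_geom; rewrite Rabs_pos_eq //; apply Cmod_ge_0. }
    move=> /is_lim_seq_spec /(_ (mkposreal _ He)) [N HN]; exists N => n Hn.
    have := HN n Hn => /=; rewrite Rminus_0_r Rabs_pos_eq; last by apply pow_le, Cmod_ge_0.
    have -> : (z ^ n - 0 = z ^ n)%C by ring.
    by rewrite Cmod_pow. }
  have K := clim_minus _ _ _ _ (clim_const (/ (1 - z))%C) (clim_scal (/ (1 - z))%C _ _ Z).
  have E : (/ (1 - z) - / (1 - z) * 0 = / (1 - z))%C by ring.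
  rewrite E in K; apply: clim_ext K => n; by rewrite S.
Qed.

Lemma rsum_geom x n : 0 <= x < 1 -> rsum (fun k => x ^ k) n <= / (1 - x).
Proof.
  move=> Hx.
  have -> : rsum (fun k => x ^ k) n = (1 - x ^ n) * / (1 - x).
  { elim: n => [|n IH] /=; [ring | rewrite IH; field; lra]. }
  have P : 0 <= x ^ n by apply pow_le; lra.
  have : 0 < / (1 - x) by apply Rinv_0_lt_compat; lra.
  nra.
Qed.

Lemma ps_inv s0 r c : 0 < r < Cmod (s0 - c)%C ->
  ps s0 r (/ (Cmod (s0 - c)%C - r)) (fun n => - (- / (s0 - c)) ^ S n)%C (fun s => / (s - c))%C.
Proof.
  move=> [Hr Hr']; split => //.
  have Ne : (s0 - c)%C <> 0 by move=> E; rewrite E Cmod_0 in Hr'; lra.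
  have Hm : Cmod (- / (s0 - c))%C = / Cmod (s0 - c)%C by rewrite Cmod_opp Cmod_inv.
  move: (Cmod (s0 - c)%C) Hm Hr' => m Hm Hr'.
  have Hq : 0 <= r / m < 1.
  { split; first by apply Rdiv_le_0_compat; lra.
    apply (Rmult_lt_reg_r m); first lra.
    have -> : r / m * m = r by field; lra. lra. }
  split.
  - move=> n; have G := rsum_geom _ n Hq.
    rewrite (rsum_ext _ (fun k => / m * (r / m) ^ k)).
    + rewrite rsum_scal.
      have -> : / (m - r) = / m * / (1 - r / m) by field; lra.
      apply Rmult_le_compat_l => //; apply Rlt_le, Rinv_0_lt_compat; lra.
    + move=> k; rewrite Cmod_opp Cmod_pow Hm /Rdiv Rpow_mult_distr /=; ring.
  - move=> s Hs.
    have Hz : Cmod (- / (s0 - c) * (s - s0))%C < 1.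
    { rewrite Cmod_mult Hm; apply: Rle_lt_trans (proj2 Hq).
      rewrite /Rdiv Rmult_comm; apply Rmult_le_compat_r => //.
      apply Rlt_le, Rinv_0_lt_compat; lra. }
    have G := csums_scal (/ (s0 - c))%C _ _ (csums_geom _ Hz).
    have -> : (/ (s - c) = / (s0 - c) * / (1 - - / (s0 - c) * (s - s0)))%C.
    { have E1 : (s - c <> 0)%C.
      { move=> E. have {}E : (s - s0 = - (s0 - c))%C by have -> : (s - s0 = (s - c) - (s0 - c))%C by [ring]; rewrite E; ring.
        move: Hz; rewrite E.
        have -> : (- / (s0 - c) * - (s0 - c) = 1)%C by field.
        rewrite Cmod_1; lra. }
      have E2 : (1 - - / (s0 - c) * (s - s0) = (s - c) / (s0 - c))%C by field.
      rewrite E2; by field. }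
    apply: csums_ext G => n; rewrite Cpow_mult_l Cpow_S; ring.
Qed.

(** * Principal logarithm and powers of positive reals *)

Lemma RtoC_neq_0 x : x <> 0 -> RtoC x <> 0.
Proof. by move=> H /RtoC_inj. Qed.

(** The arctangent is smooth across the real axis, where the definition of [Carg] switches between
    its two cases, so this form can be differentiated. *)
Lemma Carg_right_half_plane z : 0 < Re z -> Carg z = atan (Im z / Re z).
Proof.
  move=> H.
  (* [y] is the sign [1] or [-1] of the imaginary part, so that one computation serves both cases of
     [Carg]. *)
  have K y : Re z / Cmod z = cos (atan (y * (Im z / Re z))) -> y * y = 1 ->
     Rle_dec 0 (Im z) = Rle_dec 0 (Im z) ->
     0 <= atan (y * (Im z / Re z)) -> acos (Re z / Cmod z) = atan (y * (Im z / Re z)).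
  { move=> E _ _ P; rewrite E acos_cos //; split => //.
    have [_ A] := atan_bound (y * (Im z / Re z)); have := PI_RGT_0; lra. }
  have Cz y : y * y = 1 -> Re z / Cmod z = cos (atan (y * (Im z / Re z))).
  { move=> Hy; rewrite cos_atan.
    have -> : 1 + (y * (Im z / Re z))² = ((Re z)^2 + (Im z)^2) / (Re z)^2.
    { rewrite /Rsqr.
      have -> : y * (Im z / Re z) * (y * (Im z / Re z)) = (y * y) * ((Im z)^2 / (Re z)^2) by field; lra.
      rewrite Hy; field; lra. }
    have P : 0 < (Re z)^2 by apply pow_lt.
    have Q : 0 <= (Im z)^2 by apply pow2_ge_0.
    rewrite sqrt_div; [|lra|done].
    rewrite (sqrt_pow2 (Re z)); last lra.
    have S : 0 < sqrt ((Re z)^2 + (Im z)^2) by apply sqrt_lt_R0; lra.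
    rewrite /Cmod -/(Re z) -/(Im z); field; split; lra. }
  rewrite /Carg; case: Rle_dec => Hi.
  - rewrite (K 1); [by rewrite Rmult_1_l | apply Cz; ring | ring | done |].
    rewrite Rmult_1_l -atan_0; case: (Req_dec (Im z) 0) => [->|Hn].
    + by rewrite /Rdiv Rmult_0_l; lra.
    + apply Rlt_le, atan_increasing, Rdiv_lt_0_compat; lra.
  - rewrite (K (-1)); [ | apply Cz; ring | ring | done |].
    + rewrite -atan_opp; congr atan; ring.
    + rewrite -atan_0; apply Rlt_le, atan_increasing.
      have -> : -1 * (Im z / Re z) = (- Im z) / Re z by field; lra.
      apply Rdiv_lt_0_compat; lra.
Qed.

Lemma Clog_RtoC x : 0 < x -> Clog (RtoC x) = RtoC (ln x).
Proof.
  move=> H; rewrite /Clog Carg_right_half_plane //= Cmod_R Rabs_pos_eq; last lra.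
  by rewrite /Rdiv Rmult_0_l atan_0.
Qed.

Definition xp (x : R) (z : C) : C := Cexp (z * RtoC (ln x)).

Lemma Cpower_RtoC x z : 0 < x -> Cpower (RtoC x) z = xp x z.
Proof. by move=> H; rewrite /Cpower Clog_RtoC. Qed.

Lemma xp_plus x z z' : xp x (z + z')%C = (xp x z * xp x z')%C.
Proof. rewrite /xp -Cexp_plus; congr Cexp; ring. Qed.

Lemma xp_opp x z : xp x (- z)%C = (/ xp x z)%C.
Proof. rewrite /xp -Cexp_opp; congr Cexp; ring. Qed.

Lemma xp_mult x y z : 0 < x -> 0 < y -> xp (x * y) z = (xp x z * xp y z)%C.
Proof. move=> Hx Hy; rewrite /xp -Cexp_plus ln_mult // RtoC_plus; congr Cexp; ring. Qed.

Lemma Cexp_RtoC x : Cexp (RtoC x) = RtoC (exp x).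
Proof. rewrite /Cexp /= cos_0 sin_0 /RtoC; f_equal; ring. Qed.

Lemma xp_INR x n : 0 < x -> xp x (RtoC (INR n)) = (RtoC x ^ n)%C.
Proof.
  move=> H; rewrite /xp -RtoC_mult Cexp_RtoC -ln_pow // exp_ln; last by apply pow_lt.
  apply RtoC_pow.
Qed.

Lemma xp_0 x : xp x 0 = RtoC 1.
Proof. by rewrite /xp Cmult_0_l Cexp_0. Qed.

Lemma Cmod_xp x z : Cmod (xp x z) = exp (Re z * ln x).
Proof. rewrite /xp Cmod_Cexp; congr exp; rewrite /Re /=; ring. Qed.

(** The condition on [w] keeps the segment from [x] to [x + w] in the right half plane, where [Carg]
    is an arctangent. *)
Lemma dC_Clog (x : R) (w : C) t : Cmod w < x -> 0 <= t <= 1 ->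
  dC (fun t => Clog (RtoC x + RtoC t * w)%C) t (w / (RtoC x + RtoC t * w))%C.
Proof.
  move=> Hw Ht.
  have P y : Rabs y <= 1 -> 0 < x + y * Re w.
  { move=> Hy.
    have : Rabs (y * Re w) < x.
    { rewrite Rabs_mult; apply: Rle_lt_trans Hw.
      rewrite -[X in _ <= X]Rmult_1_l; apply Rmult_le_compat; try apply Rabs_pos => //.
      - done.
      - apply re_le_Cmod. }
    move=> Q; have := Rabs_def2 _ _ Q; lra. }
  have P1 : 0 < x + t * Re w by apply P; rewrite Rabs_pos_eq; lra.
  have Pp : 0 < x by have := Cmod_ge_0 w; lra.
  have X2 : 0 < (x + t * Re w)^2 + (t * Im w)^2.
  { have := pow2_ge_0 (t * Im w); have := pow_lt _ 2 P1; lra. }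
  have RE y : Re (RtoC x + RtoC y * w)%C = x + y * Re w by rewrite /Re /=; ring.
  have IM y : Im (RtoC x + RtoC y * w)%C = y * Im w by rewrite /Re /Im /=; ring.
  have loc : locally t (fun y => 0 < x + y * Re w).
  { have Hc : continuous (fun y => x + y * Re w) t.
    { apply (ex_derive_continuous (V := R_NormedModule)); by auto_derive. }
    apply (Hc (fun y => 0 < y)); exists (mkposreal _ P1) => z /= Hz.
    move: (Rabs_def2 _ _ Hz); rewrite /minus /plus /opp /=; lra. }
  have dre : Re (w / (RtoC x + RtoC t * w))%C = ((x + t * Re w) * Re w + (t * Im w) * Im w) / ((x + t * Re w)^2 + (t * Im w)^2).
  { rewrite /Cdiv /Cinv.
    have -> : fst (RtoC x + RtoC t * w)%C = x + t * Re w by rewrite -RE.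
    have -> : snd (RtoC x + RtoC t * w)%C = t * Im w by rewrite -IM.
    rewrite /Re /Im /= in X2 *; field; lra. }
  have dim : Im (w / (RtoC x + RtoC t * w))%C = ((x + t * Re w) * Im w - (t * Im w) * Re w) / ((x + t * Re w)^2 + (t * Im w)^2).
  { rewrite /Cdiv /Cinv.
    have -> : fst (RtoC x + RtoC t * w)%C = x + t * Re w by rewrite -RE.
    have -> : snd (RtoC x + RtoC t * w)%C = t * Im w by rewrite -IM.
    rewrite /Re /Im /= in X2 *; field; lra. }
  split.
  - rewrite dre.
    apply (is_derive_ext (fun y => ln (sqrt ((x + y * Re w)^2 + (y * Im w)^2)))).
    { move=> y; by rewrite -RE -IM. }
    have S : 0 < sqrt ((x + t * Re w)^2 + (t * Im w)^2) by apply sqrt_lt_R0.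
    auto_derive; rewrite /= in X2 S *; repeat split; try lra.
    have Q := sqrt_sqrt _ (Rlt_le _ _ X2).
    set s := sqrt _ in S Q *.
    rewrite -Q; field; lra.
  - rewrite dim.
    apply (is_derive_ext_loc (fun y => atan ((y * Im w) / (x + y * Re w)))).
    { apply: filter_imp loc => y Hy; rewrite -IM -RE.
      rewrite -Carg_right_half_plane //; by rewrite RE. }
    auto_derive; first lra.
    rewrite /= in X2 *; field; repeat split; nra.
Qed.

(** * Generalized binomial coefficients *)

Fixpoint bn (n : nat) (z : C) : C :=
  match n with O => RtoC 1 | S m => (bn m z * (z - RtoC (INR m)) / RtoC (INR (S m)))%C end.

Lemma RtoC_INR_S n : RtoC (INR (S n)) <> 0.
Proof. apply RtoC_neq_0, not_0_INR; lia. Qed.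

(** The ratio [(T + n) / (n + 1)] is at most [2] once [n >= T], so the initial terms fix the
    constant. [K] depends on [T] alone, since the recursion determines the sequence. *)
Lemma growth_2 T : 0 <= T -> exists K, 0 <= K /\ forall m : nat -> R,
  m 0%nat = 1 -> (forall n, m (S n) = m n * ((T + INR n) / INR (S n))) -> forall n, m n <= K * 2 ^ n.
Proof.
  move=> HT.
  pose fix m (n : nat) : R := match n with O => 1 | S n => m n * ((T + INR n) / INR (S n)) end.
  have [N HN] : exists N, T <= INR N.
  { exists (Z.to_nat (up T)). have [A _] := archimed T.
    have U : (0 <= up T)%Z by apply le_IZR; lra.
    rewrite INR_IZR_INZ Z2Nat.id //; lra. }
  have m0 n : 0 <= m n.
  { elim: n => [|n IH]; first by rewrite /=; lra.
    change (0 <= m n * ((T + INR n) / INR (S n))).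
    apply Rmult_le_pos => //; apply Rdiv_le_0_compat.
    - have := pos_INR n; lra.
    - apply lt_0_INR; lia. }
  exists (rsum m (S N)); split; first by apply rsum_nonneg.
  move=> m' H0 HS n.
  have -> : m' n = m n by elim: n => [|n IH] //=; rewrite HS IH.
  have R0 := rsum_nonneg m (S N) m0.
  elim: n => [|n IH].
  - have := rsum_incr m 1 (S N) m0 ltac:(lia) => /=; lra.
  - case: (Compare_dec.le_lt_dec (S n) N) => Hn.
    + have A : m (S n) <= rsum m (S N).
      { have := rsum_incr m (S (S n)) (S N) m0 ltac:(lia).
        have -> : rsum m (S (S n)) = rsum m (S n) + m (S n) by [].
        have := rsum_nonneg m (S n) m0; lra. }
      have := pow_R1_Rle 2 (S n) ltac:(lra) => P; nra.
    + change (m n * ((T + INR n) / INR (S n)) <= rsum m (S N) * 2 ^ S n).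
      have B : (T + INR n) / INR (S n) <= 2.
      { have P : 0 < INR (S n) by apply lt_0_INR; lia.
        apply (Rmult_le_reg_r (INR (S n))) => //.
        have -> : (T + INR n) / INR (S n) * INR (S n) = T + INR n by field; lra.
        have : INR N <= INR n by apply le_INR; lia.
        rewrite S_INR; lra. }
      have := m0 n => Mn.
      have -> : rsum m (S N) * 2 ^ S n = (rsum m (S N) * 2 ^ n) * 2 by rewrite -tech_pow_Rmult; ring.
      apply: (Rle_trans _ (m n * 2)); first by apply Rmult_le_compat_l.
      apply Rmult_le_compat_r => //; lra.
Qed.

(** Each step of the recursion multiplies the norm by at most [(|s0 - c| + r + n) / (n + 1)], which
    [growth_2] controls. *)
Lemma psb_bn c s0 r : 0 < r -> exists K, 0 <= K /\
  forall n, psb s0 r (K * 2 ^ n) (fun s => bn n (c - s)%C).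
Proof.
  move=> Hr.
  have T0 : 0 <= Cmod (s0 - c)%C + r by have := Cmod_ge_0 (s0 - c)%C; lra.
  have [K [K0 HK]] := growth_2 _ T0.
  exists K; split => // n.
  pose fix m (n : nat) : R := match n with O => 1 | S n => m n * ((Cmod (s0 - c)%C + r + INR n) / INR (S n)) end.
  apply (psb_mono _ _ (m n)); first by apply (HK m).
  elim: n => [|n IH].
  - have := psb_const s0 r (RtoC 1) Hr; by rewrite Cmod_1.
  - have A := psb_id s0 r (c - RtoC (INR n))%C Hr.
    have B := psb_mult _ _ _ _ _ _ IH (psb_scal _ _ _ _ (- / RtoC (INR (S n)))%C A).
    apply: psb_mono (psb_ext _ _ _ _ _ _ B).
    + change (m (S n)) with (m n * ((Cmod (s0 - c)%C + r + INR n) / INR (S n))).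
      apply Rmult_le_compat_l; first by apply: psb_nonneg IH.
      have P : 0 < INR (S n) by apply lt_0_INR; lia.
      rewrite Cmod_opp Cmod_inv; last apply RtoC_INR_S.
      rewrite Cmod_R Rabs_pos_eq; last lra.
      rewrite /Rdiv Rmult_comm; apply Rmult_le_compat_r.
      { apply Rlt_le, Rinv_0_lt_compat; lra. }
      have : Cmod (s0 - (c - RtoC (INR n)))%C <= Cmod (s0 - c)%C + INR n.
      { have -> : (s0 - (c - RtoC (INR n)) = (s0 - c) + RtoC (INR n))%C by ring.
        apply: Rle_trans (Cmod_triangle _ _) _.
        rewrite Cmod_R Rabs_pos_eq; [lra | apply pos_INR]. }
      lra.
    + move=> s _; change (bn (S n) (c - s)%C) with (bn n (c - s) * (c - s - RtoC (INR n)) / RtoC (INR (S n)))%C.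
      field; apply RtoC_INR_S.
Qed.

Lemma bn_bound z : exists K, 0 <= K /\ forall n, Cmod (bn n z) <= K * 2 ^ n.
Proof.
  have [K [K0 HK]] := psb_bn z 0 1 ltac:(lra).
  exists K; split => // n.
  have := psb_bound _ _ _ _ 0 (HK n); rewrite Cmod_minus_diag.
  have -> : (z - 0 = z)%C by ring. apply; lra.
Qed.

Lemma bn_S n z : (RtoC (INR (S n)) * bn (S n) z = bn n z * (z - RtoC (INR n)))%C.
Proof.
  change (bn (S n) z) with (bn n z * (z - RtoC (INR n)) / RtoC (INR (S n)))%C.
  field; apply RtoC_INR_S.
Qed.

Lemma csums_0_pow (a : nat -> C) : csums (fun n => a n * RtoC 0 ^ n)%C (a 0%nat).
Proof.
  have E : csum (fun n => a n * RtoC 0 ^ n)%C 1 = a 0%nat by rewrite /=; ring.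
  rewrite -E; apply csums_finite => -[|k] Hk; first lia.
  rewrite Cpow_S; ring.
Qed.

(** Both sides solve the same differential equation along the segment from [x] to [x + w]. The
    factor [8] beats the growth [2^n] of the binomial coefficients and leaves a radius of
    convergence of at least [2]. *)
Lemma binomial_series x (w z : C) : 0 < x -> 8 * Cmod w <= x ->
  csums (fun n => xp x z * (bn n z * (w / RtoC x) ^ n))%C (Cpower (RtoC x + w) z).
Proof.
  move=> Hx Hw.
  have xC : RtoC x <> 0 by apply RtoC_neq_0; lra.
  have w0 := Cmod_ge_0 w.
  pose u := (w / RtoC x)%C.
  have Hu : Cmod u <= / 8.
  { rewrite /u Cmod_div // Cmod_R Rabs_pos_eq; last lra.
    apply (Rmult_le_reg_r x) => //.
    have -> : Cmod w / x * x = Cmod w by field; lra. lra. }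
  have [K [K0 HK]] := bn_bound z.
  have B n : Cmod (bn n z * u ^ n)%C * 2 ^ n <= K.
  { rewrite Cmod_mult Cmod_pow.
    have P2 : 0 < 2 ^ n by apply pow_lt; lra.
    have P8 : 0 < (/ 8) ^ n by apply pow_lt; lra.
    apply (Rle_trans _ (K * 2 ^ n * (/ 8) ^ n * 2 ^ n)).
    - apply Rmult_le_compat_r; first lra.
      apply Rmult_le_compat => //; try apply Cmod_ge_0; first apply pow_le, Cmod_ge_0.
      apply pow_incr; split => //; apply Cmod_ge_0.
    - have -> : K * 2 ^ n * (/ 8) ^ n * 2 ^ n = K * (2 * / 8 * 2) ^ n by rewrite !Rpow_mult_distr; ring.
      have : (2 * / 8 * 2) ^ n <= 1 by rewrite -(pow1 n); apply pow_incr; lra.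
      nra. }
  have [g [g' Hg]] := pser_dC _ 2 _ B ltac:(lra).
  have G0 : g 0 = RtoC 1.
  { have [Hs _] := Hg 0 ltac:(lra).
    apply: csums_unique Hs _.
    have := csums_0_pow (fun n => bn n z * u ^ n)%C => /=.
    by rewrite Cmult_1_l. }
  have Hwx : Cmod w < x by lra.
  have G1 := dC_exp_unique g (fun t => Clog (RtoC x + RtoC t * w)%C) g' (fun t => (w / (RtoC x + RtoC t * w))%C) z.
  have key t : 0 <= t <= 1 -> g' t = (z * (w / (RtoC x + RtoC t * w)) * g t)%C.
  { move=> Ht.
    have [Ha [Hb _]] := Hg t Ht.
    have D : (RtoC x + RtoC t * w)%C <> 0.
    { move=> E0.
      have E1 : (RtoC x = - (RtoC t * w))%C by have -> : (- (RtoC t * w) = RtoC x - (RtoC x + RtoC t * w))%C by [ring]; rewrite E0; ring.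
      have := f_equal Cmod E1; rewrite Cmod_opp Cmod_mult !Cmod_R !Rabs_pos_eq; try lra. nra. }
    have H1 := csums_scal (RtoC t * u)%C _ _ Hb.
    have H3 := csums_scal (z * u)%C _ _ Ha.
    (* The equation [(1 + t u) g' = z u g] holds coefficient by coefficient: it is the recursion
       [bn_S]. *)
    have E : (g' t + RtoC t * u * g' t = z * u * g t)%C.
    { have H1' : csums (fun n => u * (RtoC (INR n) * (bn n z * u ^ n)) * RtoC t ^ n)%C (RtoC t * u * g' t)%C.
      { have -> : (RtoC t * u * g' t = csum (fun n => u * (RtoC (INR n) * (bn n z * u ^ n)) * RtoC t ^ n) 1 + RtoC t * u * g' t)%C
          by rewrite /=; ring.
        apply csums_shift; apply: csums_ext H1 => n.
        rewrite Nat.add_1_l (Cpow_S (RtoC t)); ring. }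
      apply: csums_unique (csums_plus _ _ _ _ Hb H1') _.
      apply: csums_ext H3 => n.
      rewrite (Cmult_assoc (RtoC (INR (S n)))) bn_S Cpow_S; ring. }
    have -> : (g' t = (g' t + RtoC t * u * g' t) * (RtoC x / (RtoC x + RtoC t * w)))%C.
    { rewrite /u; field; by split. }
    rewrite E /u; field; by split. }
  have {}G1 := G1 (fun t Ht => conj (proj2 (proj2 (Hg t Ht))) (conj (dC_Clog x w t Hwx Ht) (key t Ht))).
  have [Hs _] := Hg 1 ltac:(lra).
  have -> : Cpower (RtoC x + w)%C z = (xp x z * g 1)%C.
  { rewrite G1 G0 /Cpower /xp Cmult_1_l -Cexp_plus.
      have -> : (RtoC x + 0 * w = RtoC x)%C by ring.
      have -> : (RtoC x + 1 * w = RtoC x + w)%C by ring.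
      rewrite Clog_RtoC //; congr Cexp; ring. }
  apply csums_scal; apply: csums_ext Hs => n; by rewrite Cpow_1_l Cmult_1_r.
Qed.

(** * Bernoulli polynomials *)

Lemma conv_ext a a' b b' n : (forall k, a k = a' k) -> (forall k, b k = b' k) -> conv a b n = conv a' b' n.
Proof. move=> H H'; apply csum_ext => k; by rewrite H H'. Qed.

Lemma csum_rev u n : csum u n = csum (fun k => u (n - S k)%nat) n.
Proof.
  elim: n => [|n IH] //.
  rewrite [RHS]csum_S_l.
  have -> : (S n - 1 = n)%nat by lia.
  rewrite /= IH Cplus_comm; congr Cplus.
Qed.

Lemma conv_comm a b n : conv a b n = conv b a n.
Proof.
  rewrite /conv csum_rev; apply csum_ext_lt => k Hk.
  have -> : (S n - S k = n - k)%nat by lia.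
  have -> : (n - (n - k) = k)%nat by lia.
  apply Cmult_comm.
Qed.

Lemma csum_triangle (F : nat -> nat -> C) n :
  csum (fun k => csum (fun i => F i k) (S k)) n = csum (fun i => csum (fun j => F i (i + j)%nat) (n - i)) n.
Proof.
  elim: n => [|n IH] //.
  rewrite [LHS]/= IH.
  have -> : csum (fun i => csum (fun j => F i (i + j)%nat) (S n - i)) (S n) =
     (csum (fun i => csum (fun j => F i (i + j)%nat) (n - i) + F i n)%C n + F n n)%C.
  { rewrite [LHS]/=; congr Cplus.
    - apply csum_ext_lt => i Hi.
      have -> : (match i with O => S n | S l => (n - l)%nat end = S (n - i))%nat by destruct i; lia.
      rewrite /=; congr Cplus; congr F; lia.
    - have -> : (match n with O => S n | S l => (n - l)%nat end = 1)%nat by destruct n; lia.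
      rewrite /= Nat.add_0_r; ring. }
  rewrite csum_plus /=; ring.
Qed.

Lemma conv_assoc a b c n : conv (conv a b) c n = conv a (conv b c) n.
Proof.
  rewrite /conv.
  rewrite (csum_ext _ (fun k => csum (fun i => a i * b (k - i)%nat * c (n - k)%nat)%C (S k))).
  - rewrite csum_triangle; apply csum_ext_lt => i Hi.
    rewrite -csum_scal.
    have -> : (S n - i = S (n - i))%nat by lia.
    apply csum_ext_lt => j Hj.
    have -> : (i + j - i = j)%nat by lia.
    have -> : (n - (i + j) = n - i - j)%nat by lia.
    ring.
  - move=> k; rewrite Cmult_comm -csum_scal; apply csum_ext => i; ring.
Qed.

Lemma conv_plus_l a b c n : conv (fun k => a k + b k)%C c n = (conv a c n + conv b c n)%C.
Proof. rewrite /conv -csum_plus; apply csum_ext => k; ring. Qed.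

Lemma conv_scal_l x a c n : conv (fun k => x * a k)%C c n = (x * conv a c n)%C.
Proof. rewrite /conv -csum_scal; apply csum_ext => k; ring. Qed.

Lemma conv_shift_l a b n : a 0%nat = RtoC 0 -> conv a b (S n) = conv (fun k => a (S k)) b n.
Proof.
  move=> H; rewrite {1}/conv csum_S_l H.
  rewrite Cmult_0_l Cplus_0_l; apply csum_ext => k; by rewrite Nat.sub_succ.
Qed.

Lemma conv_derivation a b n :
  (RtoC (INR n) * conv a b n = conv (fun k => RtoC (INR k) * a k) b n + conv a (fun k => RtoC (INR k) * b k) n)%C.
Proof.
  rewrite /conv -csum_scal -csum_plus; apply csum_ext_lt => k Hk.
  have {1}-> : n = (k + (n - k))%nat by lia.
  rewrite plus_INR RtoC_plus; ring.
Qed.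

(** Taylor coefficients of [exp (w t)] in [t]. Identities between generating functions are stated
    for coefficient sequences, with [conv] as product, so that no convergence is involved. *)
Definition ex_seq (w : C) (n : nat) : C := (w ^ n / RtoC (INR (Factorial.fact n)))%C.

Lemma RtoC_fact_neq_0 n : RtoC (INR (Factorial.fact n)) <> 0.
Proof. apply RtoC_neq_0, INR_fact_neq_0. Qed.

Lemma RtoC_fact_S n :
  RtoC (INR (Factorial.fact (S n))) = (RtoC (INR (S n)) * RtoC (INR (Factorial.fact n)))%C.
Proof. by rewrite -RtoC_mult -mult_INR. Qed.

Lemma ex_seq_S w n : (RtoC (INR (S n)) * ex_seq w (S n) = w * ex_seq w n)%C.
Proof.
  rewrite /ex_seq RtoC_fact_S Cpow_S; field.
  split; [apply RtoC_fact_neq_0 | apply RtoC_INR_S].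
Qed.

(** Multiplying the [n]-th coefficient by [n] is a derivation for [conv], so both sides satisfy
    [(n + 1) c (n + 1) = (w + v) c n]. *)
Lemma ex_seq_plus w v n : conv (ex_seq w) (ex_seq v) n = ex_seq (w + v)%C n.
Proof.
  elim: n => [|n IH].
  - rewrite /conv /ex_seq /=; field; apply RtoC_neq_0; lra.
  - have N := RtoC_INR_S n.
    have E : (RtoC (INR (S n)) * conv (ex_seq w) (ex_seq v) (S n) = RtoC (INR (S n)) * ex_seq (w + v) (S n))%C.
    { rewrite conv_derivation ex_seq_S -IH.
      rewrite conv_shift_l; last by rewrite /=; ring.
      rewrite (conv_comm (ex_seq w)) conv_shift_l; last by rewrite /=; ring.
      rewrite (conv_ext _ (fun k => w * ex_seq w k)%C _ (ex_seq v)) //; last by move=> k; apply ex_seq_S.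
      rewrite (conv_ext (fun k => RtoC (INR (S k)) * ex_seq v (S k))%C (fun k => v * ex_seq v k)%C _ (ex_seq w)) //; last by move=> k; apply ex_seq_S.
      rewrite !conv_scal_l (conv_comm (ex_seq v)); ring. }
    have -> : conv (ex_seq w) (ex_seq v) (S n) = (/ RtoC (INR (S n)) * (RtoC (INR (S n)) * conv (ex_seq w) (ex_seq v) (S n)))%C
      by field.
    rewrite E; by field.
Qed.

Definition delta1 (n : nat) : C := match n with 1%nat => RtoC 1 | _ => RtoC 0 end.

Lemma conv_delta1 a n : conv delta1 a (S n) = a n.
Proof.
  rewrite conv_shift_l // /conv csum_S_l csum_zero /=.
  - rewrite Nat.sub_0_r; ring.
  - move=> k _; ring.
Qed.

(** Coefficients of [t / (exp t - 1)]. *)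
Definition beta_seq (n : nat) : C := (RtoC (bernoulli n) / RtoC (INR (Factorial.fact n)))%C.

Lemma bernoulli_upto_eq n k : (k <= n)%nat -> bernoulli_upto n k = bernoulli k.
Proof.
  elim: n => [|n IH] H.
  - by have -> : k = 0%nat by lia.
  - case: (Nat.eq_dec k (S n)) => [->|Hne] //.
    rewrite /=; have -> : Nat.leb k n = true by apply Nat.leb_le; lia.
    apply IH; lia.
Qed.

Lemma bernoulli_S m : bernoulli (S m) =
  - / INR (m + 2) * sum_n (fun j => Binomial.C (m + 2) j * bernoulli j) m.
Proof.
  rewrite {1}/bernoulli; change (bernoulli_upto (S m) (S m)) with (if Nat.leb (S m) m then bernoulli_upto m (S m)
    else - / INR (m + 2) * sum_n (fun j => Binomial.C (m + 2) j * bernoulli_upto m j) m).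
  have -> : Nat.leb (S m) m = false by apply Nat.leb_gt; lia.
  congr Rmult; apply sum_n_ext_loc => j Hj; by rewrite bernoulli_upto_eq.
Qed.

(** This is [beta exp t = beta + t], with [delta1] standing for [t]; from order two on it is the
    recursion that defines the Bernoulli numbers. *)
Lemma conv_beta_ex1 n : conv beta_seq (ex_seq 1) n = (beta_seq n + delta1 n)%C.
Proof.
  have F0 : ex_seq 1 0 = RtoC 1 by rewrite /ex_seq /=; field; apply RtoC_neq_0; lra.
  have last_ m : conv beta_seq (ex_seq 1) (S m) = (csum (fun k => beta_seq k * ex_seq 1 (S m - k)%nat)%C (S m) + beta_seq (S m))%C.
  { have -> : conv beta_seq (ex_seq 1) (S m) = (csum (fun k => beta_seq k * ex_seq 1 (S m - k)%nat)%C (S m) + beta_seq (S m) * ex_seq 1 (S m - S m)%nat)%C by [].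
    rewrite Nat.sub_diag F0; ring. }
  case: n => [|[|m]].
  - rewrite /conv /= F0; ring.
  - rewrite last_ /= /beta_seq /ex_seq /bernoulli /=; field; apply RtoC_neq_0; lra.
  - rewrite last_ [delta1 _]/= Cplus_0_r.
    suff -> : csum (fun k => beta_seq k * ex_seq 1 (S (S m) - k)%nat)%C (S (S m)) = 0 by ring.
    have E k : (k <= S m)%nat -> (beta_seq k * ex_seq 1 (S (S m) - k)%nat =
       / RtoC (INR (Factorial.fact (S (S m)))) * RtoC (Binomial.C (S (S m)) k * bernoulli k))%C.
    { move=> Hk; rewrite /beta_seq /ex_seq Cpow_1_l /Binomial.C RtoC_mult RtoC_div ?RtoC_mult.
      - field; repeat split; apply RtoC_fact_neq_0.
      - apply Rmult_integral_contrapositive_currified; apply INR_fact_neq_0. }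
    rewrite (csum_ext_lt _ (fun k => / RtoC (INR (Factorial.fact (S (S m)))) * RtoC (Binomial.C (S (S m)) k * bernoulli k))%C);
      last by move=> k Hk; apply E; lia.
    rewrite csum_scal csum_RtoC.
    suff -> : rsum (fun k => Binomial.C (S (S m)) k * bernoulli k) (S (S m)) = 0 by ring.
    change (rsum (fun k => Binomial.C (S (S m)) k * bernoulli k) (S m) + Binomial.C (S (S m)) (S m) * bernoulli (S m) = 0).
    rewrite bernoulli_S sum_n_rsum.
    have -> : (m + 2 = S (S m))%nat by lia.
    have -> : Binomial.C (S (S m)) (S m) = INR (S (S m)).
    { rewrite /Binomial.C.
      have -> : (S (S m) - S m = 1)%nat by lia.
      rewrite (_ : Factorial.fact (S (S m)) = (S (S m) * Factorial.fact (S m))%nat) // mult_INR.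
      have := INR_fact_neq_0 (S m); move: (INR (Factorial.fact (S m))) => x Hx.
      have -> : INR (Factorial.fact 1) = 1 by []. by field. }
    have : INR (S (S m)) <> 0 by apply not_0_INR; lia.
    move: (INR (S (S m))) => x Hx; by field.
Qed.

Lemma bernoulli_poly_conv n w :
  bernoulli_poly n w = (RtoC (INR (Factorial.fact n)) * conv beta_seq (ex_seq w) n)%C.
Proof.
  rewrite /bernoulli_poly.
  have -> : forall u : nat -> C, sum_n u n = csum u (S n) by move=> u; apply sum_n_csum.
  rewrite /conv -csum_scal; apply csum_ext_lt => k Hk.
  rewrite /beta_seq /ex_seq /Binomial.C RtoC_mult RtoC_div ?RtoC_mult.
  - field; repeat split; apply RtoC_fact_neq_0.
  - apply Rmult_integral_contrapositive_currified; apply INR_fact_neq_0.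
Qed.

Definition bp_seq (w : C) (n : nat) : C := conv beta_seq (ex_seq w) n.

(** Multiplying [beta exp t = beta + t] by [exp (w t)] gives the difference equation of the
    Bernoulli polynomials. *)
Lemma bp_seq_rec w n : conv (bp_seq w) (ex_seq 1) (S n) = (bp_seq w (S n) + ex_seq w n)%C.
Proof.
  rewrite conv_assoc (conv_ext _ beta_seq _ (conv (ex_seq 1) (ex_seq w))) //; last by move=> k; apply conv_comm.
  rewrite -conv_assoc (conv_ext _ _ _ (ex_seq w) _ conv_beta_ex1) //.
  by rewrite conv_plus_l conv_delta1.
Qed.

Definition alt (a : nat -> C) (n : nat) : C := ((- (1)) ^ n * a n)%C.

Lemma conv_alt a b n : conv (alt a) (alt b) n = alt (conv a b) n.
Proof.
  rewrite /alt (conv_ext _ (fun n => a n * (- (1)) ^ n)%C _ (fun n => b n * (- (1)) ^ n)%C); try by move=> k; apply Cmult_comm.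
  rewrite conv_pow; apply Cmult_comm.
Qed.

Lemma alt_ex_seq w n : alt (ex_seq w) n = ex_seq (- w)%C n.
Proof.
  rewrite /alt /ex_seq.
  have -> : (- w = - (1) * w)%C by ring.
  rewrite Cpow_mult_l /Cdiv; ring.
Qed.

Lemma ex_seq_0 n : ex_seq 0 n = match n with O => RtoC 1 | _ => RtoC 0 end.
Proof.
  rewrite /ex_seq; case: n => [|n]; first by rewrite /=; field; apply RtoC_neq_0; lra.
  rewrite Cpow_S /Cdiv; ring.
Qed.

Lemma conv_ex_seq_0 a n : conv a (ex_seq 0) n = a n.
Proof.
  rewrite conv_comm /conv csum_S_l csum_zero ?ex_seq_0 ?Nat.sub_0_r.
  - ring.
  - move=> k _; rewrite ex_seq_0; ring.
Qed.

(* The generating function of [a] is annihilated by [exp t - 1]. *)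
Lemma conv_ex1_fixpoint a : (forall n, conv a (ex_seq 1) n = a n) -> forall n, a n = 0.
Proof.
  move=> H; elim/Wf_nat.lt_wf_ind => n IH.
  have E := H (S n).
  have F0 : ex_seq 1 0 = RtoC 1 by rewrite /ex_seq /=; field; apply RtoC_neq_0; lra.
  have F1 : ex_seq 1 1 = RtoC 1 by rewrite /ex_seq /=; field; apply RtoC_neq_0; lra.
  rewrite /conv in E.
  change (csum (fun k => a k * ex_seq 1 (S n - k)%nat) n + a n * ex_seq 1 (S n - n)%nat
     + a (S n) * ex_seq 1 (S n - S n)%nat = a (S n))%C in E.
  rewrite csum_zero in E; last by move=> k Hk; rewrite IH //; ring.
  rewrite Nat.sub_diag F0 in E; have N : (S n - n = 1)%nat by lia.
  rewrite N F1 in E.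
  have -> : a n = (0 + a n * 1 + a (S n) * 1 - a (S n))%C by ring.
  rewrite E; ring.
Qed.

(** [alt] substitutes [- t] for [t]. Both [beta (- t)] and [beta exp t] solve
    [f exp t = f + t exp t], and [conv_ex1_fixpoint] shows that the solution is unique. *)
Lemma alt_beta_seq n : alt beta_seq n = (beta_seq n + delta1 n)%C.
Proof.
  rewrite -conv_beta_ex1.
  have A m : conv (alt beta_seq) (ex_seq 1) m = (alt beta_seq m + conv delta1 (ex_seq 1) m)%C.
  { have Q k : conv (alt beta_seq) (ex_seq (- (1))%C) k = (alt beta_seq k + - delta1 k)%C.
    { rewrite (conv_ext _ (alt beta_seq) _ (alt (ex_seq 1))) //; last by move=> i; rewrite alt_ex_seq.
      rewrite conv_alt /alt conv_beta_ex1.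
      have -> : (delta1 k = - ((- (1)) ^ k * delta1 k))%C by case: k => [|[|k]] /=; ring.
      case: k => [|[|k]] /=; ring. }
    have W k : conv (alt beta_seq) (ex_seq 1) k = (alt beta_seq k + conv delta1 (ex_seq 1) k)%C.
    { have -> : alt beta_seq k = conv (alt beta_seq) (conv (ex_seq (- (1))%C) (ex_seq 1)) k.
      { rewrite (conv_ext _ (alt beta_seq) _ (ex_seq 0)) //; first by rewrite conv_ex_seq_0.
        move=> i; rewrite ex_seq_plus; congr ex_seq; ring. }
      rewrite -conv_assoc (conv_ext _ _ _ (ex_seq 1) _ Q) // conv_plus_l.
      rewrite (conv_ext (fun k => (- delta1 k)%C) (fun k => - (1) * delta1 k)%C _ (ex_seq 1)) //; last by move=> i; ring.
      rewrite conv_scal_l; ring. }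
    exact: W. }
  have B m : conv (conv beta_seq (ex_seq 1)) (ex_seq 1) m =
     (conv beta_seq (ex_seq 1) m + conv delta1 (ex_seq 1) m)%C.
  { by rewrite (conv_ext _ _ _ (ex_seq 1) _ conv_beta_ex1) // conv_plus_l. }
  have Z : (alt beta_seq n + - (1) * conv beta_seq (ex_seq 1) n = 0)%C.
  { apply (conv_ex1_fixpoint (fun n => alt beta_seq n + - (1) * conv beta_seq (ex_seq 1) n)%C) => m.
    rewrite conv_plus_l conv_scal_l A B; ring. }
  have -> : alt beta_seq n = (alt beta_seq n + - (1) * conv beta_seq (ex_seq 1) n + conv beta_seq (ex_seq 1) n)%C by ring.
  rewrite Z; ring.
Qed.

Lemma bp_seq_reflect w n : bp_seq (1 - w)%C n = alt (bp_seq w) n.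
Proof.
  rewrite /bp_seq -conv_alt.
  rewrite [RHS](conv_ext _ (conv beta_seq (ex_seq 1)) _ (ex_seq (- w)%C)).
  - rewrite conv_assoc; apply conv_ext => // k; by rewrite ex_seq_plus.
  - move=> k; by rewrite alt_beta_seq conv_beta_ex1.
  - move=> k; by rewrite alt_ex_seq.
Qed.

Lemma bernoulli_poly_reflect n w : bernoulli_poly n (1 - w)%C = ((- (1)) ^ n * bernoulli_poly n w)%C.
Proof.
  rewrite !bernoulli_poly_conv; have := bp_seq_reflect w n; rewrite /bp_seq /alt => ->; ring.
Qed.

Lemma bernoulli_poly_0 n : bernoulli_poly n 0 = RtoC (bernoulli n).
Proof.
  rewrite bernoulli_poly_conv conv_ex_seq_0 /beta_seq; field; apply RtoC_fact_neq_0.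
Qed.

Lemma bernoulli_sign n : (2 <= n)%nat -> ((- (1)) ^ n * RtoC (bernoulli n))%C = RtoC (bernoulli n).
Proof.
  case: n => [|[|n]] H; try lia.
  have := alt_beta_seq (S (S n)); rewrite /alt /delta1 /beta_seq Cplus_0_r => E.
  have F := RtoC_fact_neq_0 (S (S n)).
  have -> : (RtoC (bernoulli (S (S n))) = RtoC (INR (Factorial.fact (S (S n)))) *
    (RtoC (bernoulli (S (S n))) / RtoC (INR (Factorial.fact (S (S n))))))%C by field.
  rewrite -{2}E; by field.
Qed.

Lemma bernoulli_poly_at_0 w : bernoulli_poly 0 w = RtoC 1.
Proof.
  rewrite bernoulli_poly_conv /conv /beta_seq /ex_seq /bernoulli /=; field; apply RtoC_neq_0; lra.
Qed.

Lemma bernoulli_poly_at_1 w : bernoulli_poly 1 w = (w - RtoC (/ 2))%C.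
Proof.
  have E : bernoulli 1 = - / 2.
  { rewrite bernoulli_S sum_O /bernoulli /Binomial.C /=; field. }
  rewrite bernoulli_poly_conv conv_1 /beta_seq /ex_seq E (_ : bernoulli 0 = 1) // RtoC_opp RtoC_inv /=.
  - field; split; apply RtoC_neq_0; lra.
  - lra.
Qed.

(* [Binomial.C n j] takes a nonzero junk value for [j > n]. *)
Definition bc (n j : nat) : R := if Nat.leb j n then Binomial.C n j else 0.

Lemma bc_le n j : 0 <= bc n j <= 2 ^ n.
Proof.
  elim: n j => [|n IH] j.
  - rewrite /bc; case: j => [|j] /=; last lra.
    rewrite /Binomial.C /=; lra.
  - have P := pow_lt 2 n ltac:(lra).
    rewrite -tech_pow_Rmult /bc; case: Nat.leb_spec => H; last lra.
    case: j H => [|j] H.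
    + have -> : Binomial.C (S n) 0 = 1.
      { rewrite /Binomial.C Nat.sub_0_r (_ : INR (Factorial.fact 0) = 1) //; field; apply INR_fact_neq_0. }
      have := pow_R1_Rle 2 n ltac:(lra); lra.
    + have A := IH j; have B := IH (S j); move: A B.
      rewrite /bc; case: Nat.leb_spec => H1; case: Nat.leb_spec => H2; try lia.
      * rewrite -pascal; last lia. lra.
      * have -> : j = n by lia. have E k : Binomial.C k k = 1.
        { rewrite /Binomial.C Nat.sub_diag (_ : INR (Factorial.fact 0) = 1) //; field; apply INR_fact_neq_0. }
        rewrite !E; lra.
Qed.

(** The difference equation [bp_seq_rec] at order [n + 1], with factorials turned into binomial
    coefficients; it makes the low coefficients of [Dseq] collapse. *)
Lemma bernoulli_poly_rec n w :
  csum (fun j => RtoC (bc (S n) j) * bernoulli_poly j w)%C (S n) = (RtoC (INR (S n)) * w ^ n)%C.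
Proof.
  have E := bp_seq_rec w n.
  have F0 : ex_seq 1 0 = RtoC 1 by rewrite /ex_seq /=; field; apply RtoC_neq_0; lra.
  rewrite /conv in E.
  change (csum (fun k => bp_seq w k * ex_seq 1 (S n - k)%nat) (S n) +
     bp_seq w (S n) * ex_seq 1 (S n - S n)%nat = bp_seq w (S n) + ex_seq w n)%C in E.
  rewrite Nat.sub_diag F0 in E.
  have {}E : csum (fun k => bp_seq w k * ex_seq 1 (S n - k)%nat)%C (S n) = ex_seq w n.
  { have -> : csum (fun k => bp_seq w k * ex_seq 1 (S n - k)%nat)%C (S n) = (csum (fun k => bp_seq w k * ex_seq 1 (S n - k)%nat) (S n) + bp_seq w (S n) * 1 - bp_seq w (S n))%C by ring.
    rewrite E; ring. }
  have -> : (RtoC (INR (S n)) * w ^ n = RtoC (INR (Factorial.fact (S n))) * ex_seq w n)%C.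
  { rewrite RtoC_fact_S /ex_seq; field; apply RtoC_fact_neq_0. }
  rewrite -E -csum_scal; apply csum_ext_lt => k Hk.
  rewrite bernoulli_poly_conv -/(bp_seq w k) /ex_seq Cpow_1_l /bc.
  have -> : Nat.leb k (S n) = true by apply Nat.leb_le; lia.
  rewrite /Binomial.C RtoC_div ?RtoC_mult.
  - field; repeat split; apply RtoC_fact_neq_0.
  - apply Rmult_integral_contrapositive_currified; apply INR_fact_neq_0.
Qed.

Lemma bn_ff n z : (RtoC (INR (Factorial.fact (S n))) * bn (S n) z =
   RtoC (INR (Factorial.fact n)) * bn n z * (z - RtoC (INR n)))%C.
Proof. rewrite RtoC_fact_S -Cmult_assoc (Cmult_comm (RtoC (INR (Factorial.fact n)))) Cmult_assoc bn_S; ring. Qed.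

(** Falling factorials concatenate: the one of length [j] from [z], followed by the one of length
    [i] from [z - j], has length [i + j]. *)
Lemma bn_mult i j z : (bn j z * bn i (z - RtoC (INR j)) = RtoC (bc (i + j) j) * bn (i + j) z)%C.
Proof.
  have Fi := RtoC_fact_neq_0 i; have Fj := RtoC_fact_neq_0 j.
  have K : ((RtoC (INR (Factorial.fact j)) * bn j z) * (RtoC (INR (Factorial.fact i)) * bn i (z - RtoC (INR j))) =
      RtoC (INR (Factorial.fact (i + j))) * bn (i + j) z)%C.
  { elim: i {Fi} => [|i IH]; first by rewrite /=; ring.
    rewrite bn_ff Nat.add_succ_l bn_ff -IH plus_INR RtoC_plus; ring. }
  rewrite /bc; have -> : Nat.leb j (i + j) = true by apply Nat.leb_le; lia.
  rewrite /Binomial.C; have -> : (i + j - j = i)%nat by lia.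
  rewrite RtoC_div ?RtoC_mult.
  - have -> : (bn j z * bn i (z - RtoC (INR j)) = (RtoC (INR (Factorial.fact j)) * bn j z) * (RtoC (INR (Factorial.fact i)) * bn i (z - RtoC (INR j))) / (RtoC (INR (Factorial.fact j)) * RtoC (INR (Factorial.fact i))))%C
      by field; split.
    rewrite K; field; by split.
  - apply Rmult_integral_contrapositive_currified; apply INR_fact_neq_0.
Qed.

Lemma Cpow_Lipschitz W (w v : C) n : Cmod w <= W -> Cmod v <= W ->
  Cmod (w ^ n - v ^ n)%C <= INR n * W ^ (n - 1) * Cmod (w - v)%C.
Proof.
  move=> Hw Hv; have W0 : 0 <= W by apply: Rle_trans (Cmod_ge_0 w) Hw.
  elim: n => [|n IH]; first by rewrite /= Cmod_minus_diag; lra.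
  have -> : (w ^ S n - v ^ S n = w * (w ^ n - v ^ n) + (w - v) * v ^ n)%C by rewrite !Cpow_S; ring.
  apply: Rle_trans (Cmod_triangle _ _) _.
  rewrite !Cmod_mult Cmod_pow.
  have D0 := Cmod_ge_0 (w - v)%C; have v0 := Cmod_ge_0 v; have w0 := Cmod_ge_0 w.
  have A : Cmod v ^ n <= W ^ n by apply pow_incr.
  have -> : (S n - 1 = n)%nat by lia.
  have B : Cmod w * Cmod (w ^ n - v ^ n)%C <= INR n * W ^ n * Cmod (w - v)%C.
  { apply: (Rle_trans _ (W * (INR n * W ^ (n - 1) * Cmod (w - v)%C))).
    - apply Rmult_le_compat => //; apply Cmod_ge_0.
    - case: n {IH A} => [|n]; first by rewrite /=; lra.
      have -> : (S n - 1 = n)%nat by lia.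
      rewrite -(tech_pow_Rmult W n); lra. }
  rewrite S_INR; nra.
Qed.

Lemma bernoulli_poly_bounds N W : 0 <= W -> exists K, 0 <= K /\
  (forall j w, (j <= N)%nat -> Cmod w <= W -> Cmod (bernoulli_poly j w) <= K) /\
  (forall j w v, (j <= N)%nat -> Cmod w <= W -> Cmod v <= W ->
     Cmod (bernoulli_poly j w - bernoulli_poly j v)%C <= K * Cmod (w - v)%C).
Proof.
  move=> W0.
  have one : forall j, exists K, 0 <= K /\ (forall w, Cmod w <= W -> Cmod (bernoulli_poly j w) <= K) /\
    (forall w v, Cmod w <= W -> Cmod v <= W ->
      Cmod (bernoulli_poly j w - bernoulli_poly j v)%C <= K * Cmod (w - v)%C).
  { move=> j.
    pose b k := Rabs (Binomial.C j k * bernoulli k).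
    have B w : bernoulli_poly j w = csum (fun k => RtoC (Binomial.C j k * bernoulli k) * w ^ (j - k))%C (S j)
      by apply sum_n_csum.
    have b0 k : 0 <= b k by apply Rabs_pos.
    have t0 k : 0 <= b k * W ^ (j - k) by apply Rmult_le_pos => //; apply pow_le.
    have t1 k : 0 <= b k * (INR (j - k) * W ^ (j - k - 1)).
    { apply Rmult_le_pos => //; apply Rmult_le_pos; [apply pos_INR | by apply pow_le]. }
    have S0 := rsum_nonneg _ (S j) t0; have S1 := rsum_nonneg _ (S j) t1.
    exists (rsum (fun k => b k * W ^ (j - k)) (S j) + rsum (fun k => b k * (INR (j - k) * W ^ (j - k - 1))) (S j)).
    split; first lra; split.
    - move=> w Hw; rewrite B; apply: Rle_trans (Cmod_csum _ _) _.
      apply: (Rle_trans _ (rsum (fun k => b k * W ^ (j - k)) (S j))); last lra.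
      apply rsum_le => k; rewrite Cmod_mult Cmod_R Cmod_pow; apply Rmult_le_compat_l; first apply Rabs_pos.
      apply pow_incr; split => //; apply Cmod_ge_0.
    - move=> w v Hw Hv; rewrite !B -csum_minus; apply: Rle_trans (Cmod_csum _ _) _.
      have D0 := Cmod_ge_0 (w - v)%C.
      apply: (Rle_trans _ (rsum (fun k => Cmod (w - v)%C * (b k * (INR (j - k) * W ^ (j - k - 1)))) (S j))).
      + apply rsum_le => k.
        have -> : (RtoC (Binomial.C j k * bernoulli k) * w ^ (j - k) - RtoC (Binomial.C j k * bernoulli k) * v ^ (j - k) =
           RtoC (Binomial.C j k * bernoulli k) * (w ^ (j - k) - v ^ (j - k)))%C by ring.
        rewrite Cmod_mult Cmod_R -/(b k).
        have L := Cpow_Lipschitz W w v (j - k) Hw Hv.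
        have := Rmult_le_compat_l (b k) _ _ (b0 k) L; lra.
      + rewrite rsum_scal; nra. }
  have [K HK] := choice_of _ one.
  have K0 k : 0 <= K k by apply (HK k).
  have le j : (j <= N)%nat -> K j <= rsum K (S N).
  { move=> Hj; have := rsum_incr K (S j) (S N) K0 ltac:(lia) => /=.
    have := rsum_nonneg K j K0; lra. }
  exists (rsum K (S N)); split; first by apply rsum_nonneg.
  split.
  - move=> j w Hj Hw; apply: Rle_trans (le j Hj); by apply (HK j).
  - move=> j w v Hj Hw Hv.
    apply: (Rle_trans _ (K j * Cmod (w - v)%C)); first by apply (HK j).
    apply Rmult_le_compat_r; [apply Cmod_ge_0 | by apply le].
Qed.

(** * Remainders of the Euler-Maclaurin expansion *)

(* Unspecified if the series diverges. *)
Definition cser (u : nat -> C) : C := epsilon (inhabits (RtoC 0)) (csums u).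

Lemma csums_cser u l : csums u l -> cser u = l.
Proof.
  move=> H; refine (csums_unique u _ _ _ H).
  by apply (epsilon_spec (inhabits (RtoC 0)) (csums u)); exists l.
Qed.

Definition rp (x p : R) : R := exp (p * ln x).

Lemma exp_le_mono x y : x <= y -> exp x <= exp y.
Proof. case => [/exp_increasing|->]; lra. Qed.

Lemma rp_pos x p : 0 < rp x p. Proof. apply exp_pos. Qed.

Lemma rp_plus x p p' : rp x (p + p') = rp x p * rp x p'.
Proof. rewrite /rp -exp_plus; congr exp; ring. Qed.

Lemma rp_mult x y p : 0 < x -> 0 < y -> rp (x * y) p = rp x p * rp y p.
Proof. move=> Hx Hy; rewrite /rp ln_mult // -exp_plus; congr exp; ring. Qed.

Lemma rp_opp_INR x n : 0 < x -> rp x (- INR n) = / x ^ n.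
Proof.
  move=> H; rewrite /rp Ropp_mult_distr_l_reverse exp_Ropp -ln_pow // exp_ln //; by apply pow_lt.
Qed.

Lemma rp_antimono x y p : 0 < x <= y -> p <= 0 -> rp y p <= rp x p.
Proof.
  move=> [Hx Hy] Hp; apply exp_le_mono.
  have : ln x <= ln y by apply ln_le.
  nra.
Qed.

Lemma rp_exp_mono x p p' : 1 <= x -> p <= p' -> rp x p <= rp x p'.
Proof.
  move=> Hx Hp; apply exp_le_mono; apply Rmult_le_compat_r => //.
  rewrite -ln_1; apply ln_le; lra.
Qed.

Lemma xp_minus_INR x z n : 0 < x -> xp x (z - RtoC (INR n))%C = (xp x z * / RtoC x ^ n)%C.
Proof.
  move=> H; have -> : (z - RtoC (INR n) = z + - RtoC (INR n))%C by ring.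
  by rewrite xp_plus xp_opp xp_INR.
Qed.

Lemma psb_xp x s0 r c : 1 <= x -> 0 < r ->
  psb s0 r (rp x (- Re s0 + r + Re c)) (fun s => xp x (c - s)%C).
Proof.
  move=> Hx Hr.
  have H := psb_scal _ _ _ _ (xp x c) (ps_psb _ _ _ _ _ (ps_exp s0 r (- RtoC (ln x))%C Hr)).
  have L : 0 <= ln x by rewrite -ln_1; apply ln_le; lra.
  apply: psb_mono (psb_ext _ _ _ _ _ _ H).
  - rewrite Cmod_xp Cmod_Cexp Cmod_opp Cmod_R Rabs_pos_eq // -!exp_plus.
    apply Req_le; congr exp.
    have -> : Re (- RtoC (ln x) * s0)%C = - ln x * Re s0 by rewrite /Re /=; ring.
    ring.
  - move=> s _; rewrite /xp -Cexp_plus; congr Cexp; ring.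
Qed.

(** The terms of index above [N] in the series of [binom(- s, n) d n x^(- s - n)]; the exact error
    of one Euler-Maclaurin step has this shape. *)
Definition tail_term (N : nat) (d : nat -> C) (x : R) (s : C) (n : nat) : C :=
  (bn (S N + n) (- s) * d (S N + n)%nat * xp x (- s - RtoC (INR (S N + n))))%C.

Definition tail (N : nat) (d : nat -> C) (x : R) (s : C) : C := cser (tail_term N d x s).

Lemma psb_cser s0 r (M : nat -> R) B (f : nat -> C -> C) :
  0 < r -> (forall k, psb s0 r (M k) (f k)) -> rbdd M B ->
  psb s0 r B (fun s => cser (fun k => f k s)) /\
  forall s, Cmod (s - s0)%C <= r -> csums (fun k => f k s) (cser (fun k => f k s)).
Proof.
  move=> Hr Hf HB; have [g [Hg1 Hg2]] := psb_series _ _ _ _ _ Hr Hf HB.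
  have E s : Cmod (s - s0)%C <= r -> g s = cser (fun k => f k s)
    by move=> Hs; rewrite (csums_cser _ _ (Hg2 s Hs)).
  split; first by apply: psb_ext Hg1.
  move=> s Hs; rewrite -E //; by apply Hg2.
Qed.

(** Under [4 * V <= x] the dominating geometric series has ratio [2 V / x <= 1/2], the [2] being the
    growth of the binomial coefficients. [K] is chosen before [d], [B] and [x], which makes the
    bound uniform. *)
Lemma psb_tail N s0 r V : 0 < r -> 0 <= V -> exists K, 0 <= K /\
  forall d B x, 0 <= B -> (forall n, Cmod (d n) <= B * V ^ n) -> 4 * V <= x -> 1 <= x ->
  psb s0 r (K * B * rp x (- Re s0 + r - INR (S N))) (tail N d x) /\
  forall s, Cmod (s - s0)%C <= r -> csums (tail_term N d x s) (tail N d x s).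
Proof.
  move=> Hr HV.
  have [K0 [K00 HK0]] := psb_bn 0 s0 r Hr.
  have P2V : 0 <= (2 * V) ^ S N by apply pow_le; lra.
  exists (2 * K0 * (2 * V) ^ S N); split; first nra.
  move=> d B x HB Hd Hx Hx1.
  pose A := K0 * B * rp x (- Re s0 + r - INR (S N)) * (2 * V) ^ S N.
  have A0 : 0 <= A.
  { apply Rmult_le_pos => //; apply Rmult_le_pos; last by apply Rlt_le, rp_pos.
    by apply Rmult_le_pos. }
  apply (psb_cser s0 r (fun n => A * (/ 2) ^ n)) => //.
  - move=> n.
    have H1 := psb_mult _ _ _ _ _ _ (HK0 (S N + n)%nat)
       (psb_scal _ _ _ _ (d (S N + n)%nat) (psb_xp x s0 r (- RtoC (INR (S N + n)))%C Hx1 Hr)).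
    apply: psb_mono (psb_ext _ _ _ _ _ _ H1).
    + have -> : Re (- RtoC (INR (S N + n)))%C = - INR (S N + n) by [].
      rewrite (rp_plus x (- Re s0 + r)) rp_opp_INR; last lra.
      rewrite /A /Rminus (rp_plus x (- Re s0 + r) (- INR (S N))) rp_opp_INR; last lra.
      have P : 0 < rp x (- Re s0 + r) by apply rp_pos.
      have D := Hd (S N + n)%nat.
      have x0 : 0 < x by lra.
      apply (Rle_trans _ (K0 * 2 ^ (S N + n) * (B * V ^ (S N + n) * (rp x (- Re s0 + r) * / x ^ (S N + n))))).
      * apply Rmult_le_compat_l.
        { apply Rmult_le_pos => //; apply pow_le; lra. }
        apply Rmult_le_compat_r => //.
        apply Rmult_le_pos; first lra. apply Rlt_le, Rinv_0_lt_compat; by apply pow_lt.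
      * rewrite !pow_add.
        have N1 : x ^ S N <> 0 by apply pow_nonzero; lra.
        have N2 : x ^ n <> 0 by apply pow_nonzero; lra.
        have -> : K0 * (2 ^ S N * 2 ^ n) * (B * (V ^ S N * V ^ n) * (rp x (- Re s0 + r) * / (x ^ S N * x ^ n))) =
          K0 * B * (rp x (- Re s0 + r) * / x ^ S N) * (2 * V) ^ S N * (2 * V * / x) ^ n.
        { rewrite !Rpow_mult_distr pow_inv; field; by split. }
        have Q0 : 0 < / x ^ S N by apply Rinv_0_lt_compat, pow_lt.
        apply Rmult_le_compat_l.
        { apply Rmult_le_pos => //; apply Rmult_le_pos; [by apply Rmult_le_pos | nra]. }
        have xi : 0 < / x by apply Rinv_0_lt_compat.
        apply pow_incr; split; first nra.
        apply (Rmult_le_reg_r x) => //.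
        have -> : 2 * V * / x * x = 2 * V by field; lra. lra.
    + move=> s _; rewrite /tail_term.
      have -> : (0 - s = - s)%C by ring.
      have -> : (- RtoC (INR (S N + n)) - s = - s - RtoC (INR (S N + n)))%C by ring.
      ring.
  - move=> n; rewrite rsum_scal.
    have G := rsum_geom (/ 2) n ltac:(lra).
    have G2 : / (1 - / 2) = 2 by field.
    have -> : 2 * K0 * (2 * V) ^ S N * B * rp x (- Re s0 + r - INR (S N)) = A * 2 by rewrite /A; ring.
    apply Rmult_le_compat_l => //; rewrite G2 in G; exact G.
Qed.

(* [s (x + w)^(- s - 1) = Q x - Q (x + 1) + O(x^(- Re s - N - 1))] for [Q x = Qs N w x s]; the error is
   exactly [tail N (Dseq N w) x s]. *)
Definition Qs (N : nat) (w : C) (x : R) (s : C) : C :=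
  csum (fun j => bn j (- s) * bernoulli_poly j w * xp x (- s - RtoC (INR j)))%C (S N).

(** The coefficient of [binom(- s, n) x^(- s - n)] in [Q (x + 1) + s (x + w)^(- s - 1)]. *)
Definition Dseq (N : nat) (w : C) (n : nat) : C :=
  (csum (fun j => RtoC (bc n j) * bernoulli_poly j w) (S N) - RtoC (INR n) * w ^ (n - 1))%C.

(** By [bernoulli_poly_rec] the low coefficients are those of [Q x] itself, so that only terms of
    index above [N] survive in [tail_identity]. *)
Lemma Dseq_low N w n : (n <= N)%nat -> Dseq N w n = bernoulli_poly n w.
Proof.
  move=> H; rewrite /Dseq.
  rewrite (_ : S N = (S n + (N - n))%nat); last lia.
  rewrite csum_shift (csum_zero (fun k => RtoC (bc n (S n + k)) * bernoulli_poly (S n + k) w)%C).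
  - case: n H => [|n] H.
    + rewrite /= /bc /= /Binomial.C /=.
      have -> : 1 / (1 * 1) = 1 by field. ring.
    + change (csum (fun j => RtoC (bc (S n) j) * bernoulli_poly j w)%C (S n) +
        RtoC (bc (S n) (S n)) * bernoulli_poly (S n) w + 0 - RtoC (INR (S n)) * w ^ (S n - 1) = bernoulli_poly (S n) w)%C.
      rewrite bernoulli_poly_rec /bc Nat.leb_refl /Binomial.C Nat.sub_diag.
      rewrite (_ : INR (Factorial.fact 0) = 1) //.
      have -> : (S n - 1 = n)%nat by lia.
      have -> : INR (Factorial.fact (S n)) / (INR (Factorial.fact (S n)) * 1) = 1
        by field; apply INR_fact_neq_0.
      ring.
  - move=> k _; rewrite /bc.
    have -> : Nat.leb (S n + k) n = false by apply Nat.leb_gt; lia.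
    ring.
Qed.

Lemma bc_1 i : bc (i + 1) 1 = INR (S i).
Proof.
  rewrite /bc; have -> : Nat.leb 1 (i + 1) = true by apply Nat.leb_le; lia.
  rewrite /Binomial.C; have -> : (i + 1 - 1 = i)%nat by lia.
  have -> : (i + 1 = S i)%nat by lia.
  rewrite (_ : Factorial.fact (S i) = (S i * Factorial.fact i)%nat) // mult_INR (_ : INR (Factorial.fact 1) = 1) //.
  field; apply INR_fact_neq_0.
Qed.

Lemma csums_Qs N w x s : 8 <= x ->
  csums (fun n => csum (fun j => RtoC (bc n j) * bernoulli_poly j w) (S N) *
     (bn n (- s) * xp x (- s - RtoC (INR n))))%C (Qs N w (x + 1) s).
Proof.
  move=> Hx.
  apply: (csums_ext (fun n => csum (fun j => RtoC (bc n j) * bernoulli_poly j w * (bn n (- s) * xp x (- s - RtoC (INR n))))%C (S N))).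
  { move=> n; rewrite [RHS]Cmult_comm -csum_scal; apply csum_ext => j; ring. }
  apply csums_csum => j _.
  have x0 : 0 < x by lra.
  have B := binomial_series x 1 (- s - RtoC (INR j))%C x0 ltac:(rewrite Cmod_1; lra).
  have -> : (bn j (- s) * bernoulli_poly j w * xp (x + 1) (- s - RtoC (INR j)) =
    csum (fun n => RtoC (bc n j) * bernoulli_poly j w * (bn n (- s) * xp x (- s - RtoC (INR n)))) j +
      bn j (- s) * bernoulli_poly j w * xp (x + 1) (- s - RtoC (INR j)))%C.
  { rewrite csum_zero; first ring.
    move=> k Hk; rewrite /bc; have -> : Nat.leb j k = false by apply Nat.leb_gt; lia. ring. }
  apply csums_shift.
  rewrite -(Cpower_RtoC (x + 1)); last lra.
  rewrite RtoC_plus.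
  apply: csums_ext (csums_scal (bn j (- s) * bernoulli_poly j w)%C _ _ B) => i.
  have -> : (j + i = i + j)%nat by lia.
  have E := bn_mult i j (- s)%C.
  have -> : (- s - RtoC (INR (i + j)) = - s - RtoC (INR j) - RtoC (INR i))%C by rewrite plus_INR RtoC_plus; ring.
  rewrite (xp_minus_INR x _ i) //.
  have -> : ((1 / RtoC x) ^ i = / RtoC x ^ i)%C.
  { have -> : (1 / RtoC x = / RtoC x)%C by rewrite /Cdiv Cmult_1_l.
    rewrite Cpow_inv //; apply RtoC_neq_0; lra. }
  transitivity (bernoulli_poly j w * (bn j (- s) * bn i (- s - RtoC (INR j))) * (xp x (- s - RtoC (INR j)) * / RtoC x ^ i))%C; first ring.
  rewrite E; ring.
Qed.

(** The factor [s] turns [binom(- s - 1, i)] into [- (i + 1) binom(- s, i + 1)], which aligns this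
    series with the expansion of [Qs]. *)
Lemma csums_power w x s : 0 < x -> 8 * Cmod w <= x ->
  csums (fun n => - (RtoC (INR n) * w ^ (n - 1)) * (bn n (- s) * xp x (- s - RtoC (INR n))))%C
    (s * Cpower (RtoC x + w) (- s - 1))%C.
Proof.
  move=> Hx Hw.
  have B := binomial_series x w (- s - 1)%C Hx Hw.
  have -> : (s * Cpower (RtoC x + w) (- s - 1) =
     csum (fun n => - (RtoC (INR n) * w ^ (n - 1)) * (bn n (- s) * xp x (- s - RtoC (INR n)))) 1 +
     s * Cpower (RtoC x + w) (- s - 1))%C by rewrite /=; ring.
  apply csums_shift.
  apply: csums_ext (csums_scal s _ _ B) => i.
  have E := bn_mult i 1 (- s)%C.
  rewrite bc_1 in E.
  have b1 : bn 1 (- s)%C = (- s)%C by rewrite /=; field; apply RtoC_neq_0; lra.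
  rewrite b1 in E.
  have -> : (1 + i = i + 1)%nat by lia.
  have -> : (- s - RtoC (INR (i + 1)) = - s - 1 - RtoC (INR i))%C by rewrite plus_INR RtoC_plus /=; ring.
  have -> : (i + 1 - 1 = i)%nat by lia.
  rewrite (xp_minus_INR x _ i) //.
  have -> : ((w / RtoC x) ^ i = w ^ i * / RtoC x ^ i)%C.
  { rewrite /Cdiv Cpow_mult_l Cpow_inv //; apply RtoC_neq_0; lra. }
  have E2 : (s * bn i (- s - 1) = - (RtoC (INR (i + 1)) * bn (i + 1) (- s)))%C.
  { have -> : (i + 1 = S i)%nat by lia. have Ei : (i + 1 = S i)%nat by lia. rewrite Ei in E.
    rewrite -E (_ : RtoC (INR 1) = RtoC 1) //; ring. }
  transitivity ((s * bn i (- s - 1)) * (xp x (- s - 1) * (w ^ i * / RtoC x ^ i)))%C; first ring.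
  rewrite E2; ring.
Qed.

Lemma tail_identity N w x s : 8 <= x -> 8 * Cmod w <= x ->
  tail N (Dseq N w) x s = (Qs N w (x + 1) s - Qs N w x s + s * Cpower (RtoC x + w) (- s - 1))%C.
Proof.
  move=> Hx Hw; apply csums_cser.
  apply (csums_shift (fun n => bn n (- s) * Dseq N w n * xp x (- s - RtoC (INR n)))%C (S N)).
  have -> : (csum (fun n => bn n (- s) * Dseq N w n * xp x (- s - RtoC (INR n))) (S N) +
     (Qs N w (x + 1) s - Qs N w x s + s * Cpower (RtoC x + w) (- s - 1)) =
     Qs N w (x + 1) s + s * Cpower (RtoC x + w) (- s - 1))%C.
  { have -> : csum (fun n => bn n (- s) * Dseq N w n * xp x (- s - RtoC (INR n)))%C (S N) = Qs N w x s.
    { apply csum_ext_lt => n Hn; rewrite Dseq_low //; lia. }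
    ring. }
  have H := csums_plus _ _ _ _ (csums_Qs N w x s Hx) (csums_power w x s ltac:(lra) Hw).
  apply: csums_ext H => n; rewrite /Dseq; ring.
Qed.

Lemma INR_le_pow2 n : INR n <= 2 ^ n.
Proof.
  elim: n => [|n IH]; first by rewrite /=; lra.
  rewrite S_INR -tech_pow_Rmult; have := pow_R1_Rle 2 n ltac:(lra); lra.
Qed.

(** The rate [4 W] comes from the Lipschitz bound, where two factors, each at most [2^n], multiply
    [W^n]. It is the [V] of [psb_tail], whence the thresholds [16 * W]. *)
Lemma Dseq_bounds N W : 1 <= W -> exists B, 0 <= B /\
  (forall w n, Cmod w <= W -> Cmod (Dseq N w n) <= B * (4 * W) ^ n) /\
  (forall w v n, Cmod w <= W -> Cmod v <= W ->
     Cmod (Dseq N w n - Dseq N v n)%C <= B * Cmod (w - v)%C * (4 * W) ^ n).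
Proof.
  move=> HW.
  have [K [K0 [HK1 HK2]]] := bernoulli_poly_bounds N W ltac:(lra).
  have SN := pos_INR (S N).
  exists (INR (S N) * K + 1); split; first nra.
  have P4 n : 2 ^ n * 2 ^ n * W ^ n = (4 * W) ^ n.
  { rewrite -!Rpow_mult_distr; congr pow; ring. }
  have P2 n : 1 <= 2 ^ n by apply pow_R1_Rle; lra.
  have PW n : 1 <= W ^ n by apply pow_R1_Rle.
  have PWm n : W ^ (n - 1) <= W ^ n by apply Rle_pow => //; lia.
  have PWm' n : W ^ (n - 1 - 1) <= W ^ n by apply Rle_pow => //; lia.
  have const c n : rsum (fun _ => c) n = INR n * c.
  { elim: n => [|n IH]; first by rewrite /=; ring.
    rewrite S_INR /= IH; ring. }
  split.
  - move=> w n Hw; rewrite /Dseq; apply: Rle_trans (Cmod_triangle_minus _ _) _.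
    have A : Cmod (csum (fun j => RtoC (bc n j) * bernoulli_poly j w)%C (S N)) <= INR (S N) * K * (4 * W) ^ n.
    { apply: Rle_trans (Cmod_csum _ _) _.
      apply (Rle_trans _ (rsum (fun _ => 2 ^ n * K) (S N))).
      - apply rsum_le_lt => j Hj; have [b0 b1] := bc_le n j.
        rewrite Cmod_mult Cmod_R Rabs_pos_eq //.
        apply Rmult_le_compat => //; [apply Cmod_ge_0 | apply HK1 => //; lia].
      - rewrite const.
        have : 2 ^ n <= (4 * W) ^ n by apply pow_incr; lra.
        have : 0 <= INR (S N) * K by nra. nra. }
    have D : Cmod (RtoC (INR n) * w ^ (n - 1))%C <= (4 * W) ^ n.
    { rewrite Cmod_mult Cmod_R Cmod_pow Rabs_pos_eq; last apply pos_INR.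
      rewrite -P4.
      have I := INR_le_pow2 n.
      have : Cmod w ^ (n - 1) <= W ^ n.
      { apply: Rle_trans (PWm n); apply pow_incr; split => //; apply Cmod_ge_0. }
      have : 0 <= Cmod w ^ (n - 1) by apply pow_le, Cmod_ge_0.
      have := P2 n; have := PW n; have := pos_INR n => ? ? ? ? ?.
      apply (Rle_trans _ (2 ^ n * W ^ n)); first by apply Rmult_le_compat.
      apply Rmult_le_compat_r; nra. }
    lra.
  - move=> w v n Hw Hv.
    have D0 := Cmod_ge_0 (w - v)%C.
    have -> : (Dseq N w n - Dseq N v n = csum (fun j => RtoC (bc n j) * (bernoulli_poly j w - bernoulli_poly j v)) (S N)
       - RtoC (INR n) * (w ^ (n - 1) - v ^ (n - 1)))%C.
    { rewrite /Dseq (csum_ext (fun j => RtoC (bc n j) * (bernoulli_poly j w - bernoulli_poly j v))%C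
        (fun j => RtoC (bc n j) * bernoulli_poly j w - RtoC (bc n j) * bernoulli_poly j v)%C).
      - rewrite csum_minus; ring.
      - move=> k; ring. }
    apply: Rle_trans (Cmod_triangle_minus _ _) _.
    have A : Cmod (csum (fun j => RtoC (bc n j) * (bernoulli_poly j w - bernoulli_poly j v))%C (S N)) <=
       INR (S N) * K * Cmod (w - v)%C * (4 * W) ^ n.
    { apply: Rle_trans (Cmod_csum _ _) _.
      apply (Rle_trans _ (rsum (fun _ => 2 ^ n * (K * Cmod (w - v)%C)) (S N))).
      - apply rsum_le_lt => j Hj; have [b0 b1] := bc_le n j.
        rewrite Cmod_mult Cmod_R Rabs_pos_eq //.
        apply Rmult_le_compat => //; [apply Cmod_ge_0 | apply HK2 => //; lia].
      - rewrite const.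
        have : 2 ^ n <= (4 * W) ^ n by apply pow_incr; lra.
        have : 0 <= INR (S N) * K * Cmod (w - v)%C by apply Rmult_le_pos => //; nra. nra. }
    have D : Cmod (RtoC (INR n) * (w ^ (n - 1) - v ^ (n - 1)))%C <= Cmod (w - v)%C * (4 * W) ^ n.
    { rewrite Cmod_mult Cmod_R Rabs_pos_eq; last apply pos_INR.
      have L := Cpow_Lipschitz W w v (n - 1) Hw Hv.
      have I := INR_le_pow2 n.
      have I' : INR (n - 1) <= 2 ^ n.
      { apply: Rle_trans I; apply le_INR; lia. }
      have n0 := pos_INR n; have n1 := pos_INR (n - 1).
      have W0 : 0 <= W ^ (n - 1 - 1) by apply pow_le; lra.
      have Pn := P2 n; have Qn := PWm' n.
      apply (Rle_trans _ (2 ^ n * (2 ^ n * W ^ n * Cmod (w - v)%C))).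
      - apply Rmult_le_compat => //; first apply Cmod_ge_0.
        apply: Rle_trans L _; apply Rmult_le_compat_r => //.
        apply Rmult_le_compat => //.
      - rewrite -P4; lra. }
    lra.
Qed.

Lemma rp_neg2 x : 0 < x -> rp x (-2) = / x ^ 2.
Proof.
  move=> H; have -> : -2 = - INR 2 by rewrite /=; ring. by apply rp_opp_INR.
Qed.

Lemma rbdd_inv_sq : rbdd (fun m => rp (INR m + 1) (-2)) 2.
Proof.
  have E n : rp (INR n + 1) (-2) = / (INR n + 1) ^ 2.
  { apply rp_neg2; have := pos_INR n; lra. }
  case => [|n]; first by rewrite /=; lra.
  have : rsum (fun m => rp (INR m + 1) (-2)) (S n) <= 2 - / (INR n + 1).
  { elim: n => [|n IH].
    - change (0 + rp (INR 0 + 1) (-2) <= 2 - / (INR 0 + 1)); rewrite E (_ : INR 0 = 0) //; lra.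
    - change (rsum (fun m => rp (INR m + 1) (-2)) (S n) + rp (INR (S n) + 1) (-2) <= 2 - / (INR (S n) + 1)).
      rewrite E S_INR; have := pos_INR n => Hn.
      have : / (INR n + 1 + 1) ^ 2 <= / (INR n + 1) - / (INR n + 1 + 1).
      { have -> : / (INR n + 1) - / (INR n + 1 + 1) = / ((INR n + 1) * (INR n + 1 + 1)) by field; lra.
        apply Rinv_le_contravar; nra. }
      lra. }
  have : 0 < / (INR n + 1) by apply Rinv_0_lt_compat; have := pos_INR n; lra.
  lra.
Qed.

(** * Simple and double sums of the remainders *)

Definition S1 (N : nat) (d : nat -> C) (x : R) (s : C) : C :=
  cser (fun m => tail N d (x + INR m) s).

(** With [p] the exponent in the bound of [tail], [(x + m)^p] is split into [(x + m)^(p + 2)], which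
    is at most [x^(p + 2)], and [(x + m)^(-2)], which is summable in [m]. *)
Lemma psb_S1 N s0 r V : 0 < r -> 0 <= V -> - Re s0 + r - INR (S N) <= -2 -> exists K, 0 <= K /\
  forall d B x, 0 <= B -> (forall n, Cmod (d n) <= B * V ^ n) -> 4 * V <= x -> 1 <= x ->
  psb s0 r (K * B * rp x (- Re s0 + r - INR (S N) + 2)) (S1 N d x) /\
  forall s, Cmod (s - s0)%C <= r -> csums (fun m => tail N d (x + INR m) s) (S1 N d x s).
Proof.
  move=> Hr HV Hp; have [K [K0 HK]] := psb_tail N s0 r V Hr HV.
  set p := - Re s0 + r - INR (S N) in Hp HK *.
  exists (K * 2); split; first lra.
  move=> d B x HB Hd Hx Hx1.
  have P := rp_pos x (p + 2).
  apply (psb_cser s0 r (fun m => K * B * rp x (p + 2) * rp (INR m + 1) (-2))) => //.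
  - move=> m; have m0 := pos_INR m.
    have [H _] := HK d B (x + INR m) HB Hd ltac:(lra) ltac:(lra).
    apply: psb_mono H.
    rewrite !Rmult_assoc; do 2 (apply Rmult_le_compat_l => //).
    have -> : p = (p + 2) + -2 by ring.
    rewrite rp_plus.
    have -> : p + 2 + -2 + 2 = p + 2 by ring.
    apply Rmult_le_compat; try (apply Rlt_le, rp_pos); apply rp_antimono; lra.
  - move=> n; rewrite rsum_scal.
    have := rbdd_inv_sq n.
    have -> : K * 2 * B * rp x (p + 2) = K * B * rp x (p + 2) * 2 by ring.
    apply Rmult_le_compat_l, Rmult_le_pos; [by apply Rmult_le_pos | lra].
Qed.

Definition S2 (N : nat) (d : nat -> C) (x : nat -> R) (s : C) : C :=
  cser (fun k => S1 N d (x k) s).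

(** The bound [y (k + 1) <= x k] separates the variables: [y^(p + 2)] carries the decay in the large
    parameter, and [(k + 1)^(p + 2) <= (k + 1)^(-2)] the summability; hence the condition
    [p <= -4]. *)
Lemma psb_S2 N s0 r V : 0 < r -> 0 <= V -> - Re s0 + r - INR (S N) <= -4 -> exists K, 0 <= K /\
  forall d B y x, 0 <= B -> (forall n, Cmod (d n) <= B * V ^ n) -> 4 * V <= y -> 1 <= y ->
  (forall k, y * (INR k + 1) <= x k) ->
  psb s0 r (K * B * rp y (- Re s0 + r - INR (S N) + 2)) (S2 N d x) /\
  forall s, Cmod (s - s0)%C <= r -> csums (fun k => S1 N d (x k) s) (S2 N d x s).
Proof.
  move=> Hr HV Hp; have [K [K0 HK]] := psb_S1 N s0 r V Hr HV ltac:(lra).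
  set p := - Re s0 + r - INR (S N) in Hp HK *.
  exists (K * 2); split; first lra.
  move=> d B y x HB Hd Hy Hy1 Hx.
  have P := rp_pos y (p + 2).
  have xy k : y <= x k.
  { have := Hx k; have := pos_INR k; nra. }
  apply (psb_cser s0 r (fun k => K * B * rp y (p + 2) * rp (INR k + 1) (-2))) => //.
  - move=> k; have k0 := pos_INR k; have xk := xy k.
    have [H _] := HK d B (x k) HB Hd ltac:(lra) ltac:(lra).
    apply: psb_mono H.
    rewrite !Rmult_assoc; do 2 (apply Rmult_le_compat_l => //).
    apply (Rle_trans _ (rp (y * (INR k + 1)) (p + 2))).
    + apply rp_antimono; last lra. split; [nra | apply Hx].
    + rewrite rp_mult; try lra.
      apply Rmult_le_compat_l; first lra.
      apply rp_exp_mono; lra.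
  - move=> n; rewrite rsum_scal.
    have := rbdd_inv_sq n.
    have -> : K * 2 * B * rp y (p + 2) = K * B * rp y (p + 2) * 2 by ring.
    apply Rmult_le_compat_l, Rmult_le_pos; [by apply Rmult_le_pos | lra].
Qed.

Lemma tail_term_minus N d d' x s n :
  tail_term N (fun k => d k - d' k)%C x s n = (tail_term N d x s n - tail_term N d' x s n)%C.
Proof. rewrite /tail_term; ring. Qed.

(** Each of the three nested series has to converge for linearity in [d] to hold. It reduces the
    dependence of the remainder on [w] to a bound for the sequence [Dseq N w - Dseq N v]. *)
Lemma S2_minus N s V B y x d d' :
  0 <= V -> 0 <= B -> - Re s + / 2 - INR (S N) <= -4 ->
  (forall n, Cmod (d n) <= B * V ^ n) -> (forall n, Cmod (d' n) <= B * V ^ n) ->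
  4 * V <= y -> 1 <= y -> (forall k, y * (INR k + 1) <= x k) ->
  S2 N (fun k => d k - d' k)%C x s = (S2 N d x s - S2 N d' x s)%C.
Proof.
  move=> HV HB Hp Hd Hd' Hy Hy1 Hx.
  have h2 : 0 < / 2 by lra.
  have [? [_ HK0]] := psb_tail N s (/ 2) V h2 HV.
  have [? [_ HK1]] := psb_S1 N s (/ 2) V h2 HV ltac:(lra).
  have [? [_ HK2]] := psb_S2 N s (/ 2) V h2 HV Hp.
  have ss : Cmod (s - s)%C <= / 2 by rewrite Cmod_minus_diag; lra.
  have xy k : y <= x k.
  { have := Hx k; have := pos_INR k; nra. }
  apply csums_cser.
  apply: csums_ext (csums_minus _ _ _ _
    (proj2 (HK2 d B y x HB Hd Hy Hy1 Hx) s ss) (proj2 (HK2 d' B y x HB Hd' Hy Hy1 Hx) s ss)) => k.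
  symmetry; apply csums_cser.
  have xk := xy k.
  apply: csums_ext (csums_minus _ _ _ _
    (proj2 (HK1 d B (x k) HB Hd ltac:(lra) ltac:(lra)) s ss) (proj2 (HK1 d' B (x k) HB Hd' ltac:(lra) ltac:(lra)) s ss)) => m.
  symmetry; apply csums_cser.
  have m0 := pos_INR m.
  apply: csums_ext (csums_minus _ _ _ _
    (proj2 (HK0 d B (x k + INR m) HB Hd ltac:(lra) ltac:(lra)) s ss) (proj2 (HK0 d' B (x k + INR m) HB Hd' ltac:(lra) ltac:(lra)) s ss)) => n.
  by rewrite tail_term_minus.
Qed.

Lemma clim_xp_0 x z : 0 < x -> Re z < 0 -> clim (fun m => xp (x + INR m) z) 0.
Proof.
  move=> Hx Hz eps He.
  have [m Hm] : exists m, exp (ln eps / Re z) < INR m.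
  { have E := exp_pos (ln eps / Re z).
    exists (Z.to_nat (up (exp (ln eps / Re z)))). have [A _] := archimed (exp (ln eps / Re z)).
    have U : (0 <= up (exp (ln eps / Re z)))%Z by apply le_IZR; lra.
    rewrite INR_IZR_INZ Z2Nat.id //; lra. }
  exists m => n Hn.
  have -> : (xp (x + INR n) z - 0 = xp (x + INR n) z)%C by ring.
  rewrite Cmod_xp -[X in _ < X](exp_ln eps) //; apply exp_increasing.
  have M : INR m <= INR n by apply le_INR.
  have L : ln eps / Re z < ln (x + INR n).
  { rewrite -{1}(ln_exp (ln eps / Re z)); apply ln_increasing; [apply exp_pos | lra]. }
  have -> : ln eps = Re z * (ln eps / Re z) by field; lra.
  nra.
Qed.

Lemma clim_Qs_0 N w x s : 0 < x -> 0 < Re s -> clim (fun m => Qs N w (x + INR m) s) 0.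
Proof.
  move=> Hx Hs.
  have -> : RtoC 0 = csum (fun j => bn j (- s) * bernoulli_poly j w * 0)%C (S N).
  { rewrite csum_zero // => k _; ring. }
  apply (csum_clim (fun m j => bn j (- s) * bernoulli_poly j w * xp (x + INR m) (- s - RtoC (INR j)))%C) => j _.
  apply clim_scal, clim_xp_0 => //.
  have := pos_INR j; rewrite /Re /= in Hs *; lra.
Qed.

(** [tail_identity] makes the partial sums telescope, and [Qs] tends to [0] at infinity because
    [Re s > 0]. *)
Lemma hz_expansion N W w x s : 1 <= W -> Cmod w <= W -> 16 * W <= x -> 0 < Re s ->
  3 / 2 <= Re s + INR N ->
  csums (fun m => s * Cpower (RtoC (x + INR m) + w) (- s - 1))%C
    (Qs N w x s + S1 N (Dseq N w) x s)%C.
Proof.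
  move=> HW Hw Hx Hs HN.
  have [B [B0 [HB _]]] := Dseq_bounds N W HW.
  (* The radius [1/2], together with the exponent condition of [psb_S1], gives the bound [3 / 2] on
     [Re s + N]. *)
  have [K [K0 HK]] := psb_S1 N s (/ 2) (4 * W) ltac:(lra) ltac:(lra) ltac:(rewrite S_INR; lra).
  have [_ H] := HK (Dseq N w) B x B0 (fun n => HB w n Hw) ltac:(lra) ltac:(lra).
  have {}H := H s ltac:(rewrite Cmod_minus_diag; lra).
  have L := clim_Qs_0 N w x s ltac:(lra) Hs.
  have K1 := clim_minus _ _ _ _ (clim_plus _ _ _ _ (clim_const (Qs N w x s)) H) L.
  have E : (Qs N w x s + S1 N (Dseq N w) x s - 0 = Qs N w x s + S1 N (Dseq N w) x s)%C by ring.
  rewrite E in K1; apply: clim_ext K1; elim => [|m IH].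
  - rewrite /= Rplus_0_r; ring.
  - rewrite !csum_S -IH S_INR.
    have m0 := pos_INR m.
    have w0 := Cmod_ge_0 w.
    rewrite (tail_identity N w (x + INR m) s); try lra.
    rewrite Rplus_assoc; ring.
Qed.

(** * The one-dimensional zeta function *)

Lemma Eta_point (a : R) : exists K : nat, 16 <= a + INR K.
Proof.
  exists (Z.to_nat (up (16 + Rabs a))). have [A _] := archimed (16 + Rabs a).
  have a0 := Rabs_pos a.
  have U : (0 <= up (16 + Rabs a))%Z by apply le_IZR; lra.
  rewrite INR_IZR_INZ Z2Nat.id //; have := Rle_abs (- a); rewrite Rabs_Ropp; lra.
Qed.

(* For every [K] with [16 <= a + K], [Eta N a K s] continues [s * zeta(s + 1, a)] to [Re s > 1 - N]. *)
Definition Eta (N : nat) (a : R) (K : nat) (s : C) : C :=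
  (s * csum (fun k => xp (a + INR k) (- s - 1)) K + Qs N 0 (a + INR K) s + S1 N (Dseq N 0) (a + INR K) s)%C.

Lemma Cpower_RtoC_0 x z : 0 < x -> Cpower (RtoC x + 0)%C z = xp x z.
Proof. move=> H; have -> : (RtoC x + 0 = RtoC x)%C by ring. by apply Cpower_RtoC. Qed.

(** [tail_identity] with [w = 0] moves one term of the remainder into the explicit sum. The freedom
    in [K] serves later to let [K] tend to infinity. The threshold [16] is [16 * W] for [W = 1]. *)
Lemma Eta_step N a K s : 16 <= a + INR K -> 3 / 2 <= Re s + INR N ->
  Eta N a (S K) s = Eta N a K s.
Proof.
  move=> Hx HN; rewrite /Eta.
  set x := a + INR K in Hx *.
  have -> : a + INR (S K) = x + 1 by rewrite S_INR /x; ring.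
  have [B [B0 [HB _]]] := Dseq_bounds N 1 ltac:(lra).
  have Z1 : Cmod 0 <= 1 by rewrite Cmod_0; lra.
  have [K' [K0 HK]] := psb_S1 N s (/ 2) (4 * 1) ltac:(lra) ltac:(lra) ltac:(rewrite S_INR; lra).
  have D := Cmod_minus_diag s.
  have H := proj2 (HK (Dseq N 0) B x B0 (fun n => HB 0 n Z1) ltac:(lra) ltac:(lra)) s ltac:(lra).
  have H1 := proj2 (HK (Dseq N 0) B (x + 1) B0 (fun n => HB 0 n Z1) ltac:(lra) ltac:(lra)) s ltac:(lra).
  have {}H1 : csums (fun m => tail N (Dseq N 0) (x + INR (1 + m)) s) (S1 N (Dseq N 0) (x + 1) s).
  { apply: csums_ext H1 => m; rewrite plus_INR /=; congr tail; ring. }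
  have {}H1 := proj1 (csums_shift (fun m => tail N (Dseq N 0) (x + INR m) s) 1 _) H1.
  rewrite (csums_unique _ _ _ H H1) /= Rplus_0_r tail_identity; try (rewrite ?Cmod_0; lra).
  rewrite Cpower_RtoC_0; last lra.
  rewrite /x; ring.
Qed.

Lemma Eta_indep N a K K' s : (K <= K')%nat -> 16 <= a + INR K -> 3 / 2 <= Re s + INR N ->
  Eta N a K' s = Eta N a K s.
Proof.
  move=> HK Hx HN; have -> : K' = (K + (K' - K))%nat by lia.
  elim: (K' - K)%nat => [|n IH]; first by rewrite Nat.add_0_r.
  rewrite Nat.add_succ_r Eta_step // plus_INR; have := pos_INR n; lra.
Qed.

Lemma Eta_series N a K s : 0 < a -> 16 <= a + INR K -> 0 < Re s -> 3 / 2 <= Re s + INR N ->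
  csums (fun k => s * xp (a + INR k) (- s - 1))%C (Eta N a K s).
Proof.
  move=> Ha Hx Hs HN; rewrite /Eta -csum_scal -Cplus_assoc.
  apply (csums_shift (fun k => s * xp (a + INR k) (- s - 1))%C K).
  have Z1 : Cmod 0 <= 1 by rewrite Cmod_0; lra.
  have H := hz_expansion N 1 0 (a + INR K) s ltac:(lra) Z1 ltac:(lra) Hs HN.
  apply: csums_ext H => m; have m0 := pos_INR m.
  rewrite Cpower_RtoC_0; last lra.
  by rewrite plus_INR Rplus_assoc.
Qed.

Lemma psb_xp_any x s0 r c : 0 < r -> exists M, psb s0 r M (fun s => xp x (c - s)%C).
Proof.
  move=> Hr.
  have H := psb_scal _ _ _ _ (xp x c) (ps_psb _ _ _ _ _ (ps_exp s0 r (- RtoC (ln x))%C Hr)).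
  eexists; apply: psb_ext H => s _; rewrite /xp -Cexp_plus; congr Cexp; ring.
Qed.

(** For places where only analyticity on a given disc matters; [psb] keeps the norm where it must be
    uniform in [tau] and [w]. *)
Definition psa (s0 : C) (r : R) (f : C -> C) : Prop := exists M, psb s0 r M f.

Lemma psa_ext s0 r f g : (forall s, Cmod (s - s0)%C <= r -> f s = g s) -> psa s0 r f -> psa s0 r g.
Proof. move=> H [M HM]; exists M; by apply: psb_ext HM. Qed.

Lemma psa_plus s0 r f g : psa s0 r f -> psa s0 r g -> psa s0 r (fun s => f s + g s)%C.
Proof. move=> [M H] [M' H']; eexists; apply psb_plus; eassumption. Qed.

Lemma psa_minus s0 r f g : psa s0 r f -> psa s0 r g -> psa s0 r (fun s => f s - g s)%C.
Proof. move=> [M H] [M' H']; eexists; apply psb_minus; eassumption. Qed.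

Lemma psa_mult s0 r f g : psa s0 r f -> psa s0 r g -> psa s0 r (fun s => f s * g s)%C.
Proof. move=> [M H] [M' H']; eexists; apply psb_mult; eassumption. Qed.

Lemma psa_const s0 r c : 0 < r -> psa s0 r (fun _ => c).
Proof. move=> H; eexists; by apply psb_const. Qed.

Lemma psa_id s0 r : 0 < r -> psa s0 r (fun s => s).
Proof.
  move=> H; apply: (psa_ext _ _ (fun s => s - 0)%C) => [s _|]; first ring.
  eexists; by apply psb_id.
Qed.

Lemma psa_shift s0 c r f : psa (s0 + c)%C r f -> psa s0 r (fun s => f (s + c)%C).
Proof. move=> [M H]; eexists; apply psb_shift; eassumption. Qed.

Lemma psa_csum s0 r (f : nat -> C -> C) N :
  0 < r -> (forall k, (k < N)%nat -> psa s0 r (f k)) -> psa s0 r (fun s => csum (fun k => f k s) N).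
Proof.
  move=> Hr; elim: N => [|N IH] H /=; first by apply psa_const.
  apply psa_plus; [apply IH => k Hk; apply H; lia | apply H; lia].
Qed.

Lemma psa_bn s0 r c n : 0 < r -> psa s0 r (fun s => bn n (c - s)%C).
Proof. move=> H; have [K [_ HK]] := psb_bn c s0 r H; eexists; apply HK. Qed.

Lemma psa_inv s0 r c : 0 < r < Cmod (s0 - c)%C -> psa s0 r (fun s => / (s - c))%C.
Proof. move=> H; eexists; eexists; by apply ps_inv. Qed.

Lemma psa_Qs N w x s0 r : 0 < r -> psa s0 r (Qs N w x).
Proof.
  move=> Hr; apply psa_csum => // j _.
  apply: (psa_ext _ _ (fun s => bn j (0 - s) * bernoulli_poly j w * xp x (- RtoC (INR j) - s))%C) => [s _|].
  - have -> : (0 - s = - s)%C by ring.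
    by have -> : (- RtoC (INR j) - s = - s - RtoC (INR j))%C by ring.
  - apply psa_mult; last by apply psb_xp_any.
    apply psa_mult; [by apply psa_bn | by apply psa_const].
Qed.

Lemma psa_Eta N a K s0 r : 0 < r -> 16 <= a + INR K -> 1 <= Re s0 - r + INR N -> psa s0 r (Eta N a K).
Proof.
  move=> Hr Hx HN; apply psa_plus; first apply psa_plus; last 1 first.
  - have [B [B0 [HB _]]] := Dseq_bounds N 1 ltac:(lra).
    have Z1 : Cmod 0 <= 1 by rewrite Cmod_0; lra.
    have [K' [K0 HK]] := psb_S1 N s0 r (4 * 1) Hr ltac:(lra) ltac:(rewrite S_INR; lra).
    have H := proj1 (HK (Dseq N 0) B (a + INR K) B0 (fun n => HB 0 n Z1) ltac:(lra) ltac:(lra)).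
    eexists; exact H.
  - apply psa_mult; first by apply psa_id.
    apply psa_csum => // k _.
    apply: (psa_ext _ _ (fun s => xp (a + INR k) (- (1) - s))%C) => [s _|]; last by apply psb_xp_any.
    by have -> : (- (1) - s = - s - 1)%C by ring.
  - by apply psa_Qs.
Qed.

(** * Continuation of the double zeta function *)

(* [Z2] continues the double series to [Re s > 5 - N]: the sum over [k2] is expanded by Euler-Maclaurin
   in powers of [tau (a + k1)], which are then summed over [k1] by means of [Eta]. *)
Definition Z2_main (N : nat) (tau a : R) (K : nat) (w s : C) : C :=
  (/ (s - 2) * xp tau (1 - s) * Eta N a K (s - 2)
   - csum (fun j => bn j (1 - s) * (bernoulli_poly (S j) w / RtoC (INR (S j)))
        * xp tau (- s - RtoC (INR j)) * Eta N a K (s + (RtoC (INR j) - 1))) N)%C.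

Definition Z2_rem (N : nat) (tau a : R) (w s : C) : C :=
  S2 N (Dseq N w) (fun k => tau * (a + INR k)) (s - 1)%C.

Definition Z2 (N : nat) (tau a : R) (K : nat) (w s : C) : C :=
  (/ (s - 1) * (Z2_main N tau a K w s + Z2_rem N tau a w s))%C.

Lemma psa_Z2_main N tau a K w s0 r : 0 < r < Cmod (s0 - 2)%C -> 16 <= a + INR K -> 3 <= Re s0 - r + INR N ->
  psa s0 r (Z2_main N tau a K w).
Proof.
  move=> [Hr Hr2] Hx HN; apply psa_minus.
  - apply psa_mult; first apply psa_mult.
    + by apply psa_inv.
    + by apply psb_xp_any.
    + apply (psa_ext _ _ (fun s => Eta N a K (s + - (2))%C)) => [s _|]; first by [].
      apply psa_shift, psa_Eta => //.
      have -> : Re (s0 + - (2))%C = Re s0 - 2 by rewrite /Re /=; ring. lra.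
  - apply psa_csum => // j _; apply psa_mult; first apply psa_mult; first apply psa_mult.
    + by apply psa_bn.
    + by apply psa_const.
    + apply: (psa_ext _ _ (fun s => xp tau (- RtoC (INR j) - s)%C)) => [s _|]; last by apply psb_xp_any.
      by have -> : (- RtoC (INR j) - s = - s - RtoC (INR j))%C by ring.
    + apply psa_shift, psa_Eta => //.
      have -> : Re (s0 + (RtoC (INR j) - 1))%C = Re s0 + INR j - 1 by rewrite /Re /=; ring.
      have := pos_INR j; lra.
Qed.

(** A constant with [lowfac a * (k + 1) <= a + k]; it puts the points [tau (a + k)] in the form
    required by [psb_S2], with [y = tau * lowfac a]. *)
Definition lowfac (a : R) : R := Rmin a 1.

Lemma lowfac_pos a : 0 < a -> 0 < lowfac a.
Proof. move=> H; apply Rmin_glb_lt; lra. Qed.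

Lemma lowfac_le tau a k : 0 < a -> 0 < tau -> (tau * lowfac a) * (INR k + 1) <= tau * (a + INR k).
Proof.
  move=> Ha Ht; rewrite Rmult_assoc; apply Rmult_le_compat_l; first lra.
  have k0 := pos_INR k; have A := Rmin_l a 1; have B := Rmin_r a 1.
  rewrite /lowfac; nra.
Qed.

(** [K] precedes [tau], [w] and [v]: the error of the expansion of [log_Gamma2] comes from this
    estimate alone. The shift by [-1] in the proof is due to [Z2_rem] evaluating [S2] at [s - 1]. *)
Lemma psb_Z2_rem N a W s0 r : 0 < r -> 1 <= W -> 0 < a -> 5 <= Re s0 - r + INR N ->
  exists K, 0 <= K /\ forall tau, 0 < tau -> 16 * W <= tau * lowfac a ->
   (forall w, Cmod w <= W -> psb s0 r (K * rp tau (- Re s0 + r - INR N + 2)) (Z2_rem N tau a w)) /\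
   (forall w v, Cmod w <= W -> Cmod v <= W ->
      psb s0 r (K * Cmod (w - v)%C * rp tau (- Re s0 + r - INR N + 2))
       (fun s => Z2_rem N tau a w s - Z2_rem N tau a v s)%C).
Proof.
  move=> Hr HW Ha HN.
  have [B [B0 [HB HL]]] := Dseq_bounds N W HW.
  have E1 : Re (s0 + - (1))%C = Re s0 - 1 by rewrite /Re /=; ring.
  have [K [K0 HK]] := psb_S2 N (s0 + - (1))%C r (4 * W) Hr ltac:(lra) ltac:(rewrite E1 S_INR; lra).
  have p0 := lowfac_pos a Ha.
  have -> : - Re s0 + r - INR N + 2 = - Re (s0 + - (1))%C + r - INR (S N) + 2 by rewrite E1 S_INR; ring.
  set p := - Re (s0 + - (1))%C + r - INR (S N) + 2 in HK *.
  have R0 := rp_pos (lowfac a) p.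
  exists (K * B * rp (lowfac a) p); split.
  { apply Rmult_le_pos; [by apply Rmult_le_pos | lra]. }
  move=> tau Ht Hy; split.
  - move=> w Hw.
    have [H _] := HK (Dseq N w) B (tau * lowfac a) (fun k => tau * (a + INR k)) B0 (fun n => HB w n Hw)
      ltac:(lra) ltac:(lra) (fun k => lowfac_le tau a k Ha Ht).
    apply: psb_mono (psb_shift _ _ _ _ _ H).
    rewrite rp_mult //; lra.
  - move=> w v Hw Hv.
    have H := HK (fun n => Dseq N w n - Dseq N v n)%C (B * Cmod (w - v)%C) (tau * lowfac a) (fun k => tau * (a + INR k))
      ltac:(apply Rmult_le_pos => //; apply Cmod_ge_0) (fun n => HL w v n Hw Hv)
      ltac:(lra) ltac:(lra) (fun k => lowfac_le tau a k Ha Ht).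
    have {}H := proj1 H.
    apply: psb_mono (psb_ext _ _ _ _ _ _ (psb_shift _ _ _ _ _ H)).
    + rewrite rp_mult //; lra.
    + move=> s Hs /=.
      have Hre : Rabs (Re (s - s0)%C) <= r by apply: Rle_trans (re_le_Cmod _) Hs.
      have Hre' : Re (s + - (1))%C = Re s - 1 by rewrite /Re /=; ring.
      have Hre'' : Re (s - s0)%C = Re s - Re s0 by [].
      rewrite Hre'' in Hre.
      have A := Rabs_def2 (- (Re s - Re s0)) (r + / 2).
      have Hm : Re s0 - r <= Re s.
      { have := Rle_abs (- (Re s - Re s0)); rewrite Rabs_Ropp; lra. }
      rewrite (S2_minus N (s + - (1))%C (4 * W) B (tau * lowfac a) (fun k => tau * (a + INR k))) //; try lra.
      (* The bound [5] in the hypothesis leaves room for the [1/2] that enters [S2_minus]. *)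
      * rewrite Hre' S_INR; lra.
      * move=> n; by apply HB.
      * move=> n; by apply HB.
      * move=> k; by apply lowfac_le.
Qed.

Lemma Cpower_bound z : exists K, 0 <= K /\ forall x w, 0 < x -> 8 * Cmod w <= x ->
  Cmod (Cpower (RtoC x + w) z) <= K * rp x (Re z).
Proof.
  have [K [K0 HK]] := bn_bound z.
  exists (K * 2); split; first lra.
  move=> x w Hx Hw.
  have H := binomial_series x w z Hx Hw.
  have P := rp_pos x (Re z).
  apply: csums_bound H => n.
  have w0 := Cmod_ge_0 w.
  have Hu : Cmod (w / RtoC x)%C <= / 8.
  { rewrite Cmod_div ?Cmod_R ?Rabs_pos_eq; try (apply RtoC_neq_0); try lra.
    apply (Rmult_le_reg_r x) => //.
    have -> : Cmod w / x * x = Cmod w by field; lra. lra. }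
  apply (Rle_trans _ (rsum (fun n => rp x (Re z) * K * (/ 2) ^ n) n)).
  - apply rsum_le => k.
    rewrite !Cmod_mult Cmod_xp -/(rp x (Re z)) Cmod_pow Rmult_assoc.
    apply Rmult_le_compat_l; first lra.
    have P2 : 0 < 2 ^ k by apply pow_lt; lra.
    apply (Rle_trans _ (K * 2 ^ k * (/ 8) ^ k)).
    + apply Rmult_le_compat; [apply Cmod_ge_0 | apply pow_le, Cmod_ge_0 | done |].
      apply pow_incr; split => //; apply Cmod_ge_0.
    + have -> : K * 2 ^ k * (/ 8) ^ k = K * (2 * / 8) ^ k by rewrite Rpow_mult_distr; ring.
      apply Rmult_le_compat_l => //; apply pow_incr; lra.
  - rewrite rsum_scal.
    have G := rsum_geom (/ 2) n ltac:(lra).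
    have G2 : / (1 - / 2) = 2 by field.
    rewrite G2 in G.
    have -> : K * 2 * rp x (Re z) = rp x (Re z) * K * 2 by ring.
    apply Rmult_le_compat_l; [nra | exact G].
Qed.

(** Comparison with the integral in telescoping form: [(x + 1)^(- 1 - delta)] is at most [1 / delta]
    times the decrease of [x^(- delta)] from [x] to [x + 1]. *)
Lemma rbdd_rp delta : 0 < delta -> rbdd (fun m => rp (INR m + 1) (- (1) - delta)) (1 + / delta).
Proof.
  move=> Hd.
  have dinv : 0 < / delta by apply Rinv_0_lt_compat.
  case => [|n]; first by rewrite /=; lra.
  have : rsum (fun m => rp (INR m + 1) (- (1) - delta)) (S n) <= 1 + / delta * (1 - rp (INR n + 1) (- delta)).
  { elim: n => [|n IH].
    - change (0 + rp (INR 0 + 1) (- (1) - delta) <= 1 + / delta * (1 - rp (INR 0 + 1) (- delta))).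
      rewrite /rp (_ : INR 0 + 1 = 1); [rewrite ln_1 !Rmult_0_r exp_0; lra | rewrite /=; ring].
    - change (rsum (fun m => rp (INR m + 1) (- (1) - delta)) (S n) + rp (INR (S n) + 1) (- (1) - delta) <=
        1 + / delta * (1 - rp (INR (S n) + 1) (- delta))).
      rewrite S_INR; have := pos_INR n; move: (INR n) IH => x IH x0.
      suff : rp (x + 1 + 1) (- (1) - delta) <= / delta * (rp (x + 1) (- delta) - rp (x + 1 + 1) (- delta)) by lra.
      have E : rp (x + 1 + 1) (- (1) - delta) = rp (x + 1 + 1) (- delta) * / (x + 1 + 1).
      { have -> : - (1) - delta = - delta + - INR 1 by rewrite /=; ring.
        rewrite rp_plus rp_opp_INR; last lra. by rewrite pow_1. }
      have Q : 0 < (x + 1) / (x + 1 + 1) by apply Rdiv_lt_0_compat; lra.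
      have F : rp (x + 1) (- delta) = rp (x + 1 + 1) (- delta) * rp ((x + 1) / (x + 1 + 1)) (- delta).
      { rewrite -rp_mult; [congr rp; field; lra | lra | done]. }
      have L : ln ((x + 1) / (x + 1 + 1)) <= - / (x + 1 + 1).
      { have := exp_ineq1_le (ln ((x + 1) / (x + 1 + 1))); rewrite exp_ln //.
        have -> : (x + 1) / (x + 1 + 1) = 1 - / (x + 1 + 1) by field; lra. lra. }
      have G : 1 + delta * / (x + 1 + 1) <= rp ((x + 1) / (x + 1 + 1)) (- delta).
      { apply: Rle_trans (exp_ineq1_le _).
        have := Rmult_le_compat_l delta _ _ (Rlt_le _ _ Hd) L; lra. }
      rewrite E F.
      have P := rp_pos (x + 1 + 1) (- delta).
      apply (Rmult_le_reg_l delta) => //.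
      have -> : forall y, delta * (/ delta * y) = y by move=> y; field; lra.
      nra. }
  have := rp_pos (INR n + 1) (- delta); nra.
Qed.

(** Summing [(tau (a + k))^(1 - s - j)] over [k] produces [Eta] at [s + j - 2], divided by
    [s + j - 2]. For [j >= 1] this divisor cancels against the last factor of [bn j (1 - s)], so
    [s = 2], from [j = 0], is the only pole of [Z2_main]. *)
Lemma Z2_main_series N tau a K w s : 0 < tau -> 0 < a -> 16 <= a + INR K -> 2 < Re s -> 7 / 2 <= Re s + INR N ->
  csums (fun k => Qs N w (tau * (a + INR k)) (s - 1))%C (Z2_main N tau a K w s).
Proof.
  move=> Ht Ha Hx Hs HN.
  have sig j : Re (s + (RtoC (INR j) - 2))%C = Re s + INR j - 2 by rewrite /Re /=; ring.
  have sn j : (s + (RtoC (INR j) - 2))%C <> 0.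
  { move=> E; have := f_equal Re E; rewrite sig /Re /=; have := pos_INR j; rewrite /Re in Hs; lra. }
  pose term j := (bn j (1 - s) * bernoulli_poly j w * xp tau (1 - s - RtoC (INR j)) *
     (/ (s + (RtoC (INR j) - 2)) * Eta N a K (s + (RtoC (INR j) - 2))))%C.
  have -> : Z2_main N tau a K w s = csum term (S N).
  { rewrite csum_S_l /Z2_main.
    have -> : csum (fun k => term (S k)) N = csum (fun j => - (1) * (bn j (1 - s) * (bernoulli_poly (S j) w / RtoC (INR (S j)))
        * xp tau (- s - RtoC (INR j)) * Eta N a K (s + (RtoC (INR j) - 1))))%C N.
    { apply csum_ext => j; rewrite /term.
      have E1 : (s + (RtoC (INR (S j)) - 2) = s + (RtoC (INR j) - 1))%C by rewrite S_INR RtoC_plus; ring.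
      have N1 := sn (S j); rewrite E1 in N1; rewrite E1.
      have -> : (1 - s - RtoC (INR (S j)) = - s - RtoC (INR j))%C by rewrite S_INR RtoC_plus; ring.
      change (bn (S j) (1 - s)) with (bn j (1 - s) * (1 - s - RtoC (INR j)) / RtoC (INR (S j)))%C.
      field; split => //; apply RtoC_INR_S. }
    rewrite csum_scal /term (_ : INR 0 = 0) // bernoulli_poly_at_0.
    have -> : (s + (0 - 2) = s - 2)%C by ring.
    have -> : (1 - s - 0 = 1 - s)%C by ring.
    have -> : bn 0 (1 - s) = RtoC 1 by [].
    ring. }
  apply (csums_csum (fun k j => bn j (- (s - 1)) * bernoulli_poly j w * xp (tau * (a + INR k)) (- (s - 1) - RtoC (INR j)))%C) => j _.
  have j0 := pos_INR j.
  have H := Eta_series N a K (s + (RtoC (INR j) - 2))%C Ha Hx ltac:(rewrite sig; lra) ltac:(rewrite sig; lra).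
  have H2 := csums_scal (bn j (1 - s) * bernoulli_poly j w * xp tau (1 - s - RtoC (INR j)) * / (s + (RtoC (INR j) - 2)))%C _ _ H.
  have -> : term j = (bn j (1 - s) * bernoulli_poly j w * xp tau (1 - s - RtoC (INR j)) * / (s + (RtoC (INR j) - 2)) * Eta N a K (s + (RtoC (INR j) - 2)))%C
    by rewrite /term; ring.
  apply: csums_ext H2 => k; have k0 := pos_INR k.
  have -> : (- (s - 1) = 1 - s)%C by ring.
  have -> : (- (s + (RtoC (INR j) - 2)) - 1 = 1 - s - RtoC (INR j))%C by ring.
  rewrite xp_mult //; last lra.
  field; apply sn.
Qed.

(** The expansion sums over the unit step first, the definition of the double series over the step
    [tau] first; [double_series] exchanges the two. *)
Lemma Z2_series N tau a K W w s :
  0 < tau -> 0 < a -> 1 <= W -> Cmod w <= W -> 16 * W <= tau * lowfac a -> 16 <= a + INR K ->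
  2 < Re s -> 5 <= Re s + INR N ->
  exists row, (forall m, csums (fun k => Cpower (RtoC (tau * a) + w + RtoC (INR m) + RtoC (INR k * tau)) (- s))%C (row m)) /\
    csums row (Z2 N tau a K w s).
Proof.
  move=> Ht Ha HW Hw Hy HK Hs HN.
  have s1 : (s - 1)%C <> 0.
  { move=> E; have := f_equal Re E; rewrite /Re /= in Hs *; lra. }
  have re1 : Re (s - 1)%C = Re s - 1 by [].
  have x0 k : 0 <= INR k by apply pos_INR.
  have w0 := Cmod_ge_0 w.
  have xk k : 16 * W <= tau * (a + INR k).
  { have := lowfac_le tau a k Ha Ht; have := x0 k; nra. }
  pose t k m := ((s - 1) * Cpower (RtoC (tau * (a + INR k) + INR m) + w) (- s))%C.
  have A k : csums (t k) (Qs N w (tau * (a + INR k)) (s - 1) + S1 N (Dseq N w) (tau * (a + INR k)) (s - 1))%C.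
  { have H := hz_expansion N W w (tau * (a + INR k)) (s - 1)%C HW Hw (xk k) ltac:(rewrite re1; lra) ltac:(rewrite re1; lra).
    apply: csums_ext H => m; rewrite /t; by have -> : (- (s - 1) - 1 = - s)%C by ring. }
  have B := Z2_main_series N tau a K w s Ht Ha HK Hs ltac:(lra).
  have [D [D0 [HD _]]] := Dseq_bounds N W HW.
  have [K2 [_ HK2]] := psb_S2 N (s - 1)%C (/ 2) (4 * W) ltac:(lra) ltac:(lra) ltac:(rewrite re1 S_INR; lra).
  have [_ G] := HK2 (Dseq N w) D (tau * lowfac a) (fun k => tau * (a + INR k)) D0 (fun n => HD w n Hw)
      ltac:(lra) ltac:(lra) (fun k => lowfac_le tau a k Ha Ht).
  have {}G := G (s - 1)%C ltac:(rewrite Cmod_minus_diag; lra).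
  have T := csums_plus _ _ _ _ B G.
  have [Cb [Cb0 HCb]] := Cpower_bound (- s)%C.
  (* [Re s = 2 + 2 delta] is shared out as [1 + delta] for each of the two summations. *)
  pose delta := (Re s - 2) / 2.
  have d0 : 0 < delta by rewrite /delta; lra.
  pose L := 1 + / delta.
  have L0 : 0 < L by have := Rinv_0_lt_compat _ d0; rewrite /L; lra.
  have HL := rbdd_rp delta d0.
  have M0 := Cmod_ge_0 (s - 1)%C.
  pose c := Cmod (s - 1)%C * Cb.
  have c0 : 0 <= c by apply Rmult_le_pos.
  pose y := tau * lowfac a.
  have y0 : 16 <= y by rewrite /y; lra.
  have tb k m : Cmod (t k m) <= c * rp (INR k + 1) (- (1) - delta) * rp (INR m + 1) (- (1) - delta).
  { rewrite /t Cmod_mult /c !Rmult_assoc; apply Rmult_le_compat_l => //.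
    have X := xk k; have km := x0 m; have kk := x0 k.
    apply: Rle_trans (HCb (tau * (a + INR k) + INR m) w ltac:(lra) ltac:(lra)) _.
    apply Rmult_le_compat_l => //.
    have -> : Re (- s)%C = - (1) - delta + (- (1) - delta) by rewrite /delta /Re /=; field.
    rewrite rp_plus; apply Rmult_le_compat; try (apply Rlt_le, rp_pos); apply rp_antimono; try lra.
    have := lowfac_le tau a k Ha Ht; rewrite -/y; nra. }
  have HR k : rbdd (fun m => Cmod (t k m)) (c * rp (INR k + 1) (- (1) - delta) * L).
  { apply: (rbdd_le _ (fun m => c * rp (INR k + 1) (- (1) - delta) * rp (INR m + 1) (- (1) - delta))) => //.
    apply rbdd_scal => //; apply Rmult_le_pos => //; apply Rlt_le, rp_pos. }
  have HB : rbdd (fun k => c * rp (INR k + 1) (- (1) - delta) * L) (c * L * L).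
  { apply: (rbdd_le _ (fun k => (c * L) * rp (INR k + 1) (- (1) - delta))); first by move=> k; lra.
    apply rbdd_scal => //; nra. }
  have [row [l [Hrow [_ [Hl [Hl2 _]]]]]] := double_series t _ _ _ HR HB A.
  exists (fun m => / (s - 1) * row m)%C; split.
  - move=> m; apply: csums_ext (csums_scal (/ (s - 1))%C _ _ (Hrow m)) => k.
    rewrite /t.
    have -> : (RtoC (tau * a) + w + RtoC (INR m) + RtoC (INR k * tau) = RtoC (tau * (a + INR k) + INR m) + w)%C.
    { rewrite !RtoC_plus !RtoC_mult RtoC_plus; ring. }
    by field.
  - rewrite /Z2 -(csums_unique _ _ _ Hl T); by apply csums_scal.
Qed.

Lemma psa_Z2 N tau a K W w s0 r :
  0 < tau -> 0 < a -> 1 <= W -> Cmod w <= W -> 16 * W <= tau * lowfac a -> 16 <= a + INR K ->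
  0 < r -> r < Cmod (s0 - 1)%C -> r < Cmod (s0 - 2)%C -> 5 <= Re s0 - r + INR N ->
  psa s0 r (Z2 N tau a K w).
Proof.
  move=> Ht Ha HW Hw Hy HK Hr H1 H2 HN; apply psa_mult; first by apply psa_inv.
  apply psa_plus; first by apply psa_Z2_main => //; lra.
  have [K' [_ HK']] := psb_Z2_rem N a W s0 r Hr HW Ha HN.
  eexists; by apply (proj1 (HK' tau Ht Hy) w Hw).
Qed.

(** * Uniqueness of the continuation *)

Lemma csums_term_bounded u l : csums u l -> exists M, forall n, Cmod (u n) <= M.
Proof.
  move=> H; have [N HN] := H 1 ltac:(lra).
  have P n : 0 <= Cmod (u n) by apply Cmod_ge_0.
  exists (2 + rsum (fun k => Cmod (u k)) N) => n.
  have S0 := rsum_nonneg (fun k => Cmod (u k)) N P.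
  case: (Compare_dec.le_lt_dec N n) => Hn.
  - have A := HN n Hn; have B := HN (S n) ltac:(lia).
    have -> : u n = (csum u (S n) - csum u n)%C by rewrite csum_S; ring.
    have := Cmod_sub_triangle (csum u (S n)) l (csum u n).
    rewrite (Cmod_sub_sym l); lra.
  - have := rsum_incr (fun k => Cmod (u k)) (S n) N P ltac:(lia) => /=.
    have := rsum_nonneg (fun k => Cmod (u k)) n P; lra.
Qed.

(** Convergence at distance [r / 2] bounds the terms there by some [M]; at radius [r / 4] they are
    dominated by [M / 2^n], hence the norm [2 M]. *)
Lemma analytic_psb f s : analytic_at f s -> exists r M, psb s r M f.
Proof.
  move=> [a [r [Hr H]]].
  have {}H h : Cmod h < r -> csums (fun n => a n * h ^ n)%C (f (s + h)%C).
  { move=> Hh; have E : (s + h - s = h)%C by ring.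
    have := H (s + h)%C; rewrite E => /(_ Hh) /is_series_csums.
    apply csums_ext => k; rewrite pow_n_C; apply Cmult_comm. }
  have Hr2 : Cmod (RtoC (r / 2)) = r / 2 by rewrite Cmod_R Rabs_pos_eq; lra.
  have [M HM] := csums_term_bounded _ _ (H (RtoC (r / 2)) ltac:(lra)).
  exists (r / 4), (M * 2), a; split; first lra; split.
  - move=> n; apply (Rle_trans _ (rsum (fun n => M * (/ 2) ^ n) n)).
    + apply rsum_le => k; have := HM k; rewrite Cmod_mult Cmod_pow Hr2 => Q.
      have -> : r / 4 = r / 2 * / 2 by field.
      rewrite Rpow_mult_distr -Rmult_assoc; apply Rmult_le_compat_r => //.
      apply pow_le; lra.
    + rewrite rsum_scal; have G := rsum_geom (/ 2) n ltac:(lra).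
      have G2 : / (1 - / 2) = 2 by field.
      rewrite G2 in G.
      apply Rmult_le_compat_l; last exact G.
      apply: Rle_trans (Cmod_ge_0 _) (HM 0%nat).
  - move=> x Hx; have {2}-> : x = (s + (x - s))%C by ring.
    apply H; lra.
Qed.

Lemma small_zero (b0 b1 : C) K r : 0 < r ->
  (exists u : C, Cmod u = 1 /\ forall h, 0 < h <= r -> Cmod (b0 + b1 * (RtoC h * u))%C <= K * h) -> b0 = 0.
Proof.
  move=> Hr [u [Hu H]].
  apply Cmod_eq_0, Rle_antisym; last apply Cmod_ge_0.
  apply le_epsilon => eps He.
  have K0 : 0 <= K.
  { have := H r ltac:(lra); have := Cmod_ge_0 (b0 + b1 * (RtoC r * u))%C => A B.
    have : 0 <= K * r by lra. move=> Q; nra. }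
  have b10 := Cmod_ge_0 b1.
  pose h := Rmin r (eps / (K + Cmod b1 + 1)).
  have h0 : 0 < h by apply Rmin_glb_lt => //; apply Rdiv_lt_0_compat; lra.
  have h1 : h <= r by apply Rmin_l.
  have h2 : h * (K + Cmod b1 + 1) <= eps.
  { have : h <= eps / (K + Cmod b1 + 1) by apply Rmin_r.
    move=> Q; have := Rmult_le_compat_r (K + Cmod b1 + 1) _ _ ltac:(lra) Q.
    have -> : eps / (K + Cmod b1 + 1) * (K + Cmod b1 + 1) = eps by field; lra. done. }
  have := H h ltac:(lra).
  have : Cmod b0 <= Cmod (b0 + b1 * (RtoC h * u))%C + Cmod (b1 * (RtoC h * u))%C.
  { have := Cmod_triangle_minus (b0 + b1 * (RtoC h * u))%C (b1 * (RtoC h * u))%C.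
    by have -> : (b0 + b1 * (RtoC h * u) - b1 * (RtoC h * u) = b0)%C by ring. }
  rewrite !Cmod_mult Hu Cmod_R Rabs_pos_eq; last lra. nra.
Qed.

(** Continuity along one segment is enough. The direction [u] is [1] on horizontal lines and [Ci]
    for reaching the real axis. *)
Lemma ps_zero_center s0 r M a g u : ps s0 r M a g -> Cmod u = 1 ->
  (forall h, 0 < h <= r -> g (s0 + RtoC h * u)%C = 0) -> a 0%nat = 0.
Proof.
  move=> H Hu Hz; have Hr := proj1 H.
  apply (small_zero _ (a 1%nat) (r * (M / r ^ 2)) r) => //; exists u; split => // h Hh.
  have E : Cmod (RtoC h * u)%C = h by rewrite Cmod_mult Hu Cmod_R Rabs_pos_eq; lra.
  have := ps_tail2 _ _ _ _ _ (RtoC h * u)%C H ltac:(lra).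
  rewrite Hz // E.
  have -> : (0 - a 0%nat - a 1%nat * (RtoC h * u) = - (a 0%nat + a 1%nat * (RtoC h * u)))%C by ring.
  rewrite Cmod_opp => Q; apply: Rle_trans Q _.
  have M0 := ps_nonneg _ _ _ _ _ H.
  have P : 0 <= M / r ^ 2 by apply Rdiv_le_0_compat => //; apply pow_lt.
  have -> : h ^ 2 * (M / r ^ 2) = h * (M / r ^ 2) * h by ring.
  apply Rmult_le_compat_r; first lra.
  apply Rmult_le_compat_r; lra.
Qed.

(** Dividing by [h] gives the series with shifted coefficients, which vanishes on the same segment,
    so the induction runs on the index of the coefficient. *)
Lemma ps_zero_coefs n s0 r M a g : ps s0 r M a g ->
  (forall h, 0 < h <= r -> g (s0 + RtoC h)%C = 0) -> a n = 0.
Proof.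
  elim: n M a g => [|n IH] M a g H Hz.
  - apply (ps_zero_center s0 r M a g 1 H Cmod_1) => h Hh.
    by rewrite Cmult_1_r Hz.
  - have Hr := proj1 H.
    have a0 : a 0%nat = 0.
    { apply (ps_zero_center s0 r M a g 1 H Cmod_1) => h Hh.
      by rewrite Cmult_1_r Hz. }
    have A : rbdd (fun k => Cmod (a (S k)) * r ^ k) (/ r * M).
    { have T := rbdd_shift (fun k => Cmod (a k) * r ^ k) M 1
        (fun k => Rmult_le_pos _ _ (Cmod_ge_0 _) (pow_le _ _ (Rlt_le _ _ Hr))) (proj1 (proj2 H)).
      have ri : 0 <= / r by apply Rlt_le, Rinv_0_lt_compat.
      apply: rbdd_le (rbdd_scal _ _ _ ri T) => k.
      rewrite Nat.add_1_l -tech_pow_Rmult; apply Req_le; field; lra. }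
    have ex s : exists l, Cmod (s - s0)%C <= r -> csums (fun k => a (S k) * (s - s0) ^ k)%C l.
    { case: (Rle_lt_dec (Cmod (s - s0)%C) r) => Hs; last by exists 0 => ?; lra.
      have [l Hl] := csums_abs (fun k => a (S k) * (s - s0) ^ k)%C (/ r * M)
         ltac:(apply: rbdd_le A => k; by apply (ps_term_le r (fun k => a (S k)))).
      by exists l. }
    have [G HG] := choice_of _ ex.
    apply (IH (/ r * M) (fun k => a (S k)) G); first by split.
    move=> h Hh.
    have hC : RtoC h <> 0 by apply RtoC_neq_0; lra.
    have E : (s0 + RtoC h - s0 = RtoC h)%C by ring.
    have Ch : Cmod (s0 + RtoC h - s0)%C <= r by rewrite E Cmod_R Rabs_pos_eq; lra.
    have S1 := proj2 (proj2 H) (s0 + RtoC h)%C Ch; rewrite Hz // in S1.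
    have S2 := csums_scal (RtoC h) _ _ (HG _ Ch).
    have S3 : csums (fun k => a k * (s0 + RtoC h - s0) ^ k)%C (RtoC h * G (s0 + RtoC h)%C)%C.
    { have -> : (RtoC h * G (s0 + RtoC h) = csum (fun k => a k * (s0 + RtoC h - s0) ^ k) 1 + RtoC h * G (s0 + RtoC h))%C
        by rewrite /= a0; ring.
      apply csums_shift; apply: csums_ext S2 => k; rewrite Nat.add_1_l E Cpow_S; ring. }
    have Z := csums_unique _ _ _ S1 S3.
    have -> : G (s0 + RtoC h)%C = (/ RtoC h * (RtoC h * G (s0 + RtoC h)))%C by field.
    rewrite -Z; ring.
Qed.

Lemma psb_zero_disc s0 r M g : psb s0 r M g ->
  (forall h, 0 < h <= r -> g (s0 + RtoC h)%C = 0) -> forall s, Cmod (s - s0)%C <= r -> g s = 0.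
Proof.
  move=> [a Ha] Hz s Hs.
  apply: csums_unique (proj2 (proj2 Ha) s Hs) _.
  apply: csums_ext (csums_finite (fun _ => 0) 0 (fun _ _ => eq_refl)) => k.
  rewrite (ps_zero_coefs k _ _ _ _ _ Ha Hz); ring.
Qed.

(** Connectedness of a half line: at the supremum [T] of the points where [g] is nonzero, [g]
    vanishes to the right, hence on a disc around [T], against the choice of [T]. *)
Lemma horizontal_line_zero g sigma y :
  (forall t, sigma < t -> exists r M, psb (t, y) r M g) ->
  (forall t, 2 < t -> g (t, y) = 0) -> forall t, sigma < t -> g (t, y) = 0.
Proof.
  move=> Ha Hz t0 Ht0; apply Classical_Prop.NNPP => Hne.
  pose E t := sigma < t /\ g (t, y) <> 0.
  have [T [HT1 HT2]] : {T | is_lub E T}.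
  { apply completeness.
    - exists 2 => t [_ Ht]; apply Rnot_lt_le => Hlt; by apply Ht, Hz.
    - by exists t0. }
  have T0 : t0 <= T by apply HT1.
  have [r [M H]] := Ha T ltac:(lra).
  have Hr : 0 < r by case: H => a [].
  have line h : (T + h, y) = ((T, y) + RtoC h)%C.
  { rewrite /RtoC /Cplus /=; congr pair; ring. }
  have D := psb_zero_disc _ _ _ _ H.
  have {}D : forall s, Cmod (s - (T, y))%C <= r -> g s = 0.
  { apply D => h Hh; rewrite -line; apply Classical_Prop.NNPP => Hn.
    have : T + h <= T by apply HT1; split => //; lra. lra. }
  have : T <= T - r.
  { apply HT2 => t [Ht1 Ht2]; apply Rnot_lt_le => Hlt; apply Ht2.
    have Tt : t <= T by apply HT1.
    apply D.
    have -> : t = T + (t - T) by ring.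
    rewrite line; have -> : ((T, y) + RtoC (t - T) - (T, y) = RtoC (t - T))%C by ring.
    rewrite Cmod_R; apply Rabs_le; lra. }
  lra.
Qed.

Lemma psb_sub s0 f g r M r' M' : psb s0 r M f -> psb s0 r' M' g ->
  exists r M, psb s0 r M (fun s => f s - g s)%C.
Proof.
  move=> H H'.
  have Hr : 0 < r by case: H => a [].
  have Hr' : 0 < r' by case: H' => a [].
  exists (Rmin r r'), (M + M'); apply psb_minus.
  - apply: psb_shrink H; split; [by apply Rmin_glb_lt | apply Rmin_l].
  - apply: psb_shrink H'; split; [by apply Rmin_glb_lt | apply Rmin_r].
Qed.

(** The exceptional points [1] and [2] are real, so horizontal lines off the real axis avoid them;
    the real points are then reached vertically. *)
Lemma continuation_unique f g sigma : sigma < 2 ->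
  (forall s, sigma < Re s -> s <> RtoC 1 -> s <> RtoC 2 -> exists r M, psb s r M f) ->
  (forall s, sigma < Re s -> s <> RtoC 1 -> s <> RtoC 2 -> exists r M, psb s r M g) ->
  (forall s, 2 < Re s -> f s = g s) ->
  forall s, sigma < Re s -> s <> RtoC 1 -> s <> RtoC 2 -> f s = g s.
Proof.
  move=> Hsig Hf Hg E.
  have H s : sigma < Re s -> s <> RtoC 1 -> s <> RtoC 2 -> exists r M, psb s r M (fun s => f s - g s)%C.
  { move=> h1 h2 h3; have [r [M A]] := Hf s h1 h2 h3; have [r' [M' A']] := Hg s h1 h2 h3.
    by apply: psb_sub A A'. }
  have off s : sigma < Re s -> Im s <> 0 -> (f s - g s = 0)%C.
  { move=> Hs Hi; case: s Hs Hi => t y /= Ht Hy.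
    apply (horizontal_line_zero (fun s => f s - g s)%C sigma y) => // u Hu.
    - apply H => // [[_ E2]|[_ E2]]; exact: Hy E2.
    - rewrite E //; ring. }
  have sub s : (f s - g s = 0)%C -> f s = g s.
  { move=> Z; have -> : f s = (f s - g s + g s)%C by ring. rewrite Z; ring. }
  move=> s Hs s1 s2; apply sub.
  case: (Req_dec (Im s) 0) => Hi; last by apply off.
  have [r [M [a Ha]]] := H s Hs s1 s2.
  rewrite (ps_value _ _ _ _ _ Ha).
  apply (ps_zero_center _ _ _ _ _ Ci Ha Cmod_Ci) => h Hh.
  apply off.
  - have -> : Re (s + RtoC h * Ci)%C = Re s by rewrite /Re /=; ring. done.
  - have -> : Im (s + RtoC h * Ci)%C = Im s + h by rewrite /Im /=; ring. lra.
Qed.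

(** * Identification of the Barnes double zeta function *)

Definition admissible (tau a W : R) (K : nat) : Prop :=
  0 < tau /\ 0 < a /\ 1 <= W /\ 16 * W <= tau * lowfac a /\ 16 <= a + INR K.

Lemma Z2_psb tau a W K w N s : admissible tau a W K -> Cmod w <= W ->
  5 < Re s + INR N -> s <> RtoC 1 -> s <> RtoC 2 ->
  exists r M, psb s r M (Z2 N tau a K w).
Proof.
  move=> [Ht [Ha [HW [Hy HK]]]] Hw HN s1 s2.
  have p1 : 0 < Cmod (s - 1)%C.
  { apply Cmod_gt_0 => E; apply s1; have -> : s = (s - 1 + 1)%C by ring. rewrite E; ring. }
  have p2 : 0 < Cmod (s - 2)%C.
  { apply Cmod_gt_0 => E; apply s2; have -> : s = (s - 2 + 2)%C by ring. rewrite E; ring. }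
  pose r := Rmin (Re s + INR N - 5) (Rmin (Cmod (s - 1)%C / 2) (Cmod (s - 2)%C / 2)).
  have r0 : 0 < r by apply Rmin_glb_lt; [lra | apply Rmin_glb_lt; lra].
  have r1 : r <= Re s + INR N - 5 by apply Rmin_l.
  have r2 : r <= Cmod (s - 1)%C / 2 by apply: Rle_trans (Rmin_r _ _) (Rmin_l _ _).
  have r3 : r <= Cmod (s - 2)%C / 2 by apply: Rle_trans (Rmin_r _ _) (Rmin_r _ _).
  have [M HM] := psa_Z2 N tau a K W w s r Ht Ha HW Hw Hy HK r0 ltac:(lra) ltac:(lra) ltac:(lra).
  by exists r, M.
Qed.

Definition double_sum_at (tau : R) (z s l : C) : Prop :=
  exists row, (forall m, csums (fun k => Cpower (z + RtoC (INR m) + RtoC (INR k * tau)) (- s))%C (row m)) /\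
    csums row l.

Lemma double_sum_at_unique tau z s l l' :
  double_sum_at tau z s l -> double_sum_at tau z s l' -> l = l'.
Proof.
  move=> [row [H1 H2]] [row' [H1' H2']]; apply: csums_unique H2 _.
  apply: csums_ext H2' => m; apply: csums_unique (H1' m) (H1 m).
Qed.

Lemma Z2_double_sum tau a W K w N s : admissible tau a W K -> Cmod w <= W -> (3 <= N)%nat -> 2 < Re s ->
  double_sum_at tau (RtoC (tau * a) + w)%C s (Z2 N tau a K w s).
Proof.
  move=> [Ht [Ha [HW [Hy HK]]]] Hw HN Hs.
  apply (Z2_series N tau a K W w s) => //.
  have : INR 3 <= INR N by apply le_INR.
  rewrite /=; lra.
Qed.

Lemma Z2_indep tau a W K w N N' s : admissible tau a W K -> Cmod w <= W -> (N <= N')%nat -> (4 <= N)%nat ->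
  5 < Re s + INR N -> s <> RtoC 1 -> s <> RtoC 2 ->
  Z2 N tau a K w s = Z2 N' tau a K w s.
Proof.
  move=> Hadm Hw HN HN4 Hs.
  have i4 : INR 4 <= INR N by apply le_INR.
  have iN : INR N <= INR N' by apply le_INR.
  rewrite /= in i4.
  apply (continuation_unique _ _ (5 - INR N)); try lra.
  - move=> u Hu; apply (Z2_psb _ _ W) => //; lra.
  - move=> u Hu; apply (Z2_psb _ _ W) => //; lra.
  - move=> u Hu; apply: (double_sum_at_unique tau (RtoC (tau * a) + w)%C u);
      apply (Z2_double_sum _ _ W) => //; lia.
Qed.

(** One truncation order reaches only a half plane; an order growing with [|s|] gives a single
    function on the plane. The margin [7] keeps all points within distance [1] of [s] in the half
    plane belonging to the order at [s]. *)
Definition order_at (s : C) : nat := (Z.to_nat (up (Cmod s)) + 7)%nat.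

Lemma order_at_spec s : Cmod s + 7 <= INR (order_at s).
Proof.
  rewrite /order_at plus_INR; have [A _] := archimed (Cmod s).
  have s0 := Cmod_ge_0 s.
  have U : (0 <= up (Cmod s))%Z by apply le_IZR; lra.
  rewrite INR_IZR_INZ Z2Nat.id // /=; lra.
Qed.

Lemma Re_ge_opp_Cmod s : - Cmod s <= Re s.
Proof. have := re_le_Cmod s; have := Rle_abs (- Re s); rewrite Rabs_Ropp; lra. Qed.

Lemma psb_analytic_eq s r M f g : 0 < r -> psb s r M f ->
  (forall u, Cmod (u - s)%C <= r -> f u = g u) -> analytic_at g s.
Proof. move=> Hr H E; apply: psb_analytic; by apply: psb_ext H. Qed.

Lemma Cmod_sub_gt_0 (s c : C) : s <> c -> 0 < Cmod (s - c)%C.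
Proof.
  move=> H; apply Cmod_gt_0 => E; apply H.
  have -> : s = (s - c + c)%C by ring. rewrite E; ring.
Qed.

(** Near each point the varying order may be replaced by the fixed order at the centre, since any
    two orders agree where both apply. *)
Lemma barnes_zeta2_exists tau a W K w : admissible tau a W K -> Cmod w <= W ->
  is_barnes_zeta2 tau (RtoC (tau * a) + w)%C (fun s => Z2 (order_at s) tau a K w s).
Proof.
  move=> Hadm Hw.
  have big s : (7 <= order_at s)%nat by rewrite /order_at; lia.
  split.
  - move=> s s1 s2.
    have S0 := order_at_spec s; have Rs := Re_ge_opp_Cmod s.
    have [r [M H]] := Z2_psb tau a W K w (order_at s) s Hadm Hw ltac:(lra) s1 s2.
    have Hr : 0 < r by case: H => b [].
    have p1 := Cmod_sub_gt_0 _ _ s1; have p2 := Cmod_sub_gt_0 _ _ s2.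
    pose r' := Rmin (Rmin r 1) (Rmin (Cmod (s - 1)%C / 2) (Cmod (s - 2)%C / 2)).
    have r0 : 0 < r' by apply Rmin_glb_lt; apply Rmin_glb_lt; lra.
    have h1 : r' <= r by apply: Rle_trans (Rmin_l _ _) (Rmin_l _ _).
    have h2 : r' <= 1 by apply: Rle_trans (Rmin_l _ _) (Rmin_r _ _).
    have h3 : r' <= Cmod (s - 1)%C / 2 by apply: Rle_trans (Rmin_r _ _) (Rmin_l _ _).
    have h4 : r' <= Cmod (s - 2)%C / 2 by apply: Rle_trans (Rmin_r _ _) (Rmin_r _ _).
    apply (psb_analytic_eq s r' M (Z2 (order_at s) tau a K w) _ r0).
    { apply: psb_shrink H; lra. }
    move=> u Hu.
    have Ru := Re_ge_opp_Cmod u; have Su := order_at_spec u.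
    have u1 : u <> RtoC 1.
    { move=> E; rewrite E Cmod_sub_sym in Hu; lra. }
    have u2 : u <> RtoC 2.
    { move=> E; rewrite E Cmod_sub_sym in Hu; lra. }
    have Rsu : Re s - 1 <= Re u.
    { have := Re_ge_opp_Cmod (u - s)%C.
      have -> : Re (u - s)%C = Re u - Re s by []. lra. }
    case: (Compare_dec.le_lt_dec (order_at s) (order_at u)) => L.
    + apply (Z2_indep _ _ W) => //; [have := big s; lia | lra].
    + symmetry; apply (Z2_indep _ _ W) => //; [lia | have := big u; lia | lra].
  - move=> s Hs.
    have [row [H1 H2]] := Z2_double_sum tau a W K w (order_at s) s Hadm Hw ltac:(have := big s; lia) Hs.
    exists row; split => [k1|]; by apply is_series_csums.
Qed.

(** The [epsilon] in [barnes_zeta2] carries information only once a continuation is known to exist;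
    uniqueness then identifies it with [Z2]. *)
Lemma barnes_zeta2_eq tau a W K w N s : admissible tau a W K -> Cmod w <= W -> (4 <= N)%nat ->
  5 < Re s + INR N -> s <> RtoC 1 -> s <> RtoC 2 ->
  barnes_zeta2 tau (RtoC (tau * a) + w)%C s = Z2 N tau a K w s.
Proof.
  move=> Hadm Hw HN Hs.
  have [P1 P2] : is_barnes_zeta2 tau (RtoC (tau * a) + w)%C (barnes_zeta2 tau (RtoC (tau * a) + w)%C).
  { apply (epsilon_spec (inhabits (fun _ : C => RtoC 0)) (is_barnes_zeta2 tau (RtoC (tau * a) + w)%C)).
    eexists; exact (barnes_zeta2_exists tau a W K w Hadm Hw). }
  have i4 : INR 4 <= INR N by apply le_INR.
  rewrite /= in i4.
  apply (continuation_unique _ _ (5 - INR N)); try lra.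
  - move=> u Hu u1 u2; by apply analytic_psb, P1.
  - move=> u Hu; apply (Z2_psb _ _ W) => //; lra.
  - move=> u Hu; apply: (double_sum_at_unique tau (RtoC (tau * a) + w)%C u).
    + have [row [H1 H2]] := P2 u Hu; exists row; split => [k|]; by apply is_series_csums.
    + apply (Z2_double_sum _ _ W) => //; lia.
Qed.

(** [6 <= N] places the disc of radius [1/2] around [0] in the half plane [Re s > 5 - N], and this
    disc avoids the poles. *)
Lemma log_Gamma2_eq tau a W K w N : admissible tau a W K -> Cmod w <= W -> (6 <= N)%nat ->
  log_Gamma2 (RtoC (tau * a) + w)%C tau = C_derive (Z2 N tau a K w) 0.
Proof.
  move=> Hadm Hw HN.
  have i6 : INR 6 <= INR N by apply le_INR.
  rewrite /= in i6.
  have n1 : RtoC 0 <> RtoC 1 by move=> /RtoC_inj; lra.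
  have n2 : RtoC 0 <> RtoC 2 by move=> /RtoC_inj; lra.
  have [r [M H]] := Z2_psb tau a W K w N 0 Hadm Hw ltac:(rewrite /Re /=; lra) n1 n2.
  have Hr : 0 < r by case: H => b [].
  have r2 : 0 < Rmin r (/ 2) by apply Rmin_glb_lt; lra.
  have {H} [b Hb] := psb_shrink _ _ _ _ _ (conj r2 (Rmin_l r (/ 2))) H.
  rewrite (ps_derive _ _ _ _ _ Hb) /log_Gamma2.
  apply (ps_derive 0 (Rmin r (/ 2)) M b).
  apply: ps_ext Hb => s Hs; symmetry.
  have Hs2 : Cmod s <= / 2.
  { have -> : s = (s - 0)%C by ring. apply: Rle_trans Hs (Rmin_r _ _). }
  apply (barnes_zeta2_eq _ _ W) => //.
  - lia.
  - have := Re_ge_opp_Cmod s; lra.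
  - move=> E; rewrite E Cmod_1 in Hs2; lra.
  - move=> E; rewrite E Cmod_R Rabs_pos_eq in Hs2; lra.
Qed.

(** * The gamma function *)

Definition gint (x t : R) : R := Rpower t (x - 1) * exp (- t).

Lemma gint_pos x t : 0 < gint x t.
Proof. apply Rmult_lt_0_compat; apply exp_pos. Qed.

Lemma is_derive_Rpower x t : 0 < t -> is_derive (fun u => Rpower u x) t (x * Rpower t (x - 1)).
Proof. move=> H; apply is_derive_Reals, derivable_pt_lim_power => //. Qed.

Lemma gint_continuous x t : 0 < t -> continuous (gint x) t.
Proof.
  move=> H; apply (continuous_mult (K := R_AbsRing) (fun t => Rpower t (x - 1)) (fun t => exp (- t))).
  - apply (ex_derive_continuous (V := R_NormedModule)); eexists; by apply is_derive_Rpower.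
  - apply (ex_derive_continuous (V := R_NormedModule)); by auto_derive.
Qed.

(** The improper integral is split at [1]; both of its ends are limits of this one
    antiderivative. *)
Definition gprim (x u : R) : R := RInt (gint x) 1 u.

Lemma gprim_derive x u : 0 < u -> is_derive (gprim x) u (gint x u).
Proof.
  move=> Hu; apply (is_derive_RInt (V := R_NormedModule) (gint x) (gprim x) 1 u).
  - have loc : locally u (fun y => 0 < y).
    { exists (mkposreal _ Hu) => y /= Hy; move: (Rabs_def2 _ _ Hy); rewrite /minus /plus /opp /=; lra. }
    apply: filter_imp loc => y Hy.
    apply (RInt_correct (V := R_CompleteNormedModule)), (ex_RInt_continuous (V := R_CompleteNormedModule)) => z Hz.
    apply gint_continuous; apply: Rlt_le_trans (proj1 Hz); apply Rmin_glb_lt; lra.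
  - by apply gint_continuous.
Qed.

Lemma derive_nonneg_le (f df : R -> R) u v : u <= v ->
  (forall t, u <= t <= v -> is_derive f t (df t)) -> (forall t, u <= t <= v -> 0 <= df t) -> f u <= f v.
Proof.
  move=> Huv Hd Hp.
  case: (Req_dec u v) => [->|Hne]; first lra.
  have [c [Hc1 Hc2]] := MVT_gen f u v df
     (fun t Ht => Hd t ltac:(move: Ht; rewrite Rmin_left ?Rmax_right; lra))
     (fun t Ht => proj2 (continuity_pt_filterlim f t)
        (ex_derive_continuous (V := R_NormedModule) f t (ex_intro _ _ (Hd t ltac:(move: Ht; rewrite Rmin_left ?Rmax_right; lra))))).
  rewrite Rmin_left ?Rmax_right in Hc1; try lra.
  have := Hp c ltac:(lra). nra.
Qed.

Lemma gprim_incr x u v : 0 < u <= v -> gprim x u <= gprim x v.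
Proof.
  move=> H; apply (derive_nonneg_le _ (gint x)) => [|t Ht|t Ht]; first lra.
  - apply gprim_derive; lra.
  - apply Rlt_le, gint_pos.
Qed.

Lemma gprim_1 x : gprim x 1 = 0.
Proof. exact (RInt_point (V := R_CompleteNormedModule) 1 (gint x)). Qed.

Lemma Rpower_exp_bound y : exists K, 0 < K /\ forall t, 1 <= t -> Rpower t y <= K * exp (t / 2).
Proof.
  have [n Hn] : exists n, y <= INR n.
  { exists (Z.to_nat (up (Rabs y))). have [A _] := archimed (Rabs y). have y0 := Rabs_pos y.
    have U : (0 <= up (Rabs y))%Z by apply le_IZR; lra.
    rewrite INR_IZR_INZ Z2Nat.id //; have := Rle_abs y; lra. }
  have F := INR_fact_lt_0 n.
  have P2 : 0 < 2 ^ n by apply pow_lt; lra.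
  exists (2 ^ n * INR (Factorial.fact n)); split; first nra.
  move=> t Ht.
  apply (Rle_trans _ (Rpower t (INR n))).
  { apply Rle_Rpower; lra. }
  rewrite Rpower_pow; last lra.
  have E := exp_ge_taylor (t / 2) n ltac:(lra).
  have S : (t / 2) ^ n / INR (Factorial.fact n) <= sum_f_R0 (fun k => (t / 2) ^ k / INR (Factorial.fact k)) n.
  { rewrite -sum_n_Reals sum_n_rsum /=.
    have t2 : 0 <= t / 2 by lra.
    have := rsum_nonneg (fun k => (t / 2) ^ k / INR (Factorial.fact k)) n
      (fun k => Rdiv_le_0_compat _ _ (pow_le _ k t2) (INR_fact_lt_0 k)). lra. }
  have -> : t ^ n = 2 ^ n * INR (Factorial.fact n) * ((t / 2) ^ n / INR (Factorial.fact n)).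
  { rewrite Rpow_mult_distr pow_inv; field; split; lra. }
  apply Rmult_le_compat_l; [nra | lra].
Qed.

Lemma incr_bounded_lim (F : R -> R) M :
  (forall u v, 1 <= u <= v -> F u <= F v) -> (forall u, 1 <= u -> F u <= M) ->
  exists l, filterlim F (Rbar_locally p_infty) (locally l) /\ forall u, 1 <= u -> F u <= l.
Proof.
  move=> Hi Hb.
  have [l [Hl1 Hl2]] : {l | is_lub (fun y => exists u, 1 <= u /\ y = F u) l}.
  { apply completeness; first by exists M => y [u [Hu ->]]; apply Hb.
    exists (F 1), 1; split => //; lra. }
  exists l; split; last by move=> u Hu; apply Hl1; exists u.
  apply filterlim_locally => eps.
  have [u [Hu1 Hu2]] : exists u, 1 <= u /\ l - eps < F u.
  { apply Classical_Prop.NNPP => Hn.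
    have := Hl2 (l - eps) => /(_ _) Q.
    have : l <= l - eps.
    { apply Q => y [u [Hu ->]]; apply Rnot_lt_le => Hlt; apply Hn; by exists u. }
    have := cond_pos eps; lra. }
  exists u => v Hv.
  have A := Hi u v ltac:(lra).
  have B : F v <= l by apply Hl1; exists v; split => //; lra.
  rewrite /ball /= /AbsRing_ball /= /abs /minus /plus /opp /=.
  apply Rabs_def1; have := cond_pos eps; lra.
Qed.

Lemma gprim_lim_infty x : exists l, filterlim (gprim x) (Rbar_locally p_infty) (locally l) /\ 0 < l.
Proof.
  have [K [K0 HK]] := Rpower_exp_bound (x - 1).
  have B u : 1 <= u -> gprim x u <= 2 * K.
  { move=> Hu.
    have D t : is_derive (fun t => - (2 * K * exp (- (t / 2)))) t (K * exp (- (t / 2))).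
    { rewrite /Rdiv; auto_derive => //; field. }
    have Q : - (2 * K * exp (- (1 / 2))) - gprim x 1 <= - (2 * K * exp (- (u / 2))) - gprim x u.
    { apply (derive_nonneg_le (fun t => - (2 * K * exp (- (t / 2))) - gprim x t) (fun t => K * exp (- (t / 2)) - gint x t)); first lra.
      - move=> t Ht.
        apply: (is_derive_minus (K := R_AbsRing) (V := R_NormedModule) (fun t => - (2 * K * exp (- (t / 2)))) (gprim x)) => //.
        apply gprim_derive; lra.
      - move=> t Ht; rewrite /gint.
        have E : exp (- (t / 2)) = exp (t / 2) * exp (- t) by rewrite -exp_plus; congr exp; field.
        rewrite E; have := HK t ltac:(lra); have := exp_pos (- t) => P Q.
        have := Rmult_le_compat_r _ _ _ (Rlt_le _ _ P) Q; lra. }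
    rewrite gprim_1 in Q.
    have E1 : exp (- (1 / 2)) <= 1 by rewrite -[X in _ <= X]exp_0; apply exp_le_mono; lra.
    have E2 := exp_pos (- (u / 2)).
    have E3 := Rmult_le_compat_l (2 * K) _ _ ltac:(lra) E1.
    have E4 : 0 <= 2 * K * exp (- (u / 2)) by apply Rmult_le_pos; lra.
    lra. }
  have [l [H1 H2]] := incr_bounded_lim (gprim x) _ (fun u v Huv => gprim_incr x u v ltac:(lra)) B.
  exists l; split => //.
  have [c [Hc1 Hc2]] := MVT_gen (gprim x) 1 2 (gint x)
     (fun t Ht => gprim_derive x t ltac:(move: Ht; rewrite Rmin_left ?Rmax_right; lra))
     (fun t Ht => proj2 (continuity_pt_filterlim (gprim x) t)
        (ex_derive_continuous (V := R_NormedModule) (gprim x) t (ex_intro _ _ (gprim_derive x t ltac:(move: Ht; rewrite Rmin_left ?Rmax_right; lra))))).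
  have := gint_pos x c; have := H2 2 ltac:(lra); rewrite gprim_1 in Hc2; lra.
Qed.

(** Replacing [u] by [/ u] reduces the end [0] to monotone convergence at infinity. The sign of the
    limit is recorded for [Gamma_pos]. *)
Lemma gprim_lim_0 x : 0 < x -> exists l, filterlim (gprim x) (at_right 0) (locally l) /\ l <= 0.
Proof.
  move=> Hx.
  have inv u : 1 <= u -> 0 < / u <= 1.
  { move=> Hu; split; first by apply Rinv_0_lt_compat; lra.
    rewrite -Rinv_1; apply Rinv_le_contravar; lra. }
  have B u : 1 <= u -> - gprim x (/ u) <= / x.
  { move=> Hu; have [i0 i1] := inv u Hu.
    have Q : Rpower (/ u) x / x - gprim x (/ u) <= Rpower 1 x / x - gprim x 1.
    { apply (derive_nonneg_le (fun t => Rpower t x / x - gprim x t) (fun t => Rpower t (x - 1) - gint x t)); first lra.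
      - move=> t Ht.
        apply: (is_derive_minus (K := R_AbsRing) (V := R_NormedModule) (fun t => Rpower t x / x) (gprim x)).
        + evar_last.
          * apply (is_derive_ext (fun t => scal (/ x) (Rpower t x))).
            { move=> y; rewrite /scal /= /mult /= /Rdiv; ring. }
            apply is_derive_scal, is_derive_Rpower; lra.
          * rewrite /scal /= /mult /=; field; lra.
        + apply gprim_derive; lra.
      - move=> t Ht; rewrite /gint.
        have E : exp (- t) <= 1 by rewrite -exp_0; apply exp_le_mono; lra.
        have P : 0 < Rpower t (x - 1) by apply exp_pos.
        nra. }
    have E1 : Rpower 1 x = 1 by rewrite /Rpower ln_1 Rmult_0_r exp_0.
    rewrite gprim_1 E1 in Q.
    have : 0 < Rpower (/ u) x / x by apply Rdiv_lt_0_compat => //; apply exp_pos.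
    have -> : / x = 1 / x by field; lra. lra. }
  have I u v : 1 <= u <= v -> - gprim x (/ u) <= - gprim x (/ v).
  { move=> Huv; apply Ropp_le_contravar, gprim_incr; split; first by apply inv; lra.
    apply Rinv_le_contravar; lra. }
  have [l [H1 H2]] := incr_bounded_lim (fun u => - gprim x (/ u)) _ I B.
  exists (- l); split.
  - apply (filterlim_ext_loc (fun u => - (- gprim x (/ / u)))).
    { exists (mkposreal 1 Rlt_0_1) => y _ Hy; rewrite Rinv_inv; ring. }
    apply: filterlim_comp; last apply: (filterlim_opp (V := R_NormedModule) l).
    apply: (filterlim_comp _ _ _ Rinv (fun u => - gprim x (/ u)) _ _ _ _ H1).
    apply filterlim_Rinv_0_right.
  - have := H2 1 ltac:(lra); rewrite Rinv_1 gprim_1; lra.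
Qed.

Lemma filter_prod_pos (P : R * R -> Prop) :
  (forall a b, 0 < a < 1 -> 1 < b -> P (a, b)) -> filter_prod (at_right 0) (Rbar_locally p_infty) P.
Proof.
  move=> H; apply (Filter_prod _ _ _ (fun a => 0 < a < 1) (fun b => 1 < b)).
  - exists (mkposreal 1 Rlt_0_1) => y /= Hy Hy0; move: (Rabs_def2 _ _ Hy); rewrite /minus /plus /opp /=; lra.
  - by exists 1.
  - move=> a b Ha Hb; by apply H.
Qed.

Lemma is_RInt_gen_antiderivative (F f : R -> R) l0 l1 :
  (forall t, 0 < t -> is_derive F t (f t)) -> (forall t, 0 < t -> continuous f t) ->
  filterlim F (at_right 0) (locally l0) -> filterlim F (Rbar_locally p_infty) (locally l1) ->
  is_RInt_gen f (at_right 0) (Rbar_locally p_infty) (l1 - l0).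
Proof.
  move=> Hd Hc H0 H1.
  apply: (is_RInt_gen_ext (Derive F)).
  - apply filter_prod_pos => a b Ha Hb t /=; rewrite Rmin_left ?Rmax_right; try lra.
    move=> Ht; apply is_derive_unique, Hd; lra.
  - apply is_RInt_gen_Derive => //.
    + apply filter_prod_pos => a b Ha Hb t /=; rewrite Rmin_left ?Rmax_right; try lra.
      move=> Ht; eexists; apply Hd; lra.
    + apply filter_prod_pos => a b Ha Hb t /=; rewrite Rmin_left ?Rmax_right; try lra.
      move=> Ht; apply (continuous_ext_loc _ f).
      * have Ht0 : 0 < t by lra.
        exists (mkposreal _ Ht0) => y /= Hy; symmetry; apply is_derive_unique, Hd.
        move: (Rabs_def2 _ _ Hy); rewrite /minus /plus /opp /=; lra.
      * apply Hc; lra.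
Qed.

Lemma Gamma_correct x : 0 < x -> is_RInt_gen (gint x) (at_right 0) (Rbar_locally p_infty) (Gamma x).
Proof.
  move=> Hx.
  have [l0 [H0 _]] := gprim_lim_0 x Hx; have [l1 [H1 _]] := gprim_lim_infty x.
  apply (RInt_gen_correct (V := R_CompleteNormedModule)).
  exists (l1 - l0); apply (is_RInt_gen_antiderivative (gprim x)) => // t Ht.
  - by apply gprim_derive.
  - by apply gint_continuous.
Qed.

Lemma Gamma_unique x l : is_RInt_gen (gint x) (at_right 0) (Rbar_locally p_infty) l -> Gamma x = l.
Proof. exact: (is_RInt_gen_unique (V := R_CompleteNormedModule) (gint x) l). Qed.

Lemma Gamma_pos x : 0 < x -> 0 < Gamma x.
Proof.
  move=> Hx.
  have [l0 [H0 P0]] := gprim_lim_0 x Hx; have [l1 [H1 P1]] := gprim_lim_infty x.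
  rewrite (Gamma_unique x (l1 - l0)); first lra.
  apply (is_RInt_gen_antiderivative (gprim x)) => // t Ht.
  - by apply gprim_derive.
  - by apply gint_continuous.
Qed.

Lemma filterlim_exp_minus c : 0 < c -> filterlim (fun t => exp (- (c * t))) (Rbar_locally p_infty) (locally 0).
Proof.
  move=> Hc; apply filterlim_locally => eps; exists (- ln eps / c) => t Ht.
  rewrite /ball /= /AbsRing_ball /= /abs /minus /plus /opp /= Ropp_0 Rplus_0_r.
  rewrite Rabs_pos_eq; last by apply Rlt_le, exp_pos.
  rewrite -[X in _ < X]exp_ln; last apply cond_pos.
  apply exp_increasing.
  have := Rmult_lt_compat_l c _ _ Hc Ht.
  have -> : c * (- ln eps / c) = - ln eps by field; lra. lra.
Qed.

(** Integration by parts: [- t^x exp (- t)] is an antiderivative of the difference of the two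
    integrands and vanishes at both ends. *)
Lemma Gamma_S x : 0 < x -> Gamma (x + 1) = x * Gamma x.
Proof.
  move=> Hx.
  have D t : 0 < t -> is_derive (fun t => - (Rpower t x * exp (- t))) t (gint (x + 1) t - x * gint x t).
  { move=> Ht.
    have E : is_derive (fun t => exp (- t)) t (- exp (- t)) by auto_derive => //; ring.
    have := is_derive_opp _ _ _ (is_derive_mult _ _ _ _ _ (is_derive_Rpower x t Ht) E Rmult_comm).
    move=> Q; evar_last; first exact Q.
    rewrite /gint /opp /plus /mult /=; have -> : x + 1 - 1 = x by ring. ring. }
  have C t : 0 < t -> continuous (fun t => gint (x + 1) t - x * gint x t) t.
  { move=> Ht; apply (continuous_minus (V := R_NormedModule)); first by apply gint_continuous.
    apply (continuous_scal_r (V := R_NormedModule) x); by apply gint_continuous. }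
  have L0 : filterlim (fun t => - (Rpower t x * exp (- t))) (at_right 0) (locally 0).
  { apply filterlim_locally => eps.
    have P := exp_pos (ln eps / x).
    exists (mkposreal _ P) => t /= Ht Ht0.
    have {}Ht : t < exp (ln eps / x) by move: (Rabs_def2 _ _ Ht); rewrite /minus /plus /opp /=; lra.
    rewrite /ball /= /AbsRing_ball /= /abs /minus /plus /opp /= Ropp_0 Rplus_0_r Rabs_Ropp.
    have P1 : 0 < Rpower t x by apply exp_pos.
    have P2 := exp_pos (- t).
    rewrite Rabs_pos_eq; last nra.
    have E1 : exp (- t) <= 1 by rewrite -exp_0; apply exp_le_mono; lra.
    have R : Rpower t x < eps.
    { rewrite /Rpower -[X in _ < X]exp_ln; last apply cond_pos.
      apply exp_increasing.
      have L : ln t < ln eps / x by rewrite -(ln_exp (ln eps / x)); apply ln_increasing.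
      have := Rmult_lt_compat_l x _ _ Hx L.
      by have -> : x * (ln eps / x) = ln eps by field; lra. }
    nra. }
  have L1 : filterlim (fun t => - (Rpower t x * exp (- t))) (Rbar_locally p_infty) (locally 0).
  { have [K [K0 HK]] := Rpower_exp_bound x.
    apply filterlim_locally => eps.
    have He : 0 < eps / K by apply Rdiv_lt_0_compat => //; apply cond_pos.
    have [M HM] := proj1 (filterlim_locally (F := Rbar_locally p_infty) _ _) (filterlim_exp_minus (/ 2) ltac:(lra)) (mkposreal _ He).
    exists (Rmax M 1) => t Ht.
    have t1 : 1 < t by apply: Rle_lt_trans Ht; apply Rmax_r.
    have := HM t (Rle_lt_trans _ _ _ (Rmax_l _ _) Ht).
    rewrite /ball /= /AbsRing_ball /= /abs /minus /plus /opp /= Ropp_0 !Rplus_0_r Rabs_Ropp.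
    have P1 : 0 < Rpower t x by apply exp_pos.
    have P2 := exp_pos (- t).
    have P3 := exp_pos (- (/ 2 * t)).
    rewrite !Rabs_pos_eq; [|nra|lra] => Q.
    have B := HK t ltac:(lra).
    apply: (Rle_lt_trans _ (K * exp (- (/ 2 * t)))).
    - have -> : exp (- (/ 2 * t)) = exp (t / 2) * exp (- t) by rewrite -exp_plus; congr exp; field.
      have := Rmult_le_compat_r _ _ _ (Rlt_le _ _ P2) B; lra.
    - have := Rmult_lt_compat_l K _ _ K0 Q.
      by have -> : K * (eps / K) = eps by field; lra. }
  have H := is_RInt_gen_antiderivative (fun t => - (Rpower t x * exp (- t))) (fun t => gint (x + 1) t - x * gint x t) 0 0 D C L0 L1.
  pose proof (is_RInt_gen_scal (Fa := at_right 0) (Fb := Rbar_locally p_infty) _ x _ (Gamma_correct x Hx)) as G1.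
  pose proof (is_RInt_gen_plus (Fa := at_right 0) (Fb := Rbar_locally p_infty) _ _ _ _ H G1) as G.
  apply Gamma_unique.
  have E : plus (0 - 0) (scal x (Gamma x)) = x * Gamma x by rewrite /plus /scal /= /mult /=; ring.
  rewrite E in G; apply: is_RInt_gen_ext G.
  apply filter_prod_pos => a b _ _ t _; rewrite /plus /scal /= /mult /=; ring.
Qed.

Lemma Gamma_1 : Gamma 1 = 1.
Proof.
  apply Gamma_unique.
  have E : is_RInt_gen (gint 1) (at_right 0) (Rbar_locally p_infty) (0 - - (1)); last first.
  { have X : 0 - - (1) = 1 by ring. by rewrite X in E. }
  have D t : 0 < t -> is_derive (fun t => - exp (- t)) t (exp (- t)) by move=> _; auto_derive => //; ring.
  apply: (is_RInt_gen_ext (fun t => exp (- t))).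
  - apply filter_prod_pos => a b Ha Hb t /=; rewrite Rmin_left ?Rmax_right; try lra.
    move=> Ht; rewrite /gint.
    have -> : 1 - 1 = 0 by ring.
    rewrite Rpower_O; lra.
  - apply (is_RInt_gen_antiderivative (fun t => - exp (- t)) (fun t => exp (- t)) (- (1)) 0 D).
    + move=> t Ht; apply (ex_derive_continuous (V := R_NormedModule)); by auto_derive.
    + have C : continuous (fun t => - exp (- t)) 0 by apply (ex_derive_continuous (V := R_NormedModule)); auto_derive.
      rewrite /continuous Ropp_0 exp_0 in C.
      apply: filterlim_filter_le_1 C => P [d Hd]; exists d => y Hy _; by apply Hd.
    + rewrite -Ropp_0; apply: filterlim_comp; last apply: (filterlim_opp (V := R_NormedModule) 0).
      apply: filterlim_ext (filterlim_exp_minus 1 Rlt_0_1) => t; congr exp; ring.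
Qed.

Lemma Rpower_le_tangent alpha u : 0 < alpha <= 1 -> 0 < u -> Rpower u alpha <= 1 - alpha + alpha * u.
Proof.
  move=> Ha Hu.
  have E1 : Rpower 1 alpha = 1 by rewrite /Rpower ln_1 Rmult_0_r exp_0.
  have D t : 0 < t -> is_derive (fun t => alpha * t - Rpower t alpha) t (alpha * (1 - Rpower t (alpha - 1))).
  { move=> Ht.
    have H : is_derive (fun t => alpha * t) t alpha by auto_derive => //; ring.
    have Q := is_derive_minus _ _ _ _ _ H (is_derive_Rpower alpha t Ht).
    evar_last; first exact Q. rewrite /minus /plus /opp /=; ring. }
  have S t : 0 < t -> (1 <= t -> Rpower t (alpha - 1) <= 1) /\ (t <= 1 -> 1 <= Rpower t (alpha - 1)).
  { move=> Ht; split => H1.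
    - rewrite /Rpower -[X in _ <= X]exp_0; apply exp_le_mono.
      have : 0 <= ln t by rewrite -ln_1; apply ln_le; lra. nra.
    - rewrite /Rpower -[X in X <= _]exp_0; apply exp_le_mono.
      have : ln t <= 0 by rewrite -ln_1; apply ln_le; lra. nra. }
  case: (Rle_lt_dec 1 u) => H1.
  - have Q : alpha * 1 - Rpower 1 alpha <= alpha * u - Rpower u alpha.
    { apply (derive_nonneg_le (fun t => alpha * t - Rpower t alpha) (fun t => alpha * (1 - Rpower t (alpha - 1)))) => // t Ht.
      - apply D; lra.
      - have [A _] := S t ltac:(lra); have := A ltac:(lra) => B; apply Rmult_le_pos; lra. }
    rewrite E1 in Q; lra.
  - have Q : - (alpha * u - Rpower u alpha) <= - (alpha * 1 - Rpower 1 alpha).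
    { apply (derive_nonneg_le (fun t => - (alpha * t - Rpower t alpha)) (fun t => - (alpha * (1 - Rpower t (alpha - 1))))) => [|t Ht|t Ht].
      - lra.
      - apply: is_derive_opp; apply D; lra.
      - have [_ A] := S t ltac:(lra); have := A ltac:(lra) => B; nra. }
    rewrite E1 in Q; lra.
Qed.

(* [t^alpha] lies below its tangent line at [c]. *)
Lemma Gamma_tangent x alpha c : 0 < x -> 0 < c -> 0 < alpha <= 1 ->
  Gamma (x + alpha) <= Rpower c alpha * ((1 - alpha) * Gamma x + alpha / c * Gamma (x + 1)).
Proof.
  move=> Hx Hc Ha.
  have P : 0 < Rpower c alpha by apply exp_pos.
  pose proof (is_RInt_gen_scal (Fa := at_right 0) (Fb := Rbar_locally p_infty) _ (Rpower c alpha * (1 - alpha)) _ (Gamma_correct x Hx)) as H1.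
  pose proof (is_RInt_gen_scal (Fa := at_right 0) (Fb := Rbar_locally p_infty) _ (Rpower c alpha * (alpha / c)) _ (Gamma_correct (x + 1) ltac:(lra))) as H2.
  pose proof (is_RInt_gen_plus (Fa := at_right 0) (Fb := Rbar_locally p_infty) _ _ _ _ H1 H2) as H.
  pose proof (fun h1 h2 => RInt_gen_norm (V := R_CompleteNormedModule) (Fa := at_right 0) (Fb := Rbar_locally p_infty) _ _ _ _ h1 h2 (Gamma_correct (x + alpha) ltac:(lra)) H) as Q.
  have {}Q : norm (Gamma (x + alpha)) <= plus (scal (Rpower c alpha * (1 - alpha)) (Gamma x)) (scal (Rpower c alpha * (alpha / c)) (Gamma (x + 1))).
  { apply Q.
    - apply filter_prod_pos => a b Hab Hb /=; lra.
    - apply filter_prod_pos => a b Hab Hb t /= Ht.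
      rewrite /norm /= /abs /= Rabs_pos_eq; last by apply Rlt_le, gint_pos.
      rewrite /plus /scal /= /mult /= /gint.
      have E0 : Rpower t (x + alpha - 1) = Rpower t (x - 1) * Rpower t alpha.
      { rewrite -Rpower_plus; congr Rpower; ring. }
      have E1 : Rpower t (x + 1 - 1) = Rpower t (x - 1) * t.
      { transitivity (Rpower t (x - 1) * Rpower t 1); last by rewrite Rpower_1; lra.
        rewrite -Rpower_plus; congr Rpower; ring. }
      rewrite E0 E1.
      have T : Rpower t alpha <= Rpower c alpha * (1 - alpha + alpha / c * t).
      { have u0 : 0 < t / c by apply Rdiv_lt_0_compat; lra.
        have -> : Rpower t alpha = Rpower c alpha * Rpower (t / c) alpha.
        { rewrite Rpower_mult_distr //; f_equal; field; lra. }
        apply Rmult_le_compat_l; first lra.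
        have -> : alpha / c * t = alpha * (t / c) by field; lra.
        move: (t / c) u0 => u u0.
        by apply Rpower_le_tangent. }
      have R1 : 0 < Rpower t (x - 1) by apply exp_pos.
      have R2 := exp_pos (- t).
      have := Rmult_le_compat_l (Rpower t (x - 1) * exp (- t)) _ _ ltac:(nra) T. lra. }
  have Gp := Gamma_pos (x + alpha) ltac:(lra).
  rewrite /norm /= /abs /= Rabs_pos_eq in Q; last lra.
  apply: Rle_trans Q _; rewrite /plus /scal /= /mult /=; lra.
Qed.

(** * The logarithm of the gamma function *)

Definition lnG (x : R) : R := ln (Gamma x).

Lemma lnG_S x : 0 < x -> lnG (x + 1) = lnG x + ln x.
Proof. move=> H; rewrite /lnG Gamma_S // ln_mult //; [ring | by apply Gamma_pos]. Qed.

Lemma lnG_shift a n : 0 < a -> lnG (INR n + a) = lnG a + rsum (fun k => ln (a + INR k)) n.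
Proof.
  move=> Ha; elim: n => [|n IH]; first by rewrite /= Rplus_0_l Rplus_0_r.
  have n0 := pos_INR n.
  rewrite S_INR.
  have -> : INR n + 1 + a = (INR n + a) + 1 by ring.
  rewrite lnG_S; last lra.
  rewrite IH /= (Rplus_comm (INR n) a); ring.
Qed.

Lemma ln_1p_bounds y : -1 < y -> y / (1 + y) <= ln (1 + y) <= y.
Proof.
  move=> Hy; split.
  - have := exp_ineq1_le (ln (/ (1 + y))).
    rewrite exp_ln; last by apply Rinv_0_lt_compat; lra.
    rewrite ln_Rinv; last lra.
    have -> : y / (1 + y) = 1 - / (1 + y) by field; lra. lra.
  - have := exp_ineq1_le (ln (1 + y)); rewrite exp_ln; lra.
Qed.

Lemma ln_add n a : 0 < n -> 0 < n + a -> ln (n + a) = ln n + ln (1 + a / n).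
Proof.
  move=> Hn Hna.
  have P : 0 < 1 + a / n.
  { have -> : 1 + a / n = (n + a) / n by field; lra. by apply Rdiv_lt_0_compat. }
  rewrite -ln_mult //; congr ln; field; lra.
Qed.

Lemma is_lim_seq_div_INR a : is_lim_seq (fun n => a / INR n) 0.
Proof.
  have -> : Finite 0 = Rbar_mult a 0 by rewrite /= Rmult_0_r.
  apply is_lim_seq_scal_l, (is_lim_seq_inv _ p_infty) => //; apply is_lim_seq_INR.
Qed.

Lemma is_lim_seq_ln_ratio a : 0 < a -> is_lim_seq (fun n => ln (INR n + a) - ln (INR n)) 0.
Proof.
  move=> Ha; apply (is_lim_seq_le_le_loc (fun _ => 0) _ (fun n => a / INR n)).
  - exists 1%nat => n Hn.
    have n0 : 0 < INR n by apply lt_0_INR; lia.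
    rewrite ln_add; try lra.
    have q : 0 < a / INR n by apply Rdiv_lt_0_compat.
    have [A B] := ln_1p_bounds (a / INR n) ltac:(lra).
    have : 0 < a / INR n / (1 + a / INR n) by apply Rdiv_lt_0_compat; lra.
    lra.
  - apply is_lim_seq_const.
  - apply is_lim_seq_div_INR.
Qed.

(** The Bohr-Mollerup squeeze. The upper bound is [Gamma_tangent] with tangent at the base point
    itself; applied from [x + alpha] with exponent [1 - alpha] it gives the lower bound, since
    [lnG (x + 1)] is known. *)
Lemma lnG_ratio_bounds x alpha : 0 < x -> 0 < alpha <= 1 ->
  - ((1 - alpha) * (ln (x + alpha) - ln x)) <= lnG (x + alpha) - lnG x - alpha * ln x <= 0.
Proof.
  move=> Hx Ha.
  have up y al : 0 < y -> 0 < al <= 1 -> lnG (y + al) <= lnG y + al * ln y.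
  { move=> Hy Hal; have G := Gamma_tangent y al y Hy Hy Hal.
    have Gp := Gamma_pos y Hy.
    rewrite Gamma_S // in G.
    have E : Rpower y al * ((1 - al) * Gamma y + al / y * (y * Gamma y)) = Gamma y * Rpower y al by field; lra.
    rewrite E in G.
    have P : 0 < Rpower y al by apply exp_pos.
    have := ln_le _ _ (Gamma_pos (y + al) ltac:(lra)) G.
    rewrite ln_mult // /Rpower ln_exp /lnG; lra. }
  split; last by have := up x alpha Hx Ha; lra.
  case: (Req_dec alpha 1) => [->|Hne].
  { rewrite lnG_S //; lra. }
  have := up (x + alpha) (1 - alpha) ltac:(lra) ltac:(lra).
  have -> : x + alpha + (1 - alpha) = x + 1 by ring.
  rewrite lnG_S //; lra.
Qed.

(** Exponents in [(0, 1]] come from the squeeze; each further unit step adds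
    [ln (n + a - 1) - ln n], which tends to [0]. *)
Lemma lnG_asymptotic a : 0 < a ->
  is_lim_seq (fun n => lnG (INR n + a) - lnG (INR n) - a * ln (INR n)) 0.
Proof.
  have base alpha : 0 < alpha <= 1 -> is_lim_seq (fun n => lnG (INR n + alpha) - lnG (INR n) - alpha * ln (INR n)) 0.
  { move=> Ha; apply (is_lim_seq_le_le_loc (fun n => - ((1 - alpha) * (ln (INR n + alpha) - ln (INR n)))) _ (fun _ => 0)).
    - exists 1%nat => n Hn; apply lnG_ratio_bounds => //; apply lt_0_INR; lia.
    - have -> : Finite 0 = Rbar_opp (Rbar_mult (1 - alpha) 0) by rewrite /= Rmult_0_r Ropp_0.
      apply (is_lim_seq_opp (fun n => (1 - alpha) * (ln (INR n + alpha) - ln (INR n)))).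
      apply is_lim_seq_scal_l, is_lim_seq_ln_ratio; lra.
    - apply is_lim_seq_const. }
  have gen m : forall a, 0 < a <= INR m + 1 -> is_lim_seq (fun n => lnG (INR n + a) - lnG (INR n) - a * ln (INR n)) 0.
  { elim: m => [|m IH] {}a; first by rewrite /= Rplus_0_l; apply base.
    rewrite S_INR => Ha.
    case: (Rle_lt_dec a 1) => H1; first by apply base; lra.
    have L1 := IH (a - 1) ltac:(lra).
    have L := is_lim_seq_plus' _ _ _ _ L1 (is_lim_seq_ln_ratio (a - 1) ltac:(lra)).
    rewrite Rplus_0_r in L.
    apply: is_lim_seq_ext_loc L; exists 1%nat => n Hn.
    have n0 : 0 < INR n by apply lt_0_INR; lia.
    have -> : lnG (INR n + a) = lnG (INR n + (a - 1)) + ln (INR n + (a - 1)).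
    { rewrite -lnG_S; last lra. congr lnG; ring. }
    ring. }
  move=> Ha.
  have [m Hm] : exists m, a <= INR m.
  { exists (Z.to_nat (up a)). have [A _] := archimed a.
    have U : (0 <= up a)%Z by apply le_IZR; lra.
    rewrite INR_IZR_INZ Z2Nat.id //; lra. }
  apply (gen m); lra.
Qed.

(** Gauss's limit formula with [lnG n] in place of the factorial. This term drops out of differences
    between two values of [a], so Stirling's formula is never called for. *)
Lemma lnG_Gauss a : 0 < a ->
  is_lim_seq (fun n => lnG (INR n) + a * ln (INR n) - rsum (fun k => ln (a + INR k)) n) (lnG a).
Proof.
  move=> Ha; have L := is_lim_seq_minus' _ _ _ _ (is_lim_seq_const (lnG a)) (lnG_asymptotic a Ha).
  rewrite Rminus_0_r in L; apply: is_lim_seq_ext L => n.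
  rewrite lnG_shift //; ring.
Qed.

Lemma rsum_minus u v n : rsum (fun k => u k - v k) n = rsum u n - rsum v n.
Proof. elim: n => [|n IH] /=; [ring | rewrite IH; ring]. Qed.

Lemma lnG_difference a x : 0 < a -> 0 < a + x ->
  is_lim_seq (fun n => x * ln (INR n) - rsum (fun k => ln (1 + x / (a + INR k))) n) (lnG (a + x) - lnG a).
Proof.
  move=> Ha Hx.
  have L := is_lim_seq_minus' _ _ _ _ (lnG_Gauss (a + x) Hx) (lnG_Gauss a Ha).
  apply: is_lim_seq_ext L => n.
  have -> : rsum (fun k => ln (a + x + INR k)) n = rsum (fun k => ln (a + INR k) + ln (1 + x / (a + INR k))) n.
  { apply rsum_ext => k; have k0 := pos_INR k.
    rewrite -ln_add; try lra. congr ln; ring. }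
  rewrite rsum_plus; ring.
Qed.

Lemma ln_1p_quadratic y : -1 / 2 <= y -> 0 <= y - ln (1 + y) <= 2 * y ^ 2.
Proof.
  move=> Hy; have [A B] := ln_1p_bounds y ltac:(lra); split; first lra.
  have : y - y / (1 + y) <= 2 * y ^ 2.
  { have -> : y - y / (1 + y) = y ^ 2 * / (1 + y) by field; lra.
    rewrite (Rmult_comm 2); apply Rmult_le_compat_l; first by apply pow2_ge_0.
    have -> : 2 = / (/ 2) by field.
    apply Rinv_le_contravar; lra. }
  lra.
Qed.

Lemma inv_sq_sum_bound a : 0 < a -> rbdd (fun k => (/ (a + INR k)) ^ 2) (2 / (lowfac a) ^ 2).
Proof.
  move=> Ha; have p := lowfac_pos a Ha.
  have p2 : 0 < (lowfac a) ^ 2 by apply pow_lt.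
  have ip : 0 <= / (lowfac a) ^ 2 by apply Rlt_le, Rinv_0_lt_compat.
  have -> : 2 / lowfac a ^ 2 = / (lowfac a) ^ 2 * 2 by field; lra.
  apply: rbdd_le (rbdd_scal _ _ _ ip rbdd_inv_sq) => k.
  have k0 := pos_INR k.
  rewrite rp_neg2; last lra.
  rewrite -Rinv_mult -Rpow_mult_distr -pow_inv.
  have := lowfac_le 1 a k Ha Rlt_0_1; rewrite !Rmult_1_l => Q.
  apply pow_incr; split; first by apply Rlt_le, Rinv_0_lt_compat; lra.
  apply Rinv_le_contravar => //; nra.
Qed.

Lemma rsum_lim u M : (forall k, 0 <= u k) -> rbdd u M -> exists l : R, is_lim_seq (rsum u) l /\ 0 <= l <= M.
Proof.
  move=> H0 HM.
  have [l Hl] : ex_finite_lim_seq (rsum u).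
  { apply (ex_finite_lim_seq_incr _ M) => // n; rewrite /=; have := H0 n; lra. }
  exists l; split => //; split.
  - apply (is_lim_seq_le (fun _ => 0) (rsum u) 0 l) => //; last apply is_lim_seq_const.
    by move=> n; apply rsum_nonneg.
  - by apply (is_lim_seq_le (rsum u) (fun _ => M) l M) => //; apply is_lim_seq_const.
Qed.

(** * The digamma function *)

Definition psi_seq (a : R) (n : nat) : R := ln (INR n) - rsum (fun k => / (a + INR k)) n.

(** The terms [1 / (a + k) - ln (1 + 1 / (a + k))] are nonnegative and bounded by twice the inverse
    square of [a + k]; [lnG_difference] with [x = 1] supplies the sum of the logarithms. *)
Lemma psi_seq_converges a : 0 < a -> exists psi : R, is_lim_seq (psi_seq a) psi.
Proof.
  move=> Ha.
  pose u k := / (a + INR k) - ln (1 + 1 / (a + INR k)).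
  have ak k : 0 < / (a + INR k) by apply Rinv_0_lt_compat; have := pos_INR k; lra.
  have Hu k : 0 <= u k <= 2 * (/ (a + INR k)) ^ 2.
  { rewrite /u; have -> : 1 / (a + INR k) = / (a + INR k) by rewrite /Rdiv Rmult_1_l.
    apply ln_1p_quadratic; have := ak k; lra. }
  have [l [Hl _]] := rsum_lim u _ (fun k => proj1 (Hu k))
    (rbdd_le _ _ _ (fun k => proj2 (Hu k)) (rbdd_scal 2 _ _ ltac:(lra) (inv_sq_sum_bound a Ha))).
  have D := lnG_difference a 1 Ha ltac:(lra).
  exists (lnG (a + 1) - lnG a - l).
  have L := is_lim_seq_minus' _ _ _ _ D Hl.
  apply: is_lim_seq_ext L => n.
  rewrite /psi_seq /u rsum_minus; ring.
Qed.

(** The logarithm of the Weierstrass product based at [a]. It serves twice: for small [x] it gives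
    the derivative of [lnG], and for [a = 1], [x = - 1 / tau] the expansion in [1 / tau]. *)
Lemma lnG_remainder_lim (a x psi : R) : 0 < a -> 0 < a + x -> is_lim_seq (psi_seq a) psi ->
  is_lim_seq (rsum (fun k => x / (a + INR k) - ln (1 + x / (a + INR k)))) (lnG (a + x) - lnG a - x * psi).
Proof.
  move=> Ha Hx Hp.
  have D := lnG_difference a x Ha Hx.
  have P : is_lim_seq (fun n => x * psi_seq a n) (x * psi) by apply (is_lim_seq_scal_l _ x psi).
  have L := is_lim_seq_minus' _ _ _ _ D P.
  apply: is_lim_seq_ext L => n.
  rewrite /psi_seq rsum_minus (rsum_ext (fun k => x / (a + INR k)) (fun k => x * / (a + INR k))) //.
  rewrite rsum_scal; ring.
Qed.

Lemma is_derive_quadratic (f : R -> R) a d K delta : 0 < delta ->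
  (forall x, Rabs x < delta -> Rabs (f (a + x) - f a - x * d) <= K * x ^ 2) -> is_derive f a d.
Proof.
  move=> Hd H; apply is_derive_Reals => eps He.
  have K0 : 0 < Rabs K + 1 by have := Rabs_pos K; lra.
  have P : 0 < Rmin delta (eps / (Rabs K + 1)) by apply Rmin_glb_lt => //; apply Rdiv_lt_0_compat.
  exists (mkposreal _ P) => h Hh /= Hlt.
  have h1 : Rabs h < delta by apply: Rlt_le_trans Hlt (Rmin_l _ _).
  have h2 : Rabs h < eps / (Rabs K + 1) by apply: Rlt_le_trans Hlt (Rmin_r _ _).
  have Q := H h h1.
  have hp : 0 < Rabs h by apply Rabs_pos_lt.
  have -> : (f (a + h) - f a) / h - d = (f (a + h) - f a - h * d) / h by field.
  rewrite Rabs_div //.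
  apply (Rmult_lt_reg_r (Rabs h)) => //.
  have -> : forall y, y / Rabs h * Rabs h = y by move=> y; field; lra.
  apply: Rle_lt_trans Q _.
  have -> : h ^ 2 = Rabs h * Rabs h by rewrite -Rabs_mult Rabs_pos_eq; [ring | nra].
  have := Rmult_lt_compat_r (Rabs K + 1) _ _ K0 h2.
  have -> : eps / (Rabs K + 1) * (Rabs K + 1) = eps by field; lra.
  have := Rle_abs K; nra.
Qed.

(** The remainder series is [O(x^2)], so [lnG] is differentiable with derivative the limit of
    [psi_seq]; no differentiation under the integral sign occurs. *)
Lemma digamma_lim a : 0 < a -> is_lim_seq (psi_seq a) (digamma a).
Proof.
  move=> Ha; have [psi Hp] := psi_seq_converges a Ha.
  suff -> : digamma a = psi by [].
  have ak k : 0 < / (a + INR k) by apply Rinv_0_lt_compat; have := pos_INR k; lra.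
  have ak2 k : / (a + INR k) <= / a by apply Rinv_le_contravar => //; have := pos_INR k; lra.
  have D : is_derive lnG a psi.
  { apply (is_derive_quadratic _ _ _ (2 * (2 / (lowfac a) ^ 2)) (a / 2)); first lra.
    move=> x Hx.
    have xb := Rabs_def2 _ _ Hx.
    have y1 k : -1 / 2 <= x / (a + INR k).
    { have : Rabs (x / (a + INR k)) <= / 2.
      { rewrite /Rdiv Rabs_mult (Rabs_pos_eq (/ _)); last by apply Rlt_le.
        apply: (Rle_trans _ (a / 2 * / a)); last by right; field; lra.
        apply Rmult_le_compat; [apply Rabs_pos | by apply Rlt_le | lra | done]. }
      have := Rle_abs (- (x / (a + INR k))); rewrite Rabs_Ropp; lra. }
    have L := lnG_remainder_lim a x psi Ha ltac:(lra) Hp.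
    have B := rbdd_scal (2 * x ^ 2) _ _ ltac:(have := pow2_ge_0 x; lra) (inv_sq_sum_bound a Ha).
    have Q k : 0 <= x / (a + INR k) - ln (1 + x / (a + INR k)) <= 2 * x ^ 2 * (/ (a + INR k)) ^ 2.
    { have [q1 q2] := ln_1p_quadratic _ (y1 k); split => //.
      apply: Rle_trans q2 _; rewrite /Rdiv Rpow_mult_distr; lra. }
    have [l [Hl [l0 l1]]] := rsum_lim _ _ (fun k => proj1 (Q k)) (rbdd_le _ _ _ (fun k => proj2 (Q k)) B).
    have E : lnG (a + x) - lnG a - x * psi = l.
    { have := is_lim_seq_unique _ _ L; have := is_lim_seq_unique _ _ Hl => -> [->] //. }
    rewrite E Rabs_pos_eq //; lra. }
  have G : is_derive Gamma a (psi * Gamma a).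
  { apply (is_derive_ext_loc (fun y => exp (lnG y))).
    - exists (mkposreal _ Ha) => y /= Hy; rewrite /lnG exp_ln //; apply Gamma_pos.
      move: (Rabs_def2 _ _ Hy); rewrite /minus /plus /opp /=; lra.
    - have := is_derive_comp exp lnG a _ _ (is_derive_exp _) D => Q.
      evar_last; first exact Q.
      rewrite /scal /= /mult /= /lnG exp_ln //; by apply Gamma_pos. }
  rewrite /digamma (is_derive_unique _ _ _ G); field.
  have := Gamma_pos a Ha; lra.
Qed.

(** * Expansion of [lnG (1 - 1 / tau)] *)

(** The derivative of the remainder is [t^P / (1 - t)], which lies between [0] and [2 t^P] on the
    interval; both bounds follow by monotonicity. *)
Lemma ln_1m_expansion P y : 0 <= y <= / 2 ->
  0 <= - ln (1 - y) - rsum (fun p => y ^ S p / INR (S p)) P <= 2 * y ^ S P.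
Proof.
  move=> Hy.
  pose h t := - ln (1 - t) - rsum (fun p => t ^ S p / INR (S p)) P.
  have geo t : t <> 1 -> rsum (fun p => t ^ p) P = (1 - t ^ P) / (1 - t).
  { move=> Ht; elim: P {h} => [|P IH] /=; first by field; lra.
    rewrite IH; field; lra. }
  have D t : 0 <= t <= / 2 -> is_derive h t (t ^ P / (1 - t)).
  { move=> Ht.
    have D1 : is_derive (fun t => - ln (1 - t)) t (/ (1 - t)) by auto_derive; [lra | field; lra].
    have D2 : is_derive (fun t => rsum (fun p => t ^ S p / INR (S p)) P) t (rsum (fun p => t ^ p) P).
    { elim: P {h geo} => [|P IH]; first exact (is_derive_const (K := R_AbsRing) (V := R_NormedModule) _ t).
      have N : INR (S P) <> 0 by apply not_0_INR; lia.
      have T : is_derive (fun t => t ^ S P / INR (S P)) t (t ^ P).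
      { have Q := is_derive_scal (fun u => u ^ S P) t (/ INR (S P)) _ (is_derive_pow (fun u => u) (S P) t 1 (is_derive_id (K := R_AbsRing) t)).
        apply: (is_derive_ext (fun u => / INR (S P) * u ^ S P)).
        - move=> u; apply Rmult_comm.
        - evar_last; first exact Q.
          rewrite [Init.Nat.pred _]/=; move: (INR (S P)) N => c N; field; exact N. }
      exact (is_derive_plus _ _ _ _ _ IH T). }
    have D3 := is_derive_minus _ _ _ _ _ D1 D2.
    evar_last; first exact D3.
    rewrite geo; last lra.
    rewrite /minus /plus /opp /=; field; lra. }
  have h0 : h 0 = 0.
  { rewrite /h Rminus_0_r ln_1.
    have -> : rsum (fun p => 0 ^ S p / INR (S p)) P = 0.
    { elim: P {h D geo} => [|P IH] //.
      change (rsum (fun p => 0 ^ S p / INR (S p)) P + 0 ^ S P / INR (S P) = 0).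
      rewrite IH -tech_pow_Rmult /Rdiv; ring. }
    ring. }
  have tP t n : 0 <= t -> 0 <= t ^ n by move=> Ht; apply pow_le.
  split.
  - rewrite -/(h y) -h0; apply (derive_nonneg_le h (fun t => t ^ P / (1 - t))); first lra.
    + move=> t Ht; apply D; lra.
    + move=> t Ht; apply Rdiv_le_0_compat; [apply tP|]; lra.
  - rewrite -/(h y).
    have N : INR (S P) <> 0 by apply not_0_INR; lia.
    have N1 : 1 <= INR (S P) by rewrite S_INR; have := pos_INR P; lra.
    have D4 t : is_derive (fun t => 2 * / INR (S P) * t ^ S P) t (2 * t ^ P).
    { have Q := is_derive_scal (fun u => u ^ S P) t (2 * / INR (S P)) _ (is_derive_pow (fun u => u) (S P) t 1 (is_derive_id (K := R_AbsRing) t)).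
      evar_last; first exact Q.
      rewrite [Init.Nat.pred _]/=; move: (INR (S P)) N => c N; field; exact N. }
    have Q : 2 * / INR (S P) * 0 ^ S P - h 0 <= 2 * / INR (S P) * y ^ S P - h y.
    { apply (derive_nonneg_le (fun t => 2 * / INR (S P) * t ^ S P - h t) (fun t => 2 * t ^ P - t ^ P / (1 - t))); first lra.
      - move=> t Ht; exact (is_derive_minus _ _ _ _ _ (D4 t) (D t ltac:(lra))).
      - move=> t Ht.
        have : / (1 - t) <= 2.
        { have -> : 2 = / (/ 2) by field. apply Rinv_le_contravar; lra. }
        have := tP t P ltac:(lra); rewrite /Rdiv; nra. }
    rewrite h0 -(tech_pow_Rmult 0) in Q.
    have yp := tP y (S P) ltac:(lra).
    have : / INR (S P) * y ^ S P <= 1 * y ^ S P.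
    { apply Rmult_le_compat_r => //; rewrite -Rinv_1; apply Rinv_le_contravar; lra. }
    lra.
Qed.

Lemma zeta_rsum p : (2 <= p)%nat -> is_lim_seq (rsum (fun k => (/ (1 + INR k)) ^ p)) (zeta p).
Proof.
  move=> Hp.
  have k0 k : 0 < / (1 + INR k) <= 1.
  { have := pos_INR k => H; split; first by apply Rinv_0_lt_compat; lra.
    rewrite -[X in _ <= X]Rinv_1; apply Rinv_le_contravar; lra. }
  have B k : (/ (1 + INR k)) ^ p <= (/ (1 + INR k)) ^ 2.
  { have -> : p = (2 + (p - 2))%nat by lia.
    rewrite pow_add -[X in _ <= X]Rmult_1_r; apply Rmult_le_compat_l.
    - apply pow_le; have := k0 k; lra.
    - rewrite -[X in _ <= X](pow1 (p - 2)); apply pow_incr; have := k0 k; lra. }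
  have [l [Hl _]] := rsum_lim (fun k => (/ (1 + INR k)) ^ p) _ (fun k => pow_le _ _ (Rlt_le _ _ (proj1 (k0 k))))
    (rbdd_le _ _ _ B (inv_sq_sum_bound 1 Rlt_0_1)).
  suff -> : zeta p = l by [].
  rewrite /zeta /hurwitz_zeta; have -> : Nat.eqb p 1 = false by apply Nat.eqb_neq; lia.
  apply is_series_unique.
  apply (is_lim_seq_ext (fun n => rsum (fun k => (/ (1 + INR k)) ^ p) (S n)) (sum_n (fun k => / (INR k + 1) ^ p)) l).
  - move=> n; rewrite sum_n_rsum; apply rsum_ext => k; by rewrite -pow_inv Rplus_comm.
  - by apply (is_lim_seq_incr_1 (rsum _)).
Qed.

(** The logarithms in the Weierstrass product are expanded to order [P], and the sum over [k] is
    exchanged with the finite sum over the order. The linear term is [- digamma 1 / tau], in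
    agreement with the convention for [zeta 1]. *)
Lemma lnG_1m_expansion P : (1 <= P)%nat -> exists K, 0 <= K /\ forall tau, 2 <= tau ->
  Rabs (lnG (1 - 1 / tau) - rsum (fun p => zeta (S p) / (INR (S p) * tau ^ S p)) P) <= K / tau ^ S P.
Proof.
  move=> HP; exists (2 * (2 / (lowfac 1) ^ 2)).
  have lp : 0 < lowfac 1 ^ 2 by apply pow_lt, lowfac_pos; lra.
  split; first by apply Rmult_le_pos; [lra | apply Rdiv_le_0_compat; lra].
  move=> tau Ht.
  have ti : 0 < / tau <= / 2.
  { split; [apply Rinv_0_lt_compat; lra | apply Rinv_le_contravar; lra]. }
  pose c k := / (1 + INR k).
  have c01 k : 0 < c k <= 1.
  { have := pos_INR k => H; split; first by apply Rinv_0_lt_compat; lra.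
    rewrite -[X in _ <= X]Rinv_1; apply Rinv_le_contravar; lra. }
  pose y k := c k * / tau.
  have y01 k : 0 <= y k <= / 2 by rewrite /y; have := c01 k; nra.
  have L := lnG_remainder_lim 1 (- / tau) (digamma 1) Rlt_0_1 ltac:(lra) (digamma_lim 1 Rlt_0_1).
  have l1 : lnG 1 = 0 by rewrite /lnG Gamma_1 ln_1.
  rewrite l1 in L.
  have {}L : is_lim_seq (rsum (fun k => - y k - ln (1 - y k))) (lnG (1 - 1 / tau) + / tau * digamma 1).
  { have -> : lnG (1 - 1 / tau) + / tau * digamma 1 = lnG (1 + - / tau) - 0 - - / tau * digamma 1.
    { have -> : 1 - 1 / tau = 1 + - / tau by rewrite /Rdiv; ring. ring. }
    apply: is_lim_seq_ext L => n; apply rsum_ext => k.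
    have -> : - / tau / (1 + INR k) = - y k by rewrite /y /c /Rdiv; ring.
    by rewrite /Rminus. }
  destruct P as [|P]; first lia.
  have M : is_lim_seq (rsum (fun k => rsum (fun p => y k ^ S (S p) / INR (S (S p))) P))
     (rsum (fun p => zeta (S (S p)) / (INR (S (S p)) * tau ^ S (S p))) P).
  { apply (is_lim_seq_ext (fun n => rsum (fun p => rsum (fun k => y k ^ S (S p) / INR (S (S p))) n) P)).
    { move=> n; by rewrite rsum_swap. }
    elim: P {HP} => [|P IH]; first exact: is_lim_seq_const.
    apply: (is_lim_seq_plus' _ _ _ _ IH).
    have N : INR (S (S P)) <> 0 by apply not_0_INR; lia.
    have tp : tau ^ S (S P) <> 0 by apply pow_nonzero; lra.
    have Z := is_lim_seq_scal_l _ (/ (INR (S (S P)) * tau ^ S (S P))) _ (zeta_rsum (S (S P)) ltac:(lia)).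
    have -> : Finite (zeta (S (S P)) / (INR (S (S P)) * tau ^ S (S P))) = Rbar_mult (/ (INR (S (S P)) * tau ^ S (S P))) (zeta (S (S P))).
    { rewrite /=; congr Finite; rewrite /Rdiv; ring. }
    apply: is_lim_seq_ext Z => n; rewrite -rsum_scal; apply rsum_ext => k.
    rewrite /y /c Rpow_mult_distr (pow_inv tau).
    move: (INR (S (S P))) (tau ^ S (S P)) N tp => u v N tp; field; by split. }
  have D := is_lim_seq_minus' _ _ _ _ L M.
  have Q k : 0 <= (- y k - ln (1 - y k)) - rsum (fun p => y k ^ S (S p) / INR (S (S p))) P <= 2 * / tau ^ S (S P) * (/ (1 + INR k)) ^ 2.
  { have [q1 q2] := ln_1m_expansion (S P) (y k) (y01 k).
    have E : rsum (fun p => y k ^ S p / INR (S p)) (S P) = y k + rsum (fun p => y k ^ S (S p) / INR (S (S p))) P.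
    { rewrite (rsum_shift _ 1 P) /=; congr Rplus. field. }
    rewrite E in q1 q2.
    split; first lra.
    have : 2 * y k ^ S (S P) <= 2 * / tau ^ S (S P) * (/ (1 + INR k)) ^ 2.
    { rewrite /y Rpow_mult_distr pow_inv -/(c k).
      have tp : 0 < / tau ^ S (S P) by apply Rinv_0_lt_compat, pow_lt; lra.
      have : c k ^ S (S P) <= c k ^ 2.
      { have -> : S (S P) = (2 + P)%nat by lia.
        rewrite pow_add -[X in _ <= X]Rmult_1_r; apply Rmult_le_compat_l.
        - apply pow_le; have := c01 k; lra.
        - rewrite -[X in _ <= X](pow1 P); apply pow_incr; have := c01 k; lra. }
      nra. }
    lra. }
  have tp : 0 < / tau ^ S (S P) by apply Rinv_0_lt_compat, pow_lt; lra.
  have B := rbdd_scal (2 * / tau ^ S (S P)) _ _ ltac:(lra) (inv_sq_sum_bound 1 Rlt_0_1).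
  have [l [Hl [h0 h1]]] := rsum_lim _ _ (fun k => proj1 (Q k)) (rbdd_le _ _ _ (fun k => proj2 (Q k)) B).
  have E : lnG (1 - 1 / tau) + / tau * digamma 1 - rsum (fun p => zeta (S (S p)) / (INR (S (S p)) * tau ^ S (S p))) P = l.
  { have {}Hl : is_lim_seq (fun n => rsum (fun k => - y k - ln (1 - y k)) n - rsum (fun k => rsum (fun p => y k ^ S (S p) / INR (S (S p))) P) n) l.
    { apply: is_lim_seq_ext Hl => n; by rewrite rsum_minus. }
    have := is_lim_seq_unique _ _ D; have := is_lim_seq_unique _ _ Hl => -> [->] //. }
  have E2 : rsum (fun p => zeta (S p) / (INR (S p) * tau ^ S p)) (S P) = - (/ tau * digamma 1) +
     rsum (fun p => zeta (S (S p)) / (INR (S (S p)) * tau ^ S (S p))) P.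
  { rewrite (rsum_shift _ 1 P) /=; congr Rplus.
    rewrite /zeta /hurwitz_zeta /=; field; lra. }
  rewrite E2.
  have -> : lnG (1 - 1 / tau) - (- (/ tau * digamma 1) + rsum (fun p => zeta (S (S p)) / (INR (S (S p)) * tau ^ S (S p))) P) = l by lra.
  rewrite Rabs_pos_eq //; rewrite /Rdiv in h1 *; lra.
Qed.

(** * First-order jets *)

(** The first two Taylor coefficients: rules for [C_derive] are proved on coefficient sequences,
    with no limits. *)
Definition Jet (s0 : C) (f : C -> C) (v d : C) : Prop :=
  exists r M a, ps s0 r M a f /\ a 0%nat = v /\ a 1%nat = d.

Lemma Jet_derive s0 f v d : Jet s0 f v d -> C_derive f s0 = d.
Proof. move=> [r [M [a [H [_ <-]]]]]; by apply: ps_derive H. Qed.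

Lemma Jet_psa s0 r f : psa s0 r f -> Jet s0 f (f s0) (C_derive f s0).
Proof.
  move=> [M [a H]]; exists r, M, a; split => //.
  by rewrite (ps_value _ _ _ _ _ H) (ps_derive _ _ _ _ _ H).
Qed.

Lemma Jet_eq s0 f v d v' d' : Jet s0 f v d -> v = v' -> d = d' -> Jet s0 f v' d'.
Proof. by move=> H <- <-. Qed.

Lemma Jet_common s0 f g v d v' d' : Jet s0 f v d -> Jet s0 g v' d' ->
  exists r M M' a b, ps s0 r M a f /\ ps s0 r M' b g /\
   a 0%nat = v /\ a 1%nat = d /\ b 0%nat = v' /\ b 1%nat = d'.
Proof.
  move=> [r [M [a [H [Ha0 Ha1]]]]] [r' [M' [b [H' [Hb0 Hb1]]]]].
  have P : 0 < Rmin r r' by apply Rmin_glb_lt; [apply (proj1 H) | apply (proj1 H')].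
  exists (Rmin r r'), M, M', a, b; split; last split => //.
  - apply: ps_shrink H; split => //; apply Rmin_l.
  - apply: ps_shrink H'; split => //; apply Rmin_r.
Qed.

Lemma Jet_plus s0 f g v d v' d' : Jet s0 f v d -> Jet s0 g v' d' ->
  Jet s0 (fun s => f s + g s)%C (v + v')%C (d + d')%C.
Proof.
  move=> H H'; have [r [M [M' [a [b [A [B [<- [<- [<- <-]]]]]]]]]] := Jet_common _ _ _ _ _ _ _ H H'.
  do 3 eexists; split; [by apply: ps_plus A B | done].
Qed.

Lemma Jet_mult s0 f g v d v' d' : Jet s0 f v d -> Jet s0 g v' d' ->
  Jet s0 (fun s => f s * g s)%C (v * v')%C (v * d' + d * v')%C.
Proof.
  move=> H H'; have [r [M [M' [a [b [A [B [<- [<- [<- <-]]]]]]]]]] := Jet_common _ _ _ _ _ _ _ H H'.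
  do 3 eexists; split; [by apply: ps_mult A B | split; last by apply conv_1].
  rewrite /conv /=; ring.
Qed.

Lemma Jet_const s0 c : Jet s0 (fun _ => c) c 0.
Proof. do 3 eexists; split; [by apply (ps_const s0 1 c); lra | done]. Qed.

Lemma Jet_scal s0 f c v d : Jet s0 f v d -> Jet s0 (fun s => c * f s)%C (c * v)%C (c * d)%C.
Proof. move=> H; apply: Jet_eq (Jet_mult _ _ _ _ _ _ _ (Jet_const s0 c) H) _ _; ring. Qed.

Lemma Jet_id s0 c : Jet s0 (fun s => s - c)%C (s0 - c)%C 1.
Proof. do 3 eexists; split; [by apply (ps_id s0 1 c); lra | done]. Qed.

Lemma Jet_ext s0 f g v d rho : 0 < rho -> (forall s, Cmod (s - s0)%C <= rho -> f s = g s) ->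
  Jet s0 f v d -> Jet s0 g v d.
Proof.
  move=> Hr E [r [M [a [H Ha]]]]; exists (Rmin r rho), M, a; split => //.
  have P : 0 < Rmin r rho by apply Rmin_glb_lt => //; apply (proj1 H).
  have H' := ps_shrink _ _ _ _ _ _ (conj P (Rmin_l r rho)) H.
  apply: ps_ext H' => s Hs; apply E; apply: Rle_trans Hs (Rmin_r _ _).
Qed.

Lemma Jet_shift s0 c f v d : Jet (s0 + c)%C f v d -> Jet s0 (fun s => f (s + c)%C) v d.
Proof. move=> [r [M [a [H Ha]]]]; exists r, M, a; split => //; by apply ps_shift. Qed.

Lemma Jet_xp s0 x c : Jet s0 (fun s => xp x (c - s)%C) (xp x (c - s0)%C) (- RtoC (ln x) * xp x (c - s0))%C.
Proof.
  have H := ps_exp s0 1 (- RtoC (ln x))%C Rlt_0_1.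
  have J : Jet s0 (fun s => Cexp (- RtoC (ln x) * s)%C) (Cexp (- RtoC (ln x) * s0)%C) (- RtoC (ln x) * Cexp (- RtoC (ln x) * s0))%C.
  { do 3 eexists; split; first exact H.
    split; rewrite /=; field; apply RtoC_neq_0; lra. }
  have E s : (xp x c * Cexp (- RtoC (ln x) * s))%C = xp x (c - s)%C.
  { rewrite /xp -Cexp_plus; congr Cexp; ring. }
  have {}J := Jet_scal _ _ (xp x c) _ _ J.
  apply: (Jet_ext _ (fun s => xp x c * Cexp (- RtoC (ln x) * s))%C _ _ _ 1 Rlt_0_1 (fun s _ => E s)).
  apply: Jet_eq J _ _; rewrite -E //; ring.
Qed.

Lemma Jet_inv s0 c : s0 <> c -> Jet s0 (fun s => / (s - c))%C (/ (s0 - c))%C (- (/ (s0 - c) * / (s0 - c)))%C.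
Proof.
  move=> H; have P := Cmod_sub_gt_0 _ _ H.
  have N : (s0 - c)%C <> 0 by apply Cmod_gt_0.
  do 3 eexists; split; first by apply (ps_inv s0 (Cmod (s0 - c)%C / 2) c); lra.
  rewrite /=; split; by field.
Qed.

Lemma Jet_csum s0 (f : nat -> C -> C) (v d : nat -> C) n :
  (forall k, (k < n)%nat -> Jet s0 (f k) (v k) (d k)) ->
  Jet s0 (fun s => csum (fun k => f k s) n) (csum v n) (csum d n).
Proof.
  elim: n => [|n IH] H /=; first exact: Jet_const.
  apply Jet_plus; [apply IH => k Hk; apply H; lia | apply H; lia].
Qed.

(** * Special values of the one-dimensional zeta function *)

Lemma bn_INR_zero m n : (m < n)%nat -> bn n (RtoC (INR m)) = 0.
Proof.
  elim: n => [|n IH] H; first lia.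
  change (bn (S n) (RtoC (INR m))) with (bn n (RtoC (INR m)) * (RtoC (INR m) - RtoC (INR n)) / RtoC (INR (S n)))%C.
  case: (Nat.eq_dec m n) => [->|Hne].
  - have -> : (RtoC (INR n) - RtoC (INR n) = 0)%C by ring. rewrite /Cdiv; ring.
  - rewrite IH; last lia. rewrite /Cdiv; ring.
Qed.

Lemma csums_zero : csums (fun _ => RtoC 0) 0.
Proof. exact: (csums_finite (fun _ => RtoC 0) 0). Qed.

(** At [s = - m] the coefficients [binom(m, n)] with [n > N >= m] vanish, so the Euler-Maclaurin
    expansion is finite and exact there. *)
Lemma S1_zero N d x s m : (m <= N)%nat -> (- s)%C = RtoC (INR m) -> S1 N d x s = 0.
Proof.
  move=> Hm Hs; apply csums_cser; apply: csums_ext csums_zero => k; symmetry.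
  apply csums_cser; apply: csums_ext csums_zero => n.
  rewrite /tail_term Hs bn_INR_zero; [ring | lia].
Qed.

(** The residue of the zeta function at its pole. *)
Lemma Eta_at_0 N a K : 16 <= a + INR K -> Eta N a K 0 = RtoC 1.
Proof.
  move=> Hx; rewrite /Eta (S1_zero N _ _ _ 0); [|lia|rewrite /=; ring].
  rewrite /Qs csum_S_l (csum_zero (fun k => bn (S k) (- 0) * bernoulli_poly (S k) 0 * xp (a + INR K) (- 0 - RtoC (INR (S k))))%C).
  - rewrite bernoulli_poly_at_0.
    have -> : (- 0 - RtoC (INR 0) = RtoC 0)%C by rewrite /=; ring.
    rewrite xp_0 /=; ring.
  - move=> k _; have -> : (- 0)%C = RtoC (INR 0) by rewrite /=; ring.
    rewrite bn_INR_zero; [ring | lia].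
Qed.

(** The value is [- zeta(0, a)]; the [K] terms of the explicit sum cancel against the shift from [a]
    to [a + K]. *)
Lemma Eta_at_m1 N a K : (1 <= N)%nat -> 16 <= a + INR K -> Eta N a K (- (1))%C = RtoC (a - / 2).
Proof.
  move=> HN Hx; rewrite /Eta (S1_zero N _ _ _ 1); [|lia|rewrite /=; ring].
  have m1 : (- - (1))%C = RtoC (INR 1) by rewrite /=; ring.
  rewrite /Qs; destruct N as [|N]; first lia.
  rewrite csum_S_l csum_S_l (csum_zero (fun k => bn (S (S k)) (- - (1)) * bernoulli_poly (S (S k)) 0 * xp (a + INR K) (- - (1) - RtoC (INR (S (S k)))))%C).
  - have -> : csum (fun k => xp (a + INR k) (- - (1) - 1)) K = RtoC (INR K).
    { elim: K {Hx} => [|K IH] //.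
      rewrite csum_S IH S_INR RtoC_plus; congr Cplus.
      have -> : (- - (1) - 1 = RtoC 0)%C by ring. by rewrite xp_0. }
    rewrite bernoulli_poly_at_0 bernoulli_poly_at_1.
    have -> : bn 0 (- - (1)) = RtoC 1 by [].
    have -> : bn 1 (- - (1)) = RtoC 1 by rewrite /=; field; apply RtoC_neq_0; lra.
    have -> : (- - (1) - RtoC (INR 0) = RtoC (INR 1))%C by rewrite /=; ring.
    have -> : (- - (1) - RtoC (INR 1) = RtoC 0)%C by rewrite /=; ring.
    rewrite xp_0 xp_INR; last lra.
    rewrite /= !RtoC_minus RtoC_plus; ring.
  - move=> k _; rewrite m1 bn_INR_zero; [ring | lia].
Qed.

Lemma csums_RtoC u l : csums (fun k => RtoC (u k)) l -> l = RtoC (Series u).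
Proof.
  move=> H.
  have E : l = RtoC (Re l).
  { refine (csums_unique _ _ _ H _); move=> eps He; have [N HN] := H eps He; exists N => n Hn.
    apply: Rle_lt_trans (HN n Hn).
    rewrite csum_RtoC -RtoC_minus Cmod_R.
    have -> : rsum u n - Re l = Re (RtoC (rsum u n) - l)%C by [].
    apply re_le_Cmod. }
  rewrite E; congr RtoC; symmetry; apply is_series_unique.
  apply filterlim_locally => eps; have [N HN] := H eps (cond_pos eps); exists N => n Hn.
  have := HN (S n) ltac:(lia); rewrite csum_RtoC E -RtoC_minus Cmod_R sum_n_rsum.
  by [].
Qed.

Lemma Eta_at_pos N a K j : 0 < a -> 16 <= a + INR K -> (1 <= N)%nat ->
  Eta N a K (RtoC (INR (S j))) = RtoC (INR (S j) * hurwitz_zeta (S (S j)) a).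
Proof.
  move=> Ha Hx HN.
  have j0 : 1 <= INR (S j) by rewrite S_INR; have := pos_INR j; lra.
  have n0 : 1 <= INR N by apply (le_INR 1).
  have Rj : Re (RtoC (INR (S j))) = INR (S j) by [].
  have H := Eta_series N a K (RtoC (INR (S j))) Ha Hx ltac:(rewrite Rj; lra) ltac:(rewrite Rj; lra).
  have J := RtoC_INR_S j.
  have H2 := csums_scal (/ RtoC (INR (S j)))%C _ _ H.
  have {}H2 : csums (fun k => RtoC (/ (INR k + a) ^ S (S j))) (/ RtoC (INR (S j)) * Eta N a K (RtoC (INR (S j))))%C.
  { apply: csums_ext H2 => k; have k0 := pos_INR k.
    have -> : (- RtoC (INR (S j)) - 1 = - RtoC (INR (S (S j))))%C by rewrite (S_INR (S j)) RtoC_plus; ring.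
    rewrite xp_opp xp_INR; last lra.
    have -> : RtoC (/ (INR k + a) ^ S (S j)) = (/ RtoC (a + INR k) ^ S (S j))%C.
    { rewrite -RtoC_pow (Rplus_comm (INR k) a) RtoC_inv //; apply pow_nonzero; lra. }
    move: (/ RtoC (a + INR k) ^ S (S j))%C => y; by field. }
  have E := csums_RtoC _ _ H2.
  rewrite RtoC_mult /hurwitz_zeta (_ : Nat.eqb (S (S j)) 1 = false) // -E; by field.
Qed.

Lemma clim_RtoC (u : nat -> R) (l : R) : is_lim_seq u l -> clim (fun n => RtoC (u n)) (RtoC l).
Proof.
  move=> /is_lim_seq_spec H eps He; have [N HN] := H (mkposreal _ He); exists N => n Hn.
  rewrite -RtoC_minus Cmod_R; exact: HN.
Qed.

(* Near [s0], everything beyond the first [J] Euler-Maclaurin terms is [O((a + K)^(-1/2))]. *)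
Lemma Eta_split N a s0 J : (J <= S N)%nat -> 1 - Re s0 <= INR J -> 2 - Re s0 <= INR N ->
  exists B, 0 <= B /\ forall K, 16 <= a + INR K ->
  psb s0 (/ 2) (B * rp (a + INR K) (- (/ 2)))
   (fun s => Eta N a K s - (s * csum (fun k => xp (a + INR k) (- s - 1)) K +
      csum (fun j => bn j (- s) * bernoulli_poly j 0 * xp (a + INR K) (- s - RtoC (INR j))) J))%C.
Proof.
  move=> HJ H1 H2.
  have h2 : 0 < / 2 by lra.
  have [Kb [Kb0 HKb]] := psb_bn 0 s0 (/ 2) h2.
  have [D [D0 [HD _]]] := Dseq_bounds N 1 ltac:(lra).
  have Z1 : Cmod 0 <= 1 by rewrite Cmod_0; lra.
  have [K' [K0 HK]] := psb_S1 N s0 (/ 2) (4 * 1) h2 ltac:(lra) ltac:(rewrite S_INR; lra).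
  pose c i := Kb * 2 ^ (J + i) * Cmod (bernoulli_poly (J + i) 0).
  have c0 i : 0 <= c i.
  { apply Rmult_le_pos; last apply Cmod_ge_0. apply Rmult_le_pos => //; apply pow_le; lra. }
  exists (rsum c (S N - J) + K' * D); split.
  { have := rsum_nonneg c (S N - J) c0; have := Rmult_le_pos _ _ K0 D0; lra. }
  move=> K Hx; set x := a + INR K in Hx *.
  have x1 : 1 <= x by lra.
  have A : psb s0 (/ 2) (rsum (fun i => c i * rp x (- (/ 2))) (S N - J))
    (fun s => csum (fun i => bn (J + i) (- s) * bernoulli_poly (J + i) 0 * xp x (- s - RtoC (INR (J + i)))) (S N - J))%C.
  { apply (psb_csum _ _ _ (fun i s => bn (J + i) (- s) * bernoulli_poly (J + i) 0 * xp x (- s - RtoC (INR (J + i))))%C) => // i _.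
    have T := psb_mult _ _ _ _ _ _ (HKb (J + i)%nat)
       (psb_scal _ _ _ _ (bernoulli_poly (J + i) 0) (psb_xp x s0 (/ 2) (- RtoC (INR (J + i)))%C x1 h2)).
    apply: psb_mono (psb_ext _ _ _ _ _ _ T).
    - have -> : Re (- RtoC (INR (J + i)))%C = - INR (J + i) by [].
      rewrite /c -!Rmult_assoc; apply Rmult_le_compat_l; first by apply c0.
      apply rp_exp_mono => //; rewrite plus_INR; have := pos_INR i; lra.
    - move=> s _; have -> : (0 - s = - s)%C by ring.
      have -> : (- RtoC (INR (J + i)) - s = - s - RtoC (INR (J + i)))%C by ring.
      ring. }
  have B := proj1 (HK (Dseq N 0) D x D0 (fun n => HD 0 n Z1) ltac:(lra) ltac:(lra)).
  have T := psb_plus _ _ _ _ _ _ A B.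
  apply: psb_mono (psb_ext _ _ _ _ _ _ T).
  - rewrite (rsum_ext _ (fun i => rp x (- (/ 2)) * c i)); last by move=> i; ring.
    rewrite rsum_scal Rmult_plus_distr_r (Rmult_comm (rp _ _)); apply Rplus_le_compat_l.
    apply Rmult_le_compat_l; first by apply Rmult_le_pos.
    apply rp_exp_mono => //; rewrite S_INR; lra.
  - move=> s _; rewrite /Eta -/x /Qs.
    have -> : (S N = J + (S N - J))%nat by lia.
    rewrite csum_shift.
    have -> : (J + (S N - J) - J = S N - J)%nat by lia.
    ring.
Qed.

Lemma Eta_derive_indep N a K K' s0 : (K <= K')%nat -> 16 <= a + INR K -> 2 <= Re s0 + INR N ->
  C_derive (Eta N a K') s0 = C_derive (Eta N a K) s0.
Proof.
  move=> HK Hx HN.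
  have [M [b H]] := psa_Eta N a K s0 (/ 2) ltac:(lra) Hx ltac:(lra).
  rewrite (ps_derive _ _ _ _ _ H).
  apply: (ps_derive s0 (/ 2) M b); apply: ps_ext H => s Hs.
  symmetry; apply Eta_indep => //.
  have := Re_ge_opp_Cmod (s - s0)%C; have -> : Re (s - s0)%C = Re s - Re s0 by []. lra.
Qed.

Lemma rp_neg_lim a p : 0 < p -> is_lim_seq (fun n => rp (a + INR n) (- p)) 0.
Proof.
  move=> Hp; apply is_lim_seq_spec => eps.
  have [n Hn] : exists n, exp (- ln eps / p) - a < INR n.
  { exists (Z.to_nat (up (Rabs (exp (- ln eps / p) - a)))). have [A _] := archimed (Rabs (exp (- ln eps / p) - a)).
    have B := Rabs_pos (exp (- ln eps / p) - a); have B' := Rle_abs (exp (- ln eps / p) - a).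
    have U : (0 <= up (Rabs (exp (- ln eps / p) - a)))%Z by apply le_IZR; lra.
    rewrite INR_IZR_INZ Z2Nat.id //; lra. }
  exists n => m Hm; have M : INR n <= INR m by apply le_INR.
  rewrite Rminus_0_r Rabs_pos_eq; last by apply Rlt_le, rp_pos.
  have L : - ln eps / p < ln (a + INR m).
  { rewrite -{1}(ln_exp (- ln eps / p)); apply ln_increasing; [apply exp_pos | lra]. }
  rewrite /rp -[X in _ < X]exp_ln; last apply cond_pos.
  apply exp_increasing.
  have := Rmult_lt_compat_l p _ _ Hp L.
  have -> : p * (- ln eps / p) = - ln eps by field; lra. lra.
Qed.

(** The derivative of [Eta] does not depend on [K], while the part omitted from [m] has a derivative
    of order [(a + n)^(- 1/2)]; letting the cut grow makes the derivative a limit of finite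
    expressions. *)
Lemma Eta_derive_lim N a K s0 J (m : nat -> R) : (J <= S N)%nat -> 1 - Re s0 <= INR J -> 2 - Re s0 <= INR N ->
  16 <= a + INR K -> 0 < a ->
  (forall n, exists v, Jet s0 (fun s => s * csum (fun k => xp (a + INR k) (- s - 1)) n +
      csum (fun j => bn j (- s) * bernoulli_poly j 0 * xp (a + INR n) (- s - RtoC (INR j))) J)%C v (RtoC (m n))) ->
  clim (fun n => RtoC (m n)) (C_derive (Eta N a K) s0).
Proof.
  move=> HJ H1 H2 Hx Ha Hm.
  have [B [B0 HB]] := Eta_split N a s0 J HJ H1 H2.
  (* A norm [B] on a disc of radius [1/2] bounds the derivative at the centre by [2 * B]. *)
  have L := is_lim_seq_scal_l _ (2 * B) _ (rp_neg_lim a (/ 2) ltac:(lra)).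
  move=> eps He.
  move: L; rewrite /= Rmult_0_r => /is_lim_seq_spec /(_ (mkposreal _ He)) [n0 Hn0].
  exists (n0 + K)%nat => n Hn.
  have Hxn : 16 <= a + INR n.
  { have : INR K <= INR n by apply le_INR; lia. lra. }
  rewrite -(Eta_derive_indep N a K n s0); [|lia|done|lra].
  have [v Hv] := Hm n.
  have T := HB n Hxn.
  have J1 := Jet_psa s0 (/ 2) (Eta N a n) (psa_Eta N a n s0 (/ 2) ltac:(lra) Hxn ltac:(lra)).
  have J2 := Jet_plus _ _ _ _ _ _ _ J1 (Jet_scal _ _ (- (1))%C _ _ Hv).
  have T2 := psb_derive_bound _ _ _ _ T.
  have E : C_derive (fun s => Eta N a n s - (s * csum (fun k => xp (a + INR k) (- s - 1)) n +
      csum (fun j => bn j (- s) * bernoulli_poly j 0 * xp (a + INR n) (- s - RtoC (INR j))) J))%C s0 =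
     (C_derive (Eta N a n) s0 - RtoC (m n))%C.
  { have -> : (C_derive (Eta N a n) s0 - RtoC (m n) = C_derive (Eta N a n) s0 + - (1) * RtoC (m n))%C by ring.
    apply (Jet_derive _ _ (Eta N a n s0 + - (1) * v)%C).
    apply: (Jet_ext _ _ _ _ _ 1 Rlt_0_1 _ J2) => s _ /=; ring. }
  rewrite E in T2; rewrite Cmod_sub_sym.
  apply: Rle_lt_trans T2 _.
  have := Hn0 n ltac:(lia) => /=; rewrite Rminus_0_r Rabs_pos_eq.
  - have := rp_pos (a + INR n) (- / 2) => P Q; apply: Rle_lt_trans Q; right; field.
  - apply Rmult_le_pos; [lra | apply Rlt_le, rp_pos].
Qed.

Lemma is_lim_seq_ln_ratio' a : 0 < a -> is_lim_seq (fun n => ln (a + INR n) - ln (INR n)) 0.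
Proof. move=> Ha; apply: is_lim_seq_ext (is_lim_seq_ln_ratio a Ha) => n; by rewrite Rplus_comm. Qed.

Lemma Jet_id' s0 : Jet s0 (fun s => s) s0 1.
Proof.
  have E : (s0 - 0 = s0)%C by ring.
  have H := Jet_id s0 0; rewrite E in H.
  apply: (Jet_ext _ _ _ _ _ 1 Rlt_0_1 _ H) => s _; ring.
Qed.

(** One Euler-Maclaurin term is enough: at [0] the explicit sum contributes the sum of the
    [1 / (a + k)], and [(a + n)^(- s)] contributes [- ln (a + n)]. *)
Lemma Eta_derive_0 N a K : (2 <= N)%nat -> 0 < a -> 16 <= a + INR K ->
  C_derive (Eta N a K) 0 = RtoC (- digamma a).
Proof.
  move=> HN Ha Hx.
  have n2 : 2 <= INR N by apply (le_INR 2).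
  pose m n := rsum (fun k => / (a + INR k)) n - ln (a + INR n).
  have A : is_lim_seq m (- digamma a).
  { have L := is_lim_seq_minus' _ _ _ _ (proj1 (is_lim_seq_opp _ _) (digamma_lim a Ha)) (is_lim_seq_ln_ratio' a Ha).
    rewrite Rminus_0_r in L.
    apply: is_lim_seq_ext L => n; rewrite /psi_seq /m; ring. }
  apply: clim_unique (clim_RtoC _ _ A).
  apply (Eta_derive_lim N a K 0 1 m) => //; try (rewrite /Re /=; lra); first lia.
  move=> n.
  have JS : exists v, Jet 0 (fun s => csum (fun k => xp (a + INR k) (- s - 1)) n)%C (RtoC (rsum (fun k => / (a + INR k)) n)) v.
  { eexists; rewrite -csum_RtoC.
    apply (Jet_csum 0 (fun k s => xp (a + INR k) (- s - 1))%C) => k _.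
    have H := Jet_xp 0 (a + INR k) (- (1))%C.
    have E : xp (a + INR k) (- (1) - 0)%C = RtoC (/ (a + INR k)).
    { have -> : (- (1) - 0 = - RtoC (INR 1))%C by rewrite /=; ring.
      have k0 := pos_INR k.
      rewrite xp_opp xp_INR; last lra. rewrite RtoC_inv; last lra. by rewrite Cpow_1_r. }
    apply: (Jet_ext _ _ _ _ _ 1 Rlt_0_1 _ (Jet_eq _ _ _ _ _ _ H E eq_refl)) => s _.
    congr xp; ring. }
  have [v JS'] := JS.
  have J1 := Jet_mult _ _ _ _ _ _ _ (Jet_id' 0) JS'.
  have J2 := Jet_plus _ _ _ _ _ _ _ J1 (Jet_xp 0 (a + INR n) 0).
  eexists.
  apply: (Jet_ext _ _ _ _ _ 1 Rlt_0_1 _ (Jet_eq _ _ _ _ _ _ J2 eq_refl _)).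
  - move=> s _; rewrite csum_S /= bernoulli_poly_at_0.
    have -> : (- s - 0 = 0 - s)%C by ring. ring.
  - have -> : (0 - 0 = RtoC 0)%C by ring.
    rewrite xp_0 /m RtoC_minus; ring.
Qed.

(** The derivative at [s = - 1] of the explicit sum together with the first two Euler-Maclaurin
    terms at [x = a + n]. *)
Definition Em1_seq (a : R) (n : nat) : R :=
  INR n + rsum (fun k => ln (a + INR k)) n - (a + INR n) * ln (a + INR n) + / 2 * (1 + ln (a + INR n)).

Lemma Eta_derive_m1_lim N a K : (3 <= N)%nat -> 0 < a -> 16 <= a + INR K ->
  clim (fun n => RtoC (Em1_seq a n)) (C_derive (Eta N a K) (- (1))%C).
Proof.
  move=> HN Ha Hx.
  have n3 : 3 <= INR N by have := le_INR 3 N HN; rewrite /=; lra.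
  apply (Eta_derive_lim N a K (- (1))%C 2) => //; try (rewrite /Re /=; lra); first lia.
  move=> n.
  have JS : Jet (- (1))%C (fun s => csum (fun k => xp (a + INR k) (- s - 1)) n)%C (RtoC (INR n)) (RtoC (- rsum (fun k => ln (a + INR k)) n)).
  { have -> : RtoC (INR n) = csum (fun _ => RtoC 1) n.
    { elim: n => [|n IH] //; by rewrite csum_S -IH S_INR RtoC_plus. }
    have -> : - rsum (fun k => ln (a + INR k)) n = rsum (fun k => - ln (a + INR k)) n.
    { elim: n => [|n IH] /=; [ring | rewrite -IH; ring]. }
    rewrite -csum_RtoC.
    apply (Jet_csum (- (1))%C (fun k s => xp (a + INR k) (- s - 1))%C) => k _.
    have H := Jet_xp (- (1))%C (a + INR k) (- (1))%C.
    have E0 : (- (1) - - (1) = RtoC 0)%C by ring.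
    rewrite E0 xp_0 in H.
    apply: (Jet_ext _ _ _ _ _ 1 Rlt_0_1 _ (Jet_eq _ _ _ _ _ _ H eq_refl _)).
    - move=> s _; congr xp; ring.
    - rewrite RtoC_opp; ring. }
  have J1 := Jet_mult _ _ _ _ _ _ _ (Jet_id' _) JS.
  have J2 := Jet_plus _ _ _ _ _ _ _ J1 (Jet_xp (- (1))%C (a + INR n) 0).
  have J3 := Jet_scal _ _ (- RtoC (/ 2))%C _ _ (Jet_mult _ _ _ _ _ _ _ (Jet_scal _ _ (- (1))%C _ _ (Jet_id' (- (1))%C)) (Jet_xp (- (1))%C (a + INR n) (- (1))%C)).
  have J4 := Jet_plus _ _ _ _ _ _ _ J2 J3.
  eexists.
  apply: (Jet_ext _ _ _ _ _ 1 Rlt_0_1 _ (Jet_eq _ _ _ _ _ _ J4 eq_refl _)).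
  - move=> s _; rewrite !csum_S bernoulli_poly_at_0 bernoulli_poly_at_1.
    have -> : bn 0 (- s)%C = RtoC 1 by [].
    have -> : bn 1 (- s)%C = (- s)%C by rewrite /=; field; apply RtoC_neq_0; lra.
    have -> : (- s - RtoC (INR 0) = 0 - s)%C by rewrite /=; ring.
    have -> : (- s - RtoC (INR 1) = - (1) - s)%C by rewrite /=; ring.
    have -> : csum (fun j => bn j (- s) * bernoulli_poly j 0 * xp (a + INR n) (- s - RtoC (INR j)))%C 0 = RtoC 0 by [].
    ring.
  - have n0 := pos_INR n.
    have -> : (- (1) - - (1) = RtoC 0)%C by ring.
    have -> : (0 - - (1) = RtoC (INR 1))%C by rewrite /=; ring.
    rewrite xp_0 xp_INR; last lra.
    rewrite /Em1_seq !(RtoC_plus, RtoC_opp, RtoC_mult) Cpow_1_r; ring.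
Qed.

Lemma lim_n_ln_ratio b c : 0 < c -> is_lim_seq (fun n => (INR n + b) * ln (1 + c / INR n)) c.
Proof.
  move=> Hc.
  have D := is_lim_seq_div_INR c.
  have L1 : is_lim_seq (fun n => INR n * ln (1 + c / INR n)) c.
  { apply (is_lim_seq_le_le_loc (fun n => c / (1 + c / INR n)) _ (fun _ => c)).
    - exists 1%nat => n Hn.
      have n0 : 0 < INR n by apply lt_0_INR; lia.
      have q : 0 < c / INR n by apply Rdiv_lt_0_compat.
      have [A B] := ln_1p_bounds (c / INR n) ltac:(lra).
      have E : c = INR n * (c / INR n) by field; lra.
      split.
      + have -> : c / (1 + c / INR n) = INR n * (c / INR n / (1 + c / INR n)).
        { rewrite {1}E; field; split; nra. }
        apply Rmult_le_compat_l; lra.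
      + rewrite {2}E; apply Rmult_le_compat_l; lra.
    - have -> : Finite c = Finite (c / (1 + 0)) by congr Finite; field.
      apply is_lim_seq_div'; [apply is_lim_seq_const | apply is_lim_seq_plus' => //; apply is_lim_seq_const | lra].
    - apply is_lim_seq_const. }
  have L2 : is_lim_seq (fun n => b * ln (1 + c / INR n)) 0.
  { have -> : Finite 0 = Rbar_mult b 0 by rewrite /= Rmult_0_r.
    apply is_lim_seq_scal_l.
    apply: is_lim_seq_ext_loc (is_lim_seq_ln_ratio c Hc); exists 1%nat => n Hn.
    have n0 : 0 < INR n by apply lt_0_INR; lia.
    rewrite ln_add; lra. }
  have L := is_lim_seq_plus' _ _ _ _ L1 L2.
  rewrite Rplus_0_r in L; apply: is_lim_seq_ext L => n; ring.
Qed.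

(** The limit of [Em1_seq a] itself involves Stirling's constant; in the difference with [a = 1] it
    cancels, and [lnG_Gauss] at the two points is enough. *)
Lemma Em1_diff_lim a : 0 < a -> is_lim_seq (fun n => Em1_seq a n - Em1_seq 1 n) (- lnG a - (a - 1)).
Proof.
  move=> Ha.
  have l1 : lnG 1 = 0 by rewrite /lnG Gamma_1 ln_1.
  have G := is_lim_seq_minus' _ _ _ _ (lnG_Gauss 1 Rlt_0_1) (lnG_Gauss a Ha).
  have T := is_lim_seq_minus' _ _ _ _ (lim_n_ln_ratio (1 - / 2) 1 Rlt_0_1) (lim_n_ln_ratio (a - / 2) a Ha).
  have L := is_lim_seq_plus' _ _ _ _ G T.
  have E : lnG 1 - lnG a + (1 - a) = - lnG a - (a - 1) by rewrite l1; ring.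
  rewrite E in L; apply: is_lim_seq_ext_loc L; exists 1%nat => n Hn.
  have n0 : 0 < INR n by apply lt_0_INR; lia.
  rewrite /Em1_seq (Rplus_comm a (INR n)) (Rplus_comm 1 (INR n)) (ln_add (INR n) a) ?(ln_add (INR n) 1); try lra.
Qed.

Lemma Eta_derive_m1_diff N a K K1 : (3 <= N)%nat -> 0 < a -> 16 <= a + INR K -> 16 <= 1 + INR K1 ->
  (C_derive (Eta N a K) (- (1)) - C_derive (Eta N 1 K1) (- (1)) = RtoC (- lnG a - (a - 1)))%C.
Proof.
  move=> HN Ha Hx Hx1.
  have A := clim_minus _ _ _ _ (Eta_derive_m1_lim N a K HN Ha Hx) (Eta_derive_m1_lim N 1 K1 HN Rlt_0_1 Hx1).
  apply: clim_unique A _.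
  apply: clim_ext (clim_RtoC _ _ (Em1_diff_lim a Ha)) => n; by rewrite RtoC_minus.
Qed.

(** * The derivative of the double zeta function at [0] *)

Definition ecoef (j : nat) (s : C) : C := (/ (s - 1) * bn j (1 - s))%C.

Definition ecoef_v (j : nat) : C := match j with O | 1%nat => (- (1))%C | _ => RtoC 0 end.
Definition ecoef_d (j : nat) : C :=
  match j with O => (- (1))%C | 1%nat => RtoC 0 | _ => ((- (1)) ^ j / (RtoC (INR j) * (RtoC (INR j) - 1)))%C end.

Lemma near_0_neq_1 s : Cmod (s - 0)%C <= / 2 -> (s - 1)%C <> 0.
Proof.
  move=> H E.
  have {}E : (s - 0 = RtoC 1)%C by have -> : (s - 0 = s - 1 + 1)%C by [ring]; rewrite E; ring.
  rewrite E Cmod_1 in H; lra.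
Qed.

(** For [j >= 1] the factor [1 - s] of [bn j (1 - s)] cancels the pole at [1]. From [j = 2] on there
    is also a factor [s], so the value at [0] vanishes and only a derivative is left. *)
Lemma Jet_ecoef j : Jet 0 (ecoef j) (ecoef_v j) (ecoef_d j).
Proof.
  have n1 : RtoC 0 <> RtoC 1 by move=> /RtoC_inj; lra.
  have h2 : 0 < / 2 by lra.
  have o1 : (RtoC 0 - 1)%C <> 0.
  { have -> : (0 - 1 = RtoC (- (1)))%C by rewrite RtoC_opp; ring. apply RtoC_neq_0; lra. }
  have step j0 s : ecoef (S j0) s = (ecoef j0 s * (- / RtoC (INR (S j0)) * (s - (1 - RtoC (INR j0)))))%C.
  { rewrite /ecoef; change (bn (S j0) (1 - s)) with (bn j0 (1 - s) * (1 - s - RtoC (INR j0)) / RtoC (INR (S j0)))%C.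
    rewrite /Cdiv; ring. }
  case: j => [|[|j]].
  - have H := Jet_inv 0 1 n1.
    apply: (Jet_ext _ _ _ _ _ 1 Rlt_0_1 _ (Jet_eq _ _ _ _ _ _ H _ _)).
    + move=> s _; rewrite /ecoef /=; ring.
    + rewrite /=; field => //.
    + rewrite /=; field => //.
  - apply: (Jet_ext _ (fun _ => - (1))%C _ _ _ (/ 2) h2); last exact: Jet_const.
    move=> s Hs; rewrite /ecoef /=; field; by apply near_0_neq_1.
  - have base : Jet 0 (ecoef 2) 0 (/ RtoC 2)%C.
    { have H := Jet_scal _ _ (/ RtoC 2)%C _ _ (Jet_id' 0).
      apply: (Jet_ext _ _ _ _ _ (/ 2) h2 _ (Jet_eq _ _ _ _ _ _ H _ _)).
      - move=> s Hs; rewrite /ecoef /=.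
        have e2 : RtoC (1 + 1) = RtoC 2 by congr RtoC; ring.
        rewrite e2; field; repeat split; try (apply RtoC_neq_0; lra); by apply near_0_neq_1.
      - ring.
      - ring. }
    elim: j => [|j IH].
    + apply: (Jet_eq _ _ _ _ _ _ base) => //.
      rewrite /=; have e2 : RtoC (1 + 1) = RtoC 2 by congr RtoC; ring.
      have e3 : (RtoC 2 = 1 + 1)%C by rewrite -RtoC_plus.
      rewrite e2 e3; field; rewrite -?RtoC_plus -?RtoC_minus; repeat split; apply RtoC_neq_0; lra.
    + have H := Jet_mult _ _ _ _ _ _ _ IH (Jet_scal _ _ (- / RtoC (INR (S (S (S j)))))%C _ _ (Jet_id 0 (1 - RtoC (INR (S (S j))))%C)).
      apply: (Jet_ext _ _ _ _ _ 1 Rlt_0_1 _ (Jet_eq _ _ _ _ _ _ H _ _)).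
      * move=> s _; by rewrite [RHS]step.
      * rewrite /ecoef_v; ring.
      * have j2 : INR (S (S j)) >= 2 by rewrite !S_INR; have := pos_INR j; lra.
        rewrite /ecoef_d /ecoef_v (S_INR (S (S j))) RtoC_plus (Cpow_S _ (S (S j))).
        move: (INR (S (S j))) j2 => x x2.
        field; rewrite -?RtoC_plus -?RtoC_minus; repeat split; apply RtoC_neq_0; lra.
Qed.

Definition gterm (N : nat) (tau a : R) (K j : nat) (s : C) : C :=
  (- (ecoef j s * (/ RtoC (INR (S j)) * xp tau (- RtoC (INR j) - s)) * Eta N a K (s + (RtoC (INR j) - 1))))%C.

Lemma Z2_decomposition N tau a K w s :
  Z2 N tau a K w s = (/ (s - 1) * (/ (s - 2) * xp tau (1 - s) * Eta N a K (s - 2)) +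
    csum (fun j => bernoulli_poly (S j) w * gterm N tau a K j s) N + / (s - 1) * Z2_rem N tau a w s)%C.
Proof.
  rewrite /Z2 /Z2_main.
  have -> : csum (fun j => bernoulli_poly (S j) w * gterm N tau a K j s)%C N =
    (- / (s - 1) * csum (fun j => bn j (1 - s) * (bernoulli_poly (S j) w / RtoC (INR (S j)))
        * xp tau (- s - RtoC (INR j)) * Eta N a K (s + (RtoC (INR j) - 1))) N)%C.
  { rewrite -csum_scal; apply csum_ext => j; rewrite /gterm /ecoef.
    have -> : (- RtoC (INR j) - s = - s - RtoC (INR j))%C by ring.
    rewrite /Cdiv; ring. }
  ring.
Qed.

(* [gam c tau a j] is the coefficient of [B_(j+1)(w)] in the expansion of [log_Gamma2 (tau a + w) tau];
   the unknown constant [c] does not depend on [a]. *)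
Definition gam (c : C) (tau a : R) (j : nat) : C :=
  match j with
  | O => (c - RtoC (lnG a + ln tau * (a - / 2)))%C
  | S i => RtoC ((- ((-1) ^ j * hurwitz_zeta j a / INR j) - (if Nat.eqb j 1 then ln tau else 0)) / (INR (S j) * tau ^ j))
  end.

(** Taking [a = 1] as the point of reference makes [c] common to all [a] and [K]. *)
Lemma Eta_derive_m1_const N K1 : (3 <= N)%nat -> 16 <= 1 + INR K1 -> exists c : C, forall a K, 0 < a -> 16 <= a + INR K ->
  (C_derive (Eta N a K) (- (1)) + RtoC (a - / 2) = c - RtoC (lnG a))%C.
Proof.
  move=> HN H1; exists (C_derive (Eta N 1 K1) (- (1))%C + RtoC (/ 2))%C => a K Ha Hx.
  have E := Eta_derive_m1_diff N a K K1 HN Ha Hx H1.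
  have -> : C_derive (Eta N a K) (- (1))%C = (C_derive (Eta N a K) (- (1)) - C_derive (Eta N 1 K1) (- (1)) + C_derive (Eta N 1 K1) (- (1)))%C by ring.
  rewrite E.
  have -> : RtoC (- lnG a - (a - 1)) = (- RtoC (lnG a) - RtoC (a - / 2) + RtoC (/ 2))%C.
  { rewrite -RtoC_opp -RtoC_minus -RtoC_plus; congr RtoC; field. }
  ring.
Qed.

(** For [j = 0] the derivative of [Eta] at [- 1] enters, for [j = 1] the one at [0], which gives the
    digamma value. From [j = 2] on [ecoef] vanishes at [0], so only the value of [Eta] at [j - 1] is
    left and no [ln tau] appears. *)
Lemma gterm_derive N c tau a K j : (6 <= N)%nat -> 0 < a -> 1 <= tau -> 16 <= a + INR K ->
  (C_derive (Eta N a K) (- (1)) + RtoC (a - / 2) = c - RtoC (lnG a))%C ->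
  exists v, Jet 0 (gterm N tau a K j) v (gam c tau a j).
Proof.
  move=> HN Ha Ht Hx Hc.
  have n6 : 6 <= INR N by have := le_INR 6 N HN; rewrite /=; lra.
  have j0 := pos_INR j.
  have Jj : RtoC (INR (S j)) <> 0 by apply RtoC_INR_S.
  have Rj : Re (0 + (RtoC (INR j) - 1))%C = INR j - 1 by rewrite /Re /=; ring.
  have JE : Jet 0 (fun s => Eta N a K (s + (RtoC (INR j) - 1)))%C (Eta N a K (RtoC (INR j) - 1)) (C_derive (Eta N a K) (RtoC (INR j) - 1)).
  { apply Jet_shift.
    have H := Jet_psa (0 + (RtoC (INR j) - 1))%C (/ 2) (Eta N a K) (psa_Eta N a K (0 + (RtoC (INR j) - 1))%C (/ 2) ltac:(lra) Hx ltac:(rewrite Rj; lra)).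
    have E : (0 + (RtoC (INR j) - 1) = RtoC (INR j) - 1)%C by ring.
    by rewrite E in H *. }
  have JX := Jet_scal _ _ (/ RtoC (INR (S j)))%C _ _ (Jet_xp 0 tau (- RtoC (INR j))%C).
  have J := Jet_scal _ _ (- (1))%C _ _ (Jet_mult _ _ _ _ _ _ _ (Jet_mult _ _ _ _ _ _ _ (Jet_ecoef j) JX) JE).
  eexists.
  apply: (Jet_ext _ _ _ _ _ 1 Rlt_0_1 _ (Jet_eq _ _ _ _ _ _ J eq_refl _)).
  { move=> s _; rewrite /gterm; ring. }
  have -> : (- RtoC (INR j) - 0 = - RtoC (INR j))%C by ring.
  rewrite xp_opp xp_INR; last lra.
  have tC : RtoC tau <> 0 by apply RtoC_neq_0; lra.
  case: j j0 Jj Rj JE JX J => [|[|j]] j0 Jj Rj JE JX J.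
  - have -> : (RtoC (INR 0) - 1 = - (1))%C by rewrite /=; ring.
    rewrite Eta_at_m1 //; last lia.
    rewrite /ecoef_v /ecoef_d (_ : INR 1 = 1) //.
    have -> : gam c tau a 0 = (C_derive (Eta N a K) (- (1)) + RtoC (a - / 2) - RtoC (ln tau) * RtoC (a - / 2))%C.
    { rewrite Hc /gam RtoC_plus RtoC_mult; ring. }
    rewrite /=; field; apply RtoC_neq_0; lra.
  - have -> : (RtoC (INR 1) - 1 = RtoC 0)%C by rewrite /=; ring.
    rewrite Eta_at_0 // Eta_derive_0 //; last lia.
    rewrite /ecoef_v /ecoef_d /gam.
    have -> : (- ((-1) ^ 1 * hurwitz_zeta 1 a / INR 1) - (if Nat.eqb 1 1 then ln tau else 0)) / (INR 2 * tau ^ 1) =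
       (- digamma a - ln tau) / (2 * tau).
    { rewrite /hurwitz_zeta /=; field; lra. }
    have e2 : RtoC (INR 2) = RtoC 2 by [].
    rewrite RtoC_div; last by apply Rmult_integral_contrapositive_currified; lra.
    rewrite e2 Cpow_1_r RtoC_mult RtoC_minus RtoC_opp; have y2 := RtoC_neq_0 2 ltac:(lra). field; exact tC.
  - have -> : (RtoC (INR (S (S j))) - 1 = RtoC (INR (S j)))%C by rewrite (S_INR (S j)) RtoC_plus; ring.
    rewrite Eta_at_pos //; last lia.
    rewrite /ecoef_v /ecoef_d /gam.
    have -> : Nat.eqb (S (S j)) 1 = false by [].
    have j1 : INR (S j) >= 1 by rewrite S_INR; have := pos_INR j; lra.
    have p0 : tau ^ S (S j) <> 0 by apply pow_nonzero; lra.
    rewrite -!RtoC_pow.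
    have -> : (- (1) = RtoC (-1))%C by rewrite -RtoC_opp.
    rewrite -RtoC_pow.
    move: (tau ^ S (S j)) p0 ((-1) ^ S (S j)) (hurwitz_zeta (S (S j)) a) => P p0 sg z.
    have -> : RtoC (-1) = (- (1))%C by rewrite -RtoC_opp.
    rewrite !(S_INR (S (S j))) (S_INR (S j)).
    move: (INR (S j)) j1 => x x1.
    have x2 : x + 1 <> 0 by lra. have x3 : x + 1 + 1 <> 0 by lra.
    have -> : (- (sg * z / (x + 1)) - 0) / ((x + 1 + 1) * P) = (- (sg * z)) / ((x + 1) * ((x + 1 + 1) * P)) by field.
    rewrite RtoC_div; last by repeat apply Rmult_integral_contrapositive_currified.
    have y1 := RtoC_neq_0 x ltac:(lra). have y2 := RtoC_neq_0 _ x2. have y3 := RtoC_neq_0 _ x3. have y4 := RtoC_neq_0 _ p0.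
    rewrite !(RtoC_mult, RtoC_opp, RtoC_plus) in y2 y3 *.
    have y5 : (RtoC x + 1 - 1)%C <> 0 by have -> : (RtoC x + 1 - 1 = RtoC x)%C by ring.
    field; tauto.
Qed.

(** The summand of [Z2] containing [Eta N a K (s - 2)] does not involve [w], so its derivative
    cancels in the difference and is never computed. *)
Lemma log_Gamma2_expansion N : (6 <= N)%nat -> exists c : C, forall a W, 0 < a -> 1 <= W ->
  exists K T, 0 <= K /\ 1 <= T /\ forall tau w v, T <= tau -> Cmod w <= W -> Cmod v <= W ->
  Cmod (log_Gamma2 (RtoC (tau * a) + w) tau - log_Gamma2 (RtoC (tau * a) + v) tau -
    csum (fun j => (bernoulli_poly (S j) w - bernoulli_poly (S j) v) * gam c tau a j) N)%C
  <= K * Cmod (w - v)%C * / tau ^ (N - 3).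
Proof.
  move=> HN.
  have n6 : 6 <= INR N by have := le_INR 6 N HN; rewrite /=; lra.
  have [K1 HK1] := Eta_point 1.
  have [c Hc] := Eta_derive_m1_const N K1 ltac:(lia) HK1.
  exists c => a W Ha HW.
  have [K HK] := Eta_point a.
  have h2 : 0 < / 2 by lra.
  have R0 : Re 0 = 0 by [].
  have [B [B0 HB]] := psb_Z2_rem N a W 0 (/ 2) h2 HW Ha ltac:(rewrite R0; lra).
  have lp := lowfac_pos a Ha.
  (* [4 * B] is the norm [2] of [/ (s - 1)] on the disc, times [B], divided by the radius [1/2]; the
     second witness makes [tau] admissible. *)
  exists (4 * B), (Rmax 1 (16 * W / lowfac a)); split; first lra; split; first apply Rmax_l.
  move=> tau w v HT Hw Hv.
  have t1 : 1 <= tau by apply: Rle_trans HT; apply Rmax_l.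
  have t2 : 16 * W <= tau * lowfac a.
  { have Q : 16 * W / lowfac a <= tau by apply: Rle_trans HT; apply Rmax_r.
    have := Rmult_le_compat_r (lowfac a) _ _ ltac:(lra) Q.
    have -> : 16 * W / lowfac a * lowfac a = 16 * W by field; lra. done. }
  have Hadm : admissible tau a W K by split; [lra | split].
  rewrite (log_Gamma2_eq tau a W K w N) // (log_Gamma2_eq tau a W K v N) //.
  have [Hrem Hdiff] := HB tau ltac:(lra) t2.
  have n1 : RtoC 0 <> RtoC 1 by move=> /RtoC_inj; lra.
  have n2 : RtoC 0 <> RtoC 2 by move=> /RtoC_inj; lra.
  have inv1 : psb 0 (/ 2) 2 (fun s => / (s - 1))%C.
  { have E : Cmod (0 - 1)%C = 1 by have -> : (0 - 1 = - (1))%C by [ring]; rewrite Cmod_opp Cmod_1.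
    have H := ps_psb _ _ _ _ _ (ps_inv 0 (/ 2) 1 ltac:(rewrite E; lra)).
    apply: psb_mono H; rewrite E; right; field. }
  pose D u s := (/ (s - 1) * (Z2_rem N tau a u s))%C.
  have JD u : Cmod u <= W -> Jet 0 (D u) (D u 0) (C_derive (D u) 0).
  { move=> Hu; apply (Jet_psa 0 (/ 2)); eexists; apply: psb_mult inv1 (Hrem u Hu). }
  have [vb Jb] : exists vb, Jet 0 (fun s => / (s - 1) * (/ (s - 2) * xp tau (1 - s) * Eta N a K (s - 2)))%C vb
     (C_derive (fun s => / (s - 1) * (/ (s - 2) * xp tau (1 - s) * Eta N a K (s - 2)))%C 0).
  { eexists; apply (Jet_psa 0 (/ 2)).
    have C2 : Cmod (0 - 2)%C = 2 by have -> : (0 - 2 = - (2))%C by [ring]; rewrite Cmod_opp Cmod_R Rabs_pos_eq; lra.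
    apply psa_mult; first by exists 2.
    apply psa_mult; first apply psa_mult.
    - apply psa_inv; rewrite C2; lra.
    - by apply psb_xp_any.
    - apply (psa_shift 0 (- (2))%C), psa_Eta => //.
      have -> : Re (0 + - (2))%C = - 2 by rewrite /Re /=; ring. lra. }
  have JG u : Jet 0 (fun s => csum (fun j => bernoulli_poly (S j) u * gterm N tau a K j s) N)%C
     (csum (fun j => bernoulli_poly (S j) u * gterm N tau a K j 0) N)%C (csum (fun j => bernoulli_poly (S j) u * gam c tau a j) N)%C.
  { apply (Jet_csum 0 (fun j s => bernoulli_poly (S j) u * gterm N tau a K j s)%C (fun j => bernoulli_poly (S j) u * gterm N tau a K j 0)%C (fun j => bernoulli_poly (S j) u * gam c tau a j)%C) => j _.
    apply Jet_scal.
    have [v0 H] := gterm_derive N c tau a K j HN Ha t1 HK (Hc a K Ha HK).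
    have [r [M [b [H1 [H2 H3]]]]] := H.
    exists r, M, b; split => //; split => //; symmetry; by apply: ps_value H1. }
  have DZ u : Cmod u <= W -> C_derive (Z2 N tau a K u) 0 =
     (C_derive (fun s => / (s - 1) * (/ (s - 2) * xp tau (1 - s) * Eta N a K (s - 2))) 0 +
      csum (fun j => bernoulli_poly (S j) u * gam c tau a j) N + C_derive (D u) 0)%C.
  { move=> Hu; have J := Jet_plus _ _ _ _ _ _ _ (Jet_plus _ _ _ _ _ _ _ Jb (JG u)) (JD u Hu).
    apply: (Jet_derive _ _ _ _ (Jet_ext _ _ _ _ _ 1 Rlt_0_1 _ J)) => s _.
    by rewrite Z2_decomposition. }
  rewrite (DZ w Hw) (DZ v Hv).
  have -> : csum (fun j => (bernoulli_poly (S j) w - bernoulli_poly (S j) v) * gam c tau a j)%C N =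
    (csum (fun j => bernoulli_poly (S j) w * gam c tau a j) N - csum (fun j => bernoulli_poly (S j) v * gam c tau a j) N)%C.
  { rewrite -csum_minus; apply csum_ext => j; ring. }
  have E : (C_derive (D w) 0 - C_derive (D v) 0)%C = C_derive (fun s => / (s - 1) * (Z2_rem N tau a w s - Z2_rem N tau a v s))%C 0.
  { symmetry.
    have -> : (C_derive (D w) 0 - C_derive (D v) 0 = C_derive (D w) 0 + - (1) * C_derive (D v) 0)%C by ring.
    have J := Jet_plus _ _ _ _ _ _ _ (JD w Hw) (Jet_scal _ _ (- (1))%C _ _ (JD v Hv)).
    apply: (Jet_derive _ _ _ _ (Jet_ext _ _ _ _ _ 1 Rlt_0_1 _ J)) => s _; rewrite /D; ring. }
  have -> : forall x y y' z z' : C, (x + y + z - (x + y' + z') - (y - y') = z - z')%C by move=> *; ring.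
  rewrite E.
  have Q := psb_derive_bound _ _ _ _ (psb_mult _ _ _ _ _ _ inv1 (Hdiff w v Hw Hv)).
  apply: Rle_trans Q _.
  have wv := Cmod_ge_0 (w - v)%C.
  have -> : 2 * (B * Cmod (w - v)%C * rp tau (- Re 0 + / 2 - INR N + 2)) / / 2 = 4 * B * Cmod (w - v)%C * rp tau (- Re 0 + / 2 - INR N + 2) by field.
  apply Rmult_le_compat_l; first by apply Rmult_le_pos => //; lra.
  (* The exponent obtained is [5/2 - N], which is at most [3 - N]. *)
  rewrite -rp_opp_INR; last lra.
  apply rp_exp_mono => //; rewrite R0 minus_INR; last lia.
  rewrite /=; lra.
Qed.

(** * Branches of the logarithm *)

Lemma ball_Cmod (x y : C) (eps : posreal) : Cmod (y - x)%C < eps -> ball (M := C_UniformSpace) x eps y.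
Proof. exact: (C_NormedModule_mixin_compat1 x y eps). Qed.

Lemma Cmod_ball (x y : C) (eps : posreal) : ball (M := C_UniformSpace) x eps y -> Cmod (y - x)%C < 2 * eps.
Proof.
  move=> H; apply: Rlt_trans (C_NormedModule_mixin_compat2 x y eps H) _.
  apply Rmult_lt_compat_r; first apply cond_pos.
  rewrite -[X in _ < X](sqrt_square 2); last lra.
  apply sqrt_lt_1; lra.
Qed.

Lemma Lipschitz_continuous_on (D : C -> Prop) (l : C -> C) K :
  (forall w v, D w -> D v -> Cmod (l w - l v)%C <= K * Cmod (w - v)%C) ->
  continuous_on (T := C_UniformSpace) (U := C_UniformSpace) D l.
Proof.
  move=> H x Hx; apply filterlim_locally => eps.
  have K0 : 0 < 2 * (Rabs K + 1) by have := Rabs_pos K; lra.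
  have P : 0 < eps / (2 * (Rabs K + 1)) by apply Rdiv_lt_0_compat => //; apply cond_pos.
  exists (mkposreal _ P) => y Hy HD; apply ball_Cmod.
  have Q := Cmod_ball _ _ _ Hy; rewrite /= in Q.
  apply: Rle_lt_trans (H y x HD Hx) _.
  have C0 := Cmod_ge_0 (y - x)%C.
  apply: (Rle_lt_trans _ ((Rabs K + 1) * Cmod (y - x)%C)).
  { apply Rmult_le_compat_r => //; have := Rle_abs K; lra. }
  have := Rmult_lt_compat_l (Rabs K + 1) _ _ ltac:(lra) Q.
  have -> : (Rabs K + 1) * (2 * (eps / (2 * (Rabs K + 1)))) = eps by field; lra. done.
Qed.

(** Extends the path from [0] to [q] to all real times within the disc, so that it is continuous
    everywhere, as the intermediate value theorem is applied below. *)
Definition clamp (t : R) : R := Rmax 0 (Rmin 1 t).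

Lemma clamp_01 t : 0 <= clamp t <= 1.
Proof. split; [apply Rmax_l | apply Rmax_lub; [lra | apply Rmin_l]]. Qed.

Lemma clamp_Lipschitz t u : Rabs (clamp t - clamp u) <= Rabs (t - u).
Proof.
  have A := Rle_abs (t - u); have B := Rle_abs (- (t - u)); rewrite Rabs_Ropp in B.
  apply Rabs_le; rewrite /clamp /Rmax /Rmin.
  destruct (Rle_dec 1 t); destruct (Rle_dec 1 u); repeat (match goal with |- context [Rle_dec 0 ?x] => destruct (Rle_dec 0 x) end); lra.
Qed.

Lemma path_continuous (l : C -> C) (q : C) t :
  continuous_on (T := C_UniformSpace) (U := C_UniformSpace) (fun w => Cmod w <= Cmod q) l ->
  continuous (fun t => Im (l (RtoC (clamp t) * q)%C)) t.
Proof.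
  move=> H.
  have D u : Cmod (RtoC (clamp u) * q)%C <= Cmod q.
  { have := clamp_01 u => c; rewrite Cmod_mult Cmod_R Rabs_pos_eq; last lra.
    have := Cmod_ge_0 q; nra. }
  apply filterlim_locally => eps.
  have [d Hd] := proj1 (filterlim_locally (F := within (fun w => Cmod w <= Cmod q) (locally (T := C_UniformSpace) (RtoC (clamp t) * q)%C)) _ _) (H _ (D t)) eps.
  have q0 : 0 < Cmod q + 1 by have := Cmod_ge_0 q; lra.
  have P : 0 < d / (Cmod q + 1) by apply Rdiv_lt_0_compat => //; apply cond_pos.
  exists (mkposreal _ P) => u Hu.
  have Q : ball (M := C_UniformSpace) (RtoC (clamp t) * q)%C d (RtoC (clamp u) * q)%C.
  { apply ball_Cmod.
    have -> : (RtoC (clamp u) * q - RtoC (clamp t) * q = RtoC (clamp u - clamp t) * q)%C by rewrite RtoC_minus; ring.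
    rewrite Cmod_mult Cmod_R.
    have L := clamp_Lipschitz u t.
    have Hu' : Rabs (u - t) < d / (Cmod q + 1) by exact Hu.
    have a0 := Rabs_pos (clamp u - clamp t); have c0 := Cmod_ge_0 q.
    have := Rmult_lt_compat_r (Cmod q + 1) _ _ q0 Hu'.
    have -> : d / (Cmod q + 1) * (Cmod q + 1) = d by field; lra. nra. }
  exact: (proj2 (Hd _ Q (D u))).
Qed.

(** The exponential of the difference of two branches is [1], so its real part is [0] and the sine
    of its imaginary part vanishes. An imaginary part that left [0] would take a nonzero value in
    [[-1, 1]], where the sine is nonzero. *)
Lemma log_branch_unique F q L L' : is_log_branch F q L -> is_log_branch F q L' -> L = L'.
Proof.
  move=> [l [Hc [He [H0 <-]]]] [l' [Hc' [He' [H0' <-]]]].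
  have key w : Cmod w <= Cmod q -> Re (l w - l' w)%C = 0 /\ sin (Im (l w - l' w)%C) = 0.
  { move=> Hw.
    have E : Cexp (l w - l' w)%C = RtoC 1.
    { rewrite /Cminus Cexp_plus Cexp_opp (He w Hw) -(He' w Hw); field; apply Cexp_neq_0. }
    have M := f_equal Cmod E; rewrite Cmod_Cexp Cmod_1 in M.
    have R0 : Re (l w - l' w)%C = 0 by apply exp_inv; rewrite M exp_0.
    split => //.
    have S := f_equal snd E; rewrite /Cexp R0 exp_0 /= Rmult_1_l in S; exact S. }
  have D u : Cmod (RtoC (clamp u) * q)%C <= Cmod q.
  { have := clamp_01 u => c; rewrite Cmod_mult Cmod_R Rabs_pos_eq; last lra.
    have := Cmod_ge_0 q; nra. }
  have c0 : clamp 0 = 0 by rewrite /clamp Rmin_right ?Rmax_left; lra.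
  have c1 : clamp 1 = 1 by rewrite /clamp Rmin_left ?Rmax_right; lra.
  pose h t := Im (l (RtoC (clamp t) * q)%C) - Im (l' (RtoC (clamp t) * q)%C).
  have Hh t : continuous h t.
  { apply (continuous_minus (V := R_NormedModule)); by apply path_continuous. }
  have h0 : h 0 = 0.
  { rewrite /h c0; have -> : (0 * q = 0)%C by ring. rewrite H0 H0'; ring. }
  have Hs t : sin (h t) = 0 by exact: (proj2 (key _ (D t))).
  have h1 : h 1 = 0.
  { apply Classical_Prop.NNPP => Hne.
    have PI3 : 1 < PI by have := PI2_1; lra.
    have [y [Hy0 [Hy1 Hy2]]] : exists y, y <> 0 /\ -1 <= y <= 1 /\ Rmin (h 0) (h 1) <= y <= Rmax (h 0) (h 1).
    { rewrite h0; case: (Rle_lt_dec 0 (h 1)) => Hp.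
      - exists (Rmin (h 1) 1); rewrite (Rmin_left 0 (h 1)) // (Rmax_right 0 (h 1)) // /Rmin; destruct (Rle_dec (h 1) 1); (split; [first [exact Hne | lra] | split; lra]).
      - exists (Rmax (h 1) (-1)); rewrite (Rmin_right 0 (h 1)); last lra. rewrite (Rmax_left 0 (h 1)); last lra.
        rewrite /Rmax; destruct (Rle_dec (h 1) (-1)); (split; [first [exact Hne | lra] | split; lra]). }
    have [t [_ Ht]] := IVT_gen h 0 1 y (fun t => proj2 (continuity_pt_filterlim h t) (Hh t)) Hy2.
    have := Hs t; rewrite Ht => S.
    case: (Rtotal_order y 0) => [Hlt|[//|Hgt]].
    - have := sin_gt_0 (- y) ltac:(lra) ltac:(lra); rewrite sin_neg; lra.
    - have := sin_gt_0 y ltac:(lra) ltac:(lra); lra. }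
  have [R1 _] := key q (Rle_refl _).
  have q1 : (RtoC (clamp 1) * q = q)%C by rewrite c1; ring.
  rewrite /h q1 in h1.
  apply injective_projections.
  - have R2 : Re (l q) - Re (l' q) = 0 by exact R1.
    rewrite /Re in R2; lra.
  - rewrite /Im in h1; lra.
Qed.

(** In the terms with [j = 1] this difference at [q] is the combined factor of [ln tau]; it matches
    the exponent of [tau^(q / tau)]. *)
Lemma bernoulli_poly_2_step w : (bernoulli_poly 2 (1 + w) - bernoulli_poly 2 w = 2 * w)%C.
Proof.
  have b0 : bc 3 0 = 1 by rewrite /bc /Binomial.C /=; field.
  have b1 : bc 3 1 = 3 by rewrite /bc /Binomial.C /=; field.
  have b2 : bc 3 2 = 3 by rewrite /bc /Binomial.C /=; field.
  have t0 : RtoC 3 <> 0 by apply RtoC_neq_0; lra.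
  have E v : bernoulli_poly 2 v = (v * v - / RtoC 3 - (v - RtoC (/ 2)))%C.
  { have := bernoulli_poly_rec 2 v; rewrite !csum_S b0 b1 b2 bernoulli_poly_at_0 bernoulli_poly_at_1.
    have -> : csum (fun j => RtoC (bc 3 j) * bernoulli_poly j v)%C 0 = RtoC 0 by [].
    have -> : INR 3 = 3 by rewrite /=; ring.
    move=> H.
    have -> : bernoulli_poly 2 v = (/ RtoC 3 * ((0 + 1 * 1 + RtoC 3 * (v - RtoC (/ 2)) + RtoC 3 * bernoulli_poly 2 v) - 1 - RtoC 3 * (v - RtoC (/ 2))))%C by field.
    rewrite H /=; by field. }
  rewrite !E; have -> : RtoC 2 = (1 + 1)%C by rewrite -RtoC_plus. ring.
Qed.

(** * An explicit branch of the logarithm of the product *)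

Definition logG2 (tau a : R) (u : C) : C := log_Gamma2 (RtoC (tau * a) + u)%C tau.

(** Written factor by factor, it is a genuine function of [w], since [log_Gamma2] is defined as a
    derivative and not by a choice of branch. *)
Definition lbranch (lambda1 lambda2 tau : R) (w : C) : C :=
  (w / RtoC tau * RtoC (ln tau) - w * RtoC (lnG (1 - 1 / tau))
   + (logG2 tau (1 + lambda1 + lambda2) (1 - w) - logG2 tau (1 + lambda1 + lambda2) 1)
   + (logG2 tau 1 (- w) - logG2 tau 1 0)
   - (logG2 tau (1 + lambda1) (1 - w) - logG2 tau (1 + lambda1) 1)
   - (logG2 tau (1 + lambda2) (1 - w) - logG2 tau (1 + lambda2) 1))%C.

Lemma lbranch_0 lambda1 lambda2 tau : lbranch lambda1 lambda2 tau 0 = 0.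
Proof.
  rewrite /lbranch.
  have -> : (1 - 0 = 1)%C by ring. have -> : (- 0 = 0)%C by ring.
  rewrite /Cdiv; ring.
Qed.

Lemma Cexp_minus a b : Cexp (a - b)%C = (Cexp a / Cexp b)%C.
Proof. by rewrite /Cminus Cexp_plus Cexp_opp. Qed.

Lemma lbranch_exp lambda1 lambda2 tau w : 1 < tau ->
  Cexp (lbranch lambda1 lambda2 tau w) = frakM w tau lambda1 lambda2.
Proof.
  move=> Ht.
  have P : 0 < 1 - 1 / tau.
  { have -> : 1 - 1 / tau = (tau - 1) / tau by field; lra. apply Rdiv_lt_0_compat; lra. }
  rewrite /frakM Cpower_RtoC; last lra.
  rewrite Cpower_RtoC; last by apply Gamma_pos.
  rewrite /Gamma2 /xp.
  have -> : (RtoC (tau * (lambda1 + lambda2 + 1) + 1) - w = RtoC (tau * (1 + lambda1 + lambda2)) + (1 - w))%C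
    by rewrite !(RtoC_plus, RtoC_mult); ring.
  have -> : RtoC (tau * (lambda1 + lambda2 + 1) + 1) = (RtoC (tau * (1 + lambda1 + lambda2)) + 1)%C
    by rewrite !(RtoC_plus, RtoC_mult); ring.
  have -> : (- w + RtoC tau = RtoC (tau * 1) + - w)%C by rewrite Rmult_1_r; ring.
  have {2}-> : RtoC tau = (RtoC (tau * 1) + 0)%C by rewrite Rmult_1_r; ring.
  have e (lam : R) : (RtoC (tau * (1 + lam) + 1) - w = RtoC (tau * (1 + lam)) + (1 - w))%C
    by rewrite RtoC_plus; ring.
  rewrite !e !(RtoC_plus (tau * (1 + lambda1))) !(RtoC_plus (tau * (1 + lambda2))).
  rewrite /lbranch /logG2 /lnG.
  rewrite !(Cexp_plus, Cexp_minus, Cexp_opp).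
  field; repeat split; apply Cexp_neq_0.
Qed.

(** * The asymptotic expansion *)

Definition coef (lambda1 lambda2 : R) (q : C) (p : nat) : C :=
  (RtoC (/ INR p)%R *
    (RtoC (hurwitz_zeta p (1 + lambda1 + lambda2)
           - hurwitz_zeta p (1 + lambda1) - hurwitz_zeta p (1 + lambda2))%R
       * ((bernoulli_poly (p + 1) q - RtoC (bernoulli (p + 1)))
          / RtoC (INR (p + 1)))
     + RtoC (zeta p)
       * ((bernoulli_poly (p + 1) (q + RtoC 1) - RtoC (bernoulli (p + 1)))
          / RtoC (INR (p + 1)))
     - q * RtoC (zeta p)))%C.

Lemma Cpow_m1_sqr n : ((- (1)) ^ n * (- (1)) ^ n = 1)%C.
Proof.
  rewrite -Cpow_mult_l; have -> : (- (1) * - (1) = RtoC 1)%C by ring. apply Cpow_1_l.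
Qed.

(** The sign [(-1)^(p + 2)] from reflection meets [- (-1)^(p + 1)] in [gam]. Besides the coefficient
    of the theorem there remain the term in [q] that [lnG (1 - 1 / tau)] removes and, for [p = 0],
    the term in [ln tau]. *)
Lemma gam_term c lambda1 lambda2 tau q p : 1 <= tau ->
  ((bernoulli_poly (S (S p)) (1 - q) - bernoulli_poly (S (S p)) 1) *
     (gam c tau (1 + lambda1 + lambda2) (S p) - gam c tau (1 + lambda1) (S p) - gam c tau (1 + lambda2) (S p)) +
   (bernoulli_poly (S (S p)) (- q) - bernoulli_poly (S (S p)) 0) * gam c tau 1 (S p) =
   coef lambda1 lambda2 q (S p) / RtoC (tau ^ S p) + q * RtoC (zeta (S p) / (INR (S p) * tau ^ S p))
   - match p with O => q / RtoC tau * RtoC (ln tau) | _ => 0 end)%C.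
Proof.
  move=> Ht.
  (* Puts [- q] in the form required by reflection; the argument [q + 1] of the theorem comes from
     here. *)
  have -> : (- q = 1 - (q + 1))%C by ring.
  have -> : bernoulli_poly (S (S p)) 1 = ((- (1)) ^ S (S p) * RtoC (bernoulli (S (S p))))%C.
  { have E := bernoulli_poly_reflect (S (S p)) 0; rewrite bernoulli_poly_0 in E.
    rewrite -E; congr bernoulli_poly; ring. }
  rewrite !bernoulli_poly_reflect bernoulli_poly_0.
  rewrite -{2}(bernoulli_sign (S (S p))); last lia.
  rewrite (Cpow_S _ (S p)).
  have sq := Cpow_m1_sqr (S p).
  have tp : tau ^ S p <> 0 by apply pow_nonzero; lra.
  have p1 : INR (S p) >= 1 by rewrite S_INR; have := pos_INR p; lra.
  have P1 : INR (S p) <> 0 by lra.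
  have P2 : INR (S (S p)) <> 0 by rewrite (S_INR (S p)); lra.
  rewrite /coef /gam /zeta.
  have -> : (S p + 1 = S (S p))%nat by lia.
  have sgE : RtoC ((-1) ^ S p) = ((- (1)) ^ S p)%C by rewrite RtoC_pow; congr Cpow; rewrite -RtoC_opp.
  have b2 := bernoulli_poly_2_step q.
  (* The [ln tau] parts of the first three [gam] add up to minus a single one, which leaves a
     difference of two Bernoulli polynomials; it matters only for [p = 0]. *)
  have L : (- (- (1)) ^ S p * RtoC (if Nat.eqb (S p) 1 then ln tau else 0) *
      (bernoulli_poly (S (S p)) (q + 1) - bernoulli_poly (S (S p)) q) / (RtoC (INR (S (S p))) * RtoC (tau ^ S p)) =
     match p with O => q / RtoC tau * RtoC (ln tau) | _ => 0 end)%C.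
  { case: p {sq tp p1 P1 P2 sgE} => [|p]; last by rewrite /=; rewrite /Cdiv; ring.
    rewrite (Cplus_comm q) b2 pow_1 Cpow_1_r.
    have -> : RtoC (INR 2) = RtoC 2 by [].
    rewrite /=; field; try split; apply RtoC_neq_0; lra. }
  move: (bernoulli_poly (S (S p)) (q + 1)) (bernoulli_poly (S (S p)) q) L => Bq1 Bq.
  move: (RtoC (bernoulli (S (S p)))) => B.
  move: (if Nat.eqb (S p) 1 then ln tau else 0) => lt.
  move: (match p with O => q / RtoC tau * RtoC (ln tau) | _ => 0 end)%C => D.
  move: (tau ^ S p) tp ((-1) ^ S p) ((- (1)) ^ S p)%C sgE sq => P tp sgr sg sgE sq.
  move: (hurwitz_zeta (S p)) => z L.
  have e x : RtoC ((- (sgr * x / INR (S p)) - lt) / (INR (S (S p)) * P)) =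
    ((- (sg * RtoC x / RtoC (INR (S p))) - RtoC lt) / (RtoC (INR (S (S p))) * RtoC P))%C.
  { rewrite RtoC_div; last by apply Rmult_integral_contrapositive_currified.
    rewrite RtoC_minus RtoC_opp RtoC_div // !RtoC_mult sgE //. }
  rewrite !e RtoC_div; last by apply Rmult_integral_contrapositive_currified.
  rewrite RtoC_inv // !RtoC_minus RtoC_mult -L.
  move: (RtoC (INR (S p))) (RtoC (INR (S (S p)))) (RtoC P) (RtoC_neq_0 _ P1) (RtoC_neq_0 _ P2) (RtoC_neq_0 _ tp) => n1 n2 PC h1 h2 h3.
  transitivity ((sg * sg) * ((Bq - B) * ((RtoC (z (1 + lambda1 + lambda2)%R) - RtoC (z (1 + lambda1)%R) - RtoC (z (1 + lambda2)%R)) / n1) +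
     (Bq1 - B) * (RtoC (z 1) / n1)) / (n2 * PC) + sg * RtoC lt * (Bq1 - Bq) / (n2 * PC))%C.
  { field; tauto. }
  rewrite sq; field; tauto.
Qed.

Lemma sum_n_m_csum (u : nat -> C) N : sum_n_m (G := C_AbelianMonoid) u 1 N = csum (fun p => u (S p)) N.
Proof.
  elim: N => [|N IH]; first by rewrite sum_n_m_zero //; lia.
  rewrite sum_n_Sm; last lia. by rewrite IH.
Qed.

Lemma csum_first (x : C) M : (1 <= M)%nat -> csum (fun p => match p with O => x | _ => RtoC 0 end) M = x.
Proof.
  case: M => [|M] H; first lia.
  rewrite csum_S_l csum_zero //; ring.
Qed.

Lemma lbranch_asymptotic lambda1 lambda2 q M :
  0 < 1 + lambda1 -> 0 < 1 + lambda2 -> 0 < 1 + lambda1 + lambda2 -> (5 <= M)%nat ->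
  exists K T, 0 <= K /\ 1 <= T /\ forall tau, T <= tau ->
  Cmod (lbranch lambda1 lambda2 tau q -
    (q * RtoC (lnG (1 + lambda1 + lambda2) - lnG (1 + lambda1) - lnG (1 + lambda2)) +
     csum (fun p => coef lambda1 lambda2 q (S p) / RtoC (tau ^ S p)) M))%C <= K * / tau ^ (M - 2).
Proof.
  move=> h1 h2 h12 HM.
  (* The order is [S M] because [j = 0] gives the constant term. One [c] serves the four values of
     [a], so that it can cancel. *)
  have [c Hc] := log_Gamma2_expansion (S M) ltac:(lia).
  (* Bounds the four arguments [1 - q], [1], [- q] and [0]. *)
  pose W := Cmod q + 2.
  have q0 := Cmod_ge_0 q.
  have W1 : 1 <= W by rewrite /W; lra.
  have [Ka [Ta [Ka0 [Ta1 HA]]]] := Hc (1 + lambda1 + lambda2) W h12 W1.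
  have [Kb [Tb [Kb0 [Tb1 HB]]]] := Hc 1 W Rlt_0_1 W1.
  have [Kc [Tc [Kc0 [Tc1 HC]]]] := Hc (1 + lambda1) W h1 W1.
  have [Kd [Td [Kd0 [Td1 HD]]]] := Hc (1 + lambda2) W h2 W1.
  have [Kg [Kg0 HG]] := lnG_1m_expansion M ltac:(lia).
  exists (Cmod q * (Kg + Ka + Kb + Kc + Kd)), (Ta + Tb + Tc + Td + 2).
  split; first by apply Rmult_le_pos; lra.
  split; first lra.
  move=> tau Ht.
  have w1 : Cmod (1 - q)%C <= W by apply: Rle_trans (Cmod_triangle_minus _ _) _; rewrite Cmod_1 /W; lra.
  have w2 : Cmod 1 <= W by rewrite Cmod_1.
  have w3 : Cmod (- q)%C <= W by rewrite Cmod_opp /W; lra.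
  have w4 : Cmod 0 <= W by rewrite Cmod_0; lra.
  have {}HA := HA tau _ _ ltac:(lra) w1 w2.
  have {}HB := HB tau _ _ ltac:(lra) w3 w4.
  have {}HC := HC tau _ _ ltac:(lra) w1 w2.
  have {}HD := HD tau _ _ ltac:(lra) w1 w2.
  have {}HG := HG tau ltac:(lra).
  have d1 : Cmod (1 - q - 1)%C = Cmod q by rewrite -(Cmod_opp q); congr Cmod; ring.
  have d2 : Cmod (- q - 0)%C = Cmod q by rewrite -(Cmod_opp q); congr Cmod; ring.
  rewrite d1 in HA HC HD; rewrite d2 in HB.
  have eM : (S M - 3 = M - 2)%nat by lia.
  rewrite eM in HA HB HC HD.
  have t1 : 1 <= tau by lra.
  pose X a w v := csum (fun j => (bernoulli_poly (S j) w - bernoulli_poly (S j) v) * gam c tau a j)%C (S M).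
  rewrite -/(X _ _ _) in HA; rewrite -/(X _ _ _) in HB; rewrite -/(X _ _ _) in HC; rewrite -/(X _ _ _) in HD.
  pose G := RtoC (rsum (fun p => zeta (S p) / (INR (S p) * tau ^ S p)) M).
  have main : (q / RtoC tau * RtoC (ln tau) - q * G + X (1 + lambda1 + lambda2)%R (1 - q) 1 + X 1%R (- q) 0
      - X (1 + lambda1)%R (1 - q) 1 - X (1 + lambda2)%R (1 - q) 1 =
     q * RtoC (lnG (1 + lambda1 + lambda2) - lnG (1 + lambda1) - lnG (1 + lambda2)) +
     csum (fun p => coef lambda1 lambda2 q (S p) / RtoC (tau ^ S p)) M)%C.
  { pose T j := ((bernoulli_poly (S j) (1 - q) - bernoulli_poly (S j) 1) *
       (gam c tau (1 + lambda1 + lambda2) j - gam c tau (1 + lambda1) j - gam c tau (1 + lambda2) j) +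
       (bernoulli_poly (S j) (- q) - bernoulli_poly (S j) 0) * gam c tau 1 j)%C.
    have E : (X (1 + lambda1 + lambda2)%R (1 - q) 1 + X 1%R (- q) 0 - X (1 + lambda1)%R (1 - q) 1 - X (1 + lambda2)%R (1 - q) 1 = csum T (S M))%C.
    { rewrite /X -csum_plus -!csum_minus; apply csum_ext => j; rewrite /T; ring. }
    (* All differences of [B_1] equal [- q]. The total factor of [c] is [1 - 1 - 1 + 1 = 0], and the
       [ln tau] parts cancel because the values [a - 1/2] have equal sums over numerators and
       denominators. *)
    have T0 : T 0%nat = (q * RtoC (lnG (1 + lambda1 + lambda2) - lnG (1 + lambda1) - lnG (1 + lambda2)))%C.
    { have l1 : lnG 1 = 0 by rewrite /lnG Gamma_1 ln_1.
      rewrite /T !bernoulli_poly_at_1 /gam l1 !(RtoC_plus, RtoC_minus, RtoC_mult).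
      have -> : RtoC 1 = (RtoC (/ 2) + RtoC (/ 2))%C by rewrite -RtoC_plus; congr RtoC; field.
      ring. }
    have TS p : T (S p) = (coef lambda1 lambda2 q (S p) / RtoC (tau ^ S p) + q * RtoC (zeta (S p) / (INR (S p) * tau ^ S p))
       - match p with O => q / RtoC tau * RtoC (ln tau) | _ => 0 end)%C := gam_term c lambda1 lambda2 tau q p t1.
    have SM : csum (fun p => T (S p)) M = (csum (fun p => coef lambda1 lambda2 q (S p) / RtoC (tau ^ S p)) M + q * G
       - q / RtoC tau * RtoC (ln tau))%C.
    { rewrite (csum_ext _ _ M TS) csum_minus csum_plus csum_scal csum_RtoC csum_first //; lia. }
    transitivity (q / RtoC tau * RtoC (ln tau) - q * G + csum T (S M))%C; first by rewrite -E; ring.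
    rewrite csum_S_l T0 SM; ring. }
  rewrite -main /lbranch.
  rewrite -/(logG2 tau _ _) -/(logG2 tau _ _) in HA.
  rewrite -/(logG2 tau _ _) -/(logG2 tau _ _) in HB.
  rewrite -/(logG2 tau _ _) -/(logG2 tau _ _) in HC.
  rewrite -/(logG2 tau _ _) -/(logG2 tau _ _) in HD.
  have EG : Cmod (RtoC (lnG (1 - 1 / tau)) - G)%C <= Kg * / tau ^ (M - 2).
  { rewrite /G -RtoC_minus Cmod_R; apply: Rle_trans HG _.
    apply Rmult_le_compat_l => //; apply Rinv_le_contravar; first by apply pow_lt; lra.
    apply Rle_pow; [lra | lia]. }
  move: (logG2 tau) HA HB HC HD => F HA HB HC HD.
  move: (X (1 + lambda1 + lambda2)%R (1 - q)%C 1) (X 1%R (- q)%C 0) (X (1 + lambda1)%R (1 - q)%C 1) (X (1 + lambda2)%R (1 - q)%C 1) HA HB HC HD {main} => xa xb xc xd HA HB HC HD.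
  set A := (F (1 + lambda1 + lambda2)%R (1 - q) - F (1 + lambda1 + lambda2)%R 1)%C in HA *.
  set B := (F 1%R (- q) - F 1 0)%C in HB *.
  set C1 := (F (1 + lambda1)%R (1 - q) - F (1 + lambda1)%R 1)%C in HC *.
  set D := (F (1 + lambda2)%R (1 - q) - F (1 + lambda2)%R 1)%C in HD *.
  have -> : (q / RtoC tau * RtoC (ln tau) - q * RtoC (lnG (1 - 1 / tau)) + A + B - C1 - D -
     (q / RtoC tau * RtoC (ln tau) - q * G + xa + xb - xc - xd) =
     (A - xa) + (B - xb) - (C1 - xc) - (D - xd) - q * (RtoC (lnG (1 - 1 / tau)) - G))%C by ring.
  apply: Rle_trans (Cmod_triangle_minus _ _) _; rewrite Cmod_mult.
  have T1 := Cmod_triangle_minus (A - xa + (B - xb) - (C1 - xc))%C (D - xd)%C.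
  have T2 := Cmod_triangle_minus (A - xa + (B - xb))%C (C1 - xc)%C.
  have T3 := Cmod_triangle (A - xa)%C (B - xb)%C.
  have T4 := Rmult_le_compat_l _ _ _ q0 EG.
  lra.
Qed.

(** Only continuity in [w] is wanted, so a fixed order is enough and [K] may depend on [tau]; the
    threshold on [tau] serves the whole disc. *)
Lemma lbranch_Lipschitz lambda1 lambda2 q :
  0 < 1 + lambda1 -> 0 < 1 + lambda2 -> 0 < 1 + lambda1 + lambda2 ->
  exists T, 1 <= T /\ forall tau, T <= tau -> exists K, forall w v, Cmod w <= Cmod q -> Cmod v <= Cmod q ->
    Cmod (lbranch lambda1 lambda2 tau w - lbranch lambda1 lambda2 tau v)%C <= K * Cmod (w - v)%C.
Proof.
  move=> h1 h2 h12.
  have [c Hc] := log_Gamma2_expansion 6 ltac:(lia).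
  pose W := Cmod q + 2.
  have q0 := Cmod_ge_0 q.
  have W1 : 1 <= W by rewrite /W; lra.
  have one a : 0 < a -> exists T, 1 <= T /\ forall tau, T <= tau -> exists K, forall w v, Cmod w <= W -> Cmod v <= W ->
     Cmod (logG2 tau a w - logG2 tau a v)%C <= K * Cmod (w - v)%C.
  { move=> Ha; have [K [T [K0 [T1 H]]]] := Hc a W Ha W1.
    exists T; split => // tau Ht.
    have [B [B0 [_ HB]]] := bernoulli_poly_bounds 6 W ltac:(lra).
    exists (rsum (fun j => B * Cmod (gam c tau a j)) 6 + K * / tau ^ (6 - 3)) => w v Hw Hv.
    have {}H := H tau w v Ht Hw Hv.
    set X := csum _ 6 in H.
    have HX : Cmod X <= rsum (fun j => B * Cmod (gam c tau a j)) 6 * Cmod (w - v)%C.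
    { apply: Rle_trans (Cmod_csum _ _) _.
      rewrite Rmult_comm -rsum_scal; apply rsum_le_lt => j Hj.
      rewrite Cmod_mult -Rmult_assoc; apply Rmult_le_compat_r; first apply Cmod_ge_0.
      rewrite Rmult_comm; apply HB => //; lia. }
    have := Cmod_le_sub (logG2 tau a w - logG2 tau a v)%C X.
    rewrite /logG2; lra. }
  have [Ta [Ta1 HA]] := one _ h12. have [Tb [Tb1 HB]] := one 1 Rlt_0_1.
  have [Tc [Tc1 HC]] := one _ h1. have [Td [Td1 HD]] := one _ h2.
  exists (Ta + Tb + Tc + Td); split; first lra.
  move=> tau Ht.
  have [Ka {}HA] := HA tau ltac:(lra). have [Kb {}HB] := HB tau ltac:(lra).
  have [Kc {}HC] := HC tau ltac:(lra). have [Kd {}HD] := HD tau ltac:(lra).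
  pose cst := (RtoC (ln tau) / RtoC tau - RtoC (lnG (1 - 1 / tau)))%C.
  exists (Cmod cst + Ka + Kb + Kc + Kd) => w v Hw Hv.
  have b1 u : Cmod u <= Cmod q -> Cmod (1 - u)%C <= W.
  { move=> Hu; apply: Rle_trans (Cmod_triangle_minus _ _) _; rewrite Cmod_1 /W; lra. }
  have b2 u : Cmod u <= Cmod q -> Cmod (- u)%C <= W by move=> Hu; rewrite Cmod_opp /W; lra.
  have {}HA := HA _ _ (b1 w Hw) (b1 v Hv). have {}HB := HB _ _ (b2 w Hw) (b2 v Hv).
  have {}HC := HC _ _ (b1 w Hw) (b1 v Hv). have {}HD := HD _ _ (b1 w Hw) (b1 v Hv).
  have d1 : Cmod (1 - w - (1 - v))%C = Cmod (w - v)%C by rewrite Cmod_sub_sym; congr Cmod; ring.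
  have d2 : Cmod (- w - - v)%C = Cmod (w - v)%C by rewrite Cmod_sub_sym; congr Cmod; ring.
  rewrite d1 in HA HC HD; rewrite d2 in HB.
  rewrite /lbranch.
  move: (logG2 tau) HA HB HC HD => F HA HB HC HD.
  set A := (F (1 + lambda1 + lambda2)%R (1 - w) - F (1 + lambda1 + lambda2)%R (1 - v))%C in HA.
  set B := (F 1%R (- w) - F 1%R (- v))%C in HB.
  set C1 := (F (1 + lambda1)%R (1 - w) - F (1 + lambda1)%R (1 - v))%C in HC.
  set D := (F (1 + lambda2)%R (1 - w) - F (1 + lambda2)%R (1 - v))%C in HD.
  match goal with |- Cmod ?x <= _ => have -> : x = (cst * (w - v) + A + B - C1 - D)%C by rewrite /cst /A /B /C1 /D /Cdiv; ring end.
  have T1 := Cmod_triangle_minus (cst * (w - v) + A + B - C1)%C D.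
  have T2 := Cmod_triangle_minus (cst * (w - v) + A + B)%C C1.
  have T3 := Cmod_triangle (cst * (w - v) + A)%C B.
  have T4 := Cmod_triangle (cst * (w - v))%C A.
  rewrite Cmod_mult in T4.
  lra.
Qed.

Lemma lbranch_is_log_branch lambda1 lambda2 q :
  0 < 1 + lambda1 -> 0 < 1 + lambda2 -> 0 < 1 + lambda1 + lambda2 ->
  exists T, 1 <= T /\ forall tau, T <= tau ->
    is_log_branch (fun w => frakM w tau lambda1 lambda2) q (lbranch lambda1 lambda2 tau q).
Proof.
  move=> h1 h2 h12; have [T [T1 H]] := lbranch_Lipschitz lambda1 lambda2 q h1 h2 h12.
  exists (T + 1); split; first lra.
  move=> tau Ht; have [K HK] := H tau ltac:(lra).
  exists (lbranch lambda1 lambda2 tau); split; [|split; [|split]] => //.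
  - apply: Lipschitz_continuous_on HK.
  - move=> w _; apply lbranch_exp; lra.
  - apply lbranch_0.
Qed.

(** The given bound loses two powers of [tau]. With [M = P + 5] it is still [O(tau^(- P - 1))], and
    so are the five extra terms. *)
Lemma asymptotic_of_bound (F : R -> C) c0 (cf : nat -> C) :
  (forall M, (5 <= M)%nat -> exists K T, 0 <= K /\ 1 <= T /\ forall tau, T <= tau ->
    Cmod (F tau - (c0 + csum (fun p => cf (S p) / RtoC (tau ^ S p)) M))%C <= K * / tau ^ (M - 2)) ->
  is_asymptotic_expansion F c0 cf.
Proof.
  move=> H P; have [K [T [K0 [T1 HK]]]] := H (P + 5)%nat ltac:(lia).
  pose B := rsum (fun i => Cmod (cf (S (P + i)))) 5 + K.
  have B0 : 0 <= B.
  { have := rsum_nonneg (fun i => Cmod (cf (S (P + i)))) 5 (fun i => Cmod_ge_0 _); rewrite /B; lra. }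
  have key tau : T <= tau -> Cmod (RtoC (tau ^ P) * (F tau - (c0 + sum_n_m (fun p => cf p / RtoC (tau ^ p)) 1 P)))%C <= B / tau.
  { move=> Ht; have {}HK := HK tau Ht.
    have -> : sum_n_m (fun p => (cf p / RtoC (tau ^ p))%C) 1 P = csum (fun p => cf (S p) / RtoC (tau ^ S p))%C P
      by apply (sum_n_m_csum (fun p => cf p / RtoC (tau ^ p))%C).
    rewrite csum_shift in HK.
    set X := csum _ P in HK *; set Y := csum _ 5 in HK.
    have t0 : 0 < tau by lra.
    have tp n : 0 < tau ^ n by apply pow_lt.
    have HY : Cmod Y <= rsum (fun i => Cmod (cf (S (P + i)))) 5 * / tau ^ S P.
    { apply: Rle_trans (Cmod_csum _ _) _.
      rewrite Rmult_comm -rsum_scal; apply rsum_le => i.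
      rewrite Cmod_div; last by apply RtoC_neq_0; have := tp (S (P + i)); lra.
      rewrite Cmod_R Rabs_pos_eq; last by apply Rlt_le.
      rewrite /Rdiv Rmult_comm; apply Rmult_le_compat_r; first apply Cmod_ge_0.
      apply Rinv_le_contravar => //; apply Rle_pow; [lra | lia]. }
    have HK2 : Cmod (F tau - (c0 + (X + Y)))%C <= K * / tau ^ S P.
    { apply: Rle_trans HK _; apply Rmult_le_compat_l => //.
      apply Rinv_le_contravar => //; apply Rle_pow; [lra | lia]. }
    have -> : (F tau - (c0 + X) = (F tau - (c0 + (X + Y))) + Y)%C by ring.
    rewrite Cmod_mult Cmod_R Rabs_pos_eq; last by apply Rlt_le.
    have Tr := Cmod_triangle (F tau - (c0 + (X + Y)))%C Y.
    have SB : Cmod (F tau - (c0 + (X + Y)) + Y)%C <= B * / tau ^ S P by rewrite /B; lra.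
    have := Rmult_le_compat_l _ _ _ (Rlt_le _ _ (tp P)) SB.
    have -> : tau ^ P * (B * / tau ^ S P) = B / tau.
    { rewrite -tech_pow_Rmult; field; split; [lra | have := tp P; lra]. }
    done. }
  apply (filterlim_locally (U := C_UniformSpace)) => eps.
  exists (Rmax T (B / eps)) => tau Ht.
  have e0 := cond_pos eps.
  have h1 : T < tau by apply: Rle_lt_trans Ht; apply Rmax_l.
  have h2 : B / eps < tau by apply: Rle_lt_trans Ht; apply Rmax_r.
  apply ball_Cmod.
  have -> : forall x : C, (x - 0 = x)%C by move=> x; ring.
  apply: Rle_lt_trans (key tau (Rlt_le _ _ h1)) _.
  apply (Rmult_lt_reg_r tau); first lra.
  have -> : B / tau * tau = B by field; lra.
  have := Rmult_lt_compat_r eps _ _ e0 h2.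
  have -> : B / eps * eps = B by field; lra.
  lra.
Qed.

(** The first conjunct shows that the hypothesis on [logM] can be met; by uniqueness every such
    [logM] eventually equals [lbranch], for which the bounds are proved. *)
Theorem theorem7 (lambda1 lambda2 : R) (q : C)
  (h1 : 0 < 1 + lambda1) (h2 : 0 < 1 + lambda2)
  (h12 : 0 < 1 + lambda1 + lambda2) :
  Rbar_locally p_infty (fun tau : R =>
    exists L : C,
      is_log_branch (fun w : C => frakM w tau lambda1 lambda2) q L)
  /\
  forall logM : R -> C,
    Rbar_locally p_infty (fun tau : R =>
      is_log_branch (fun w : C => frakM w tau lambda1 lambda2) q (logM tau)) ->
    is_asymptotic_expansion logM
      (q * RtoC (ln (Gamma (1 + lambda1 + lambda2))
                 - ln (Gamma (1 + lambda1)) - ln (Gamma (1 + lambda2)))%R)%C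
      (fun p : nat =>
         (RtoC (/ INR p)%R *
          (RtoC (hurwitz_zeta p (1 + lambda1 + lambda2)
                 - hurwitz_zeta p (1 + lambda1) - hurwitz_zeta p (1 + lambda2))%R
             * ((bernoulli_poly (p + 1) q - RtoC (bernoulli (p + 1)))
                / RtoC (INR (p + 1)))
           + RtoC (zeta p)
             * ((bernoulli_poly (p + 1) (q + RtoC 1) - RtoC (bernoulli (p + 1)))
                / RtoC (INR (p + 1)))
           - q * RtoC (zeta p)))%C).
Proof.
  have [T0 [T01 H0]] := lbranch_is_log_branch lambda1 lambda2 q h1 h2 h12.
  split.
  - exists T0 => tau Ht; eexists; apply H0; lra.
  - move=> logM [T1 H1].
    apply (asymptotic_of_bound logM _ (coef lambda1 lambda2 q)) => M HM.
    have [K [T [K0 [T1' HK]]]] := lbranch_asymptotic lambda1 lambda2 q M h1 h2 h12 HM.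
    exists K, (Rmax T (Rmax T0 (T1 + 1))); split => //.
    split; first by apply: Rle_trans (Rmax_l _ _).
    move=> tau Ht.
    have t1 := Rle_trans _ _ _ (Rmax_l _ _) Ht.
    have t2 := Rle_trans _ _ _ (Rmax_r _ _) Ht.
    have t3 := Rle_trans _ _ _ (Rmax_l _ _) t2.
    have t4 := Rle_trans _ _ _ (Rmax_r _ _) t2.
    rewrite (log_branch_unique _ _ _ _ (H1 tau ltac:(lra)) (H0 tau t3)).
    exact (HK tau t1).
Qed.
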